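(* $\mathsf{RCA}_0^\omega$ proves $\mathsf{NIN}\leftrightarrow(\mathsf A)$ and $(\mathsf B)\to\mathsf{NIN}$, where $(\mathsf A)$: for every countable $A\subseteq\mathbb R$ there is $y\in[0,1]$ with $y\neq_{\mathbb R}x$ for all $x\in A$; $(\mathsf B)$: if $A\subseteq[0,1]$ is countable, then $A$ is not perfect. Likewise, $\mathsf{RCA}_0^\omega$ proves $\mathsf{NBI}\leftrightarrow(\mathsf A')$ and $(\mathsf B')\to\mathsf{NBI}$, where $(\mathsf A')$ and $(\mathsf B')$ are $(\mathsf A)$ and $(\mathsf B)$ with ''countable'' replaced by ''strongly countable''.
   Context: Framework: Kohlenbach's higher-order arithmetic; $\mathsf{RCA}_0^\omega$ is the base theory (ordered semiring axioms, combinators/$\lambda$-abstraction, primitive recursion $\mathbf R_0$, extensionality at all finite types, quantifier-free induction, and $\mathsf{QF\text{-}AC}^{1,0}$). Reals are fast-converging Cauchy sequences of rationals with equality $=_{\mathbb R}$. A subset $A\subseteq\mathbb R$ is represented by an arbitrary function $A:\mathbb R\to\mathbb R$, with $x\in A$ meaning $A(x)>0$; $A$ is open if every $x\in A$ has a ball $B(x,r)\subseteq A$, closed if its complement is open, and perfect if it is closed and every point of $A$ is a limit point of $A$. $A$ is countable if there is $Y:\mathbb R\to\mathbb N$ with $(\forall x,y\in A)(Y(x)=Y(y)\to x=_{\mathbb R}y)$, strongly countable if moreover $(\forall n\in\mathbb N)(\exists x\in A)(Y(x)=n)$. $\mathsf{NIN}$: for every $Y:[0,1]\to\mathbb N$ there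 are $x,y\in[0,1]$ with $x\neq_{\mathbb R}y$ and $Y(x)=Y(y)$. $\mathsf{NBI}$: for every $Y:[0,1]\to\mathbb N$, either there are $x,y\in[0,1]$ with $x\ne_{\mathbb R}y$ and $Y(x)=Y(y)$, or there is $N\in\mathbb N$ with $(\forall x\in[0,1])(Y(x)\neq N)$. *)

(* Defs.v *)
From Stdlib Require Import List.
Import ListNotations.

Inductive ty : Type := ty0 : ty | Arr : ty -> ty -> ty.

Declare Scope ty_scope.
Delimit Scope ty_scope with ty.
Bind Scope ty_scope with ty.
Notation "a ~> b" := (Arr a b) (at level 55, right associativity) : ty_scope.
Local Open Scope ty_scope.

Definition ty1 : ty := ty0 ~> ty0.
Definition ty2 : ty := ty1 ~> ty0.

Definition ctx := list ty.

Inductive var : ctx -> ty -> Type :=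
| vz : forall G a, var (a :: G) a
| vs : forall G a b, var G a -> var (b :: G) a.
Arguments vz {G a}.
Arguments vs {G a b} _.

(** [Pi], [Sigma] are the combinators K, S; [Rec] is the recursor R_0. *)
Inductive cst : ty -> Type :=
| Zero : cst ty0
| One : cst ty0
| Plus : cst (ty0 ~> ty0 ~> ty0)
| Times : cst (ty0 ~> ty0 ~> ty0)
| Pi : forall a b, cst (a ~> b ~> a)
| Sigma : forall a b c, cst ((a ~> b ~> c) ~> (a ~> b) ~> a ~> c)
| Rec : cst ((ty0 ~> ty0 ~> ty0) ~> ty0 ~> ty0 ~> ty0).

Inductive tm (G : ctx) : ty -> Type :=
| Var : forall a, var G a -> tm G a
| Cst : forall a, cst a -> tm G a
| App : forall a b, tm G (a ~> b) -> tm G a -> tm G b.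
Arguments Var {G a} _.
Arguments Cst {G a} _.
Arguments App {G a b} _ _.

Inductive fm (G : ctx) : Type :=
| FBot : fm G
| FEq : tm G ty0 -> tm G ty0 -> fm G
| FLt : tm G ty0 -> tm G ty0 -> fm G
| FImp : fm G -> fm G -> fm G
| FAll : forall a, fm (a :: G) -> fm G.
Arguments FBot {G}.
Arguments FEq {G} _ _.
Arguments FLt {G} _ _.
Arguments FImp {G} _ _.
Arguments FAll {G} a _.

(** The logic is classical, so the other connectives are abbreviations. *)
Definition Neg {G} (A : fm G) : fm G := FImp A FBot.
Definition And {G} (A B : fm G) : fm G := Neg (FImp A (Neg B)).
Definition Or {G} (A B : fm G) : fm G := FImp (Neg A) B.
Definition Iff {G} (A B : fm G) : fm G := And (FImp A B) (FImp B A).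
Definition Ex {G} a (A : fm (a :: G)) : fm G := Neg (FAll a (Neg A)).

Fixpoint qf {G} (A : fm G) : Prop :=
  match A with
  | FBot | FEq _ _ | FLt _ _ => True
  | FImp A B => qf A /\ qf B
  | FAll _ _ => False
  end.

Definition renaming (G D : ctx) := forall a, var G a -> var D a.
Definition substitution (G D : ctx) := forall a, var G a -> tm D a.

Fixpoint ren_tm {G D} (r : renaming G D) {a} (t : tm G a) : tm D a :=
  match t with
  | Var v => Var (r _ v)
  | Cst c => Cst c
  | App s t => App (ren_tm r s) (ren_tm r t)
  end.

Fixpoint subst_tm {G D} (s : substitution G D) {a} (t : tm G a) : tm D a :=
  match t with
  | Var v => s _ v
  | Cst c => Cst c
  | App t u => App (subst_tm s t) (subst_tm s u)
  end.

Definition scons {G D b} (t : tm D b) (s : substitution G D) :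
    substitution (b :: G) D :=
  fun a v =>
    match v in var G' a'
      return match G' with
             | [] => unit
             | c :: G'' => tm D c -> substitution G'' D -> tm D a'
             end
    with
    | vz => fun t _ => t
    | vs v => fun _ s => s _ v
    end t s.

Definition shift {G b} : renaming G (b :: G) := fun _ v => vs v.

Definition lift_subst {G D b} (s : substitution G D) :
    substitution (b :: G) (b :: D) :=
  scons (Var vz) (fun _ v => ren_tm shift (s _ v)).

Fixpoint subst_fm {G} (A : fm G) : forall {D}, substitution G D -> fm D :=
  match A with
  | FBot => fun _ _ => FBot
  | FEq t u => fun _ s => FEq (subst_tm s t) (subst_tm s u)
  | FLt t u => fun _ s => FLt (subst_tm s t) (subst_tm s u)
  | FImp A B => fun _ s => FImp (subst_fm A s) (subst_fm B s)
  | FAll a A => fun _ s => FAll a (subst_fm A (lift_subst s))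
  end.

Definition shift_fm {G b} (A : fm G) : fm (b :: G) :=
  subst_fm A (fun _ v => Var (vs v)).

Definition inst {G b} (A : fm (b :: G)) (t : tm G b) : fm G :=
  subst_fm A (scons t (fun _ v => Var v)).

Definition Icomb {G a} : tm G (a ~> a) :=
  App (App (Cst (Sigma a (a ~> a) a)) (Cst (Pi a (a ~> a)))) (Cst (Pi a a)).

Definition lam_var {G a b} (v : var (a :: G) b) : tm G (a ~> b) :=
  match v in var G' b'
    return match G' with [] => unit | c :: G'' => tm G'' (c ~> b') end
  with
  | vz => Icomb
  | vs v => App (Cst (Pi _ _)) (Var v)
  end.

Fixpoint lam {G a b} (t : tm (a :: G) b) : tm G (a ~> b) :=
  match t with
  | Var v => lam_var v
  | Cst c => App (Cst (Pi _ _)) (Cst c)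
  | App s t => App (App (Cst (Sigma _ _ _)) (lam s)) (lam t)
  end.

(** The variable bound by [ALL x : a, A], [EX x : a, A] or [fn x : a => t] is a
    term over the context of the body.  Under further binders it is used as
    [^x]: weakening to the context at hand, with the inclusion of contexts found
    by instance search. *)

Class Sub (G D : ctx) : Type := sub_var : renaming G D.

#[export] Instance Sub_skip {G D b} (e : Sub G D) : Sub G (b :: D) | 2 :=
  fun a v => vs (e a v).
#[export] Instance Sub_refl {G} : Sub G G | 1 := fun a v => v.

Definition weaken {G D} {e : Sub G D} {a} (t : tm G a) : tm D a := ren_tm e t.

Definition all_ {G} a (A : tm (a :: G) a -> fm (a :: G)) : fm G :=
  FAll a (A (Var vz)).
Definition ex_ {G} a (A : tm (a :: G) a -> fm (a :: G)) : fm G :=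
  Ex a (A (Var vz)).
Definition lam_ {G} a {b} (t : tm (a :: G) a -> tm (a :: G) b) :
    tm G (a ~> b) :=
  lam (t (Var vz)).

Declare Scope tm_scope.
Delimit Scope tm_scope with tm.
Bind Scope tm_scope with tm.
Declare Scope fm_scope.
Delimit Scope fm_scope with fm.
Bind Scope fm_scope with fm.

Notation "^ t" := (weaken t) (at level 9, t at level 9, format "^ t") : tm_scope.
Notation "s @ t" := (App s t) (at level 36, left associativity) : tm_scope.
Notation "0" := (Cst Zero) : tm_scope.
Notation "1" := (Cst One) : tm_scope.
Notation "s + t" := (App (App (Cst Plus) s) t) : tm_scope.
Notation "s * t" := (App (App (Cst Times) s) t) : tm_scope.
Notation "'fn' x : a => t" :=
  (lam_ a%ty (fun x => t%tm))
  (at level 200, x name, a at level 60, t at level 200) : tm_scope.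

Notation "s == t" := (FEq s t) (at level 70) : fm_scope.
Notation "s < t" := (FLt s t) : fm_scope.
Notation "s <= t" := (Or (FLt s t) (FEq s t)) : fm_scope.
Notation "~ A" := (Neg A) (at level 75, right associativity) : fm_scope.
Notation "A /\ B" := (And A B) : fm_scope.
Notation "A \/ B" := (Or A B) : fm_scope.
Notation "A ==> B" := (FImp A B) (at level 88, right associativity) : fm_scope.
Notation "A <==> B" := (Iff A B) (at level 89, no associativity) : fm_scope.
Notation "'ALL' x : a , A" :=
  (all_ a%ty (fun x => A%fm))
  (at level 200, x name, a at level 60, A at level 200) : fm_scope.
Notation "'EX' x : a , A" :=
  (ex_ a%ty (fun x => A%fm))
  (at level 200, x name, a at level 60, A at level 200) : fm_scope.

Local Open Scope tm_scope.
Local Open Scope fm_scope.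

(** Equality at higher types is pointwise. *)
Fixpoint EqT {a} : forall {G}, tm G a -> tm G a -> fm G :=
  match a with
  | ty0 => fun G s t => s == t
  | Arr b c => fun G s t => ALL z : b, EqT (^s @ z) (^t @ z)
  end.

Definition axioms := forall G, fm G -> Prop.

Inductive prv (Ax : axioms) : forall G, list (fm G) -> fm G -> Prop :=
| prv_ax : forall G H A, Ax G A -> prv Ax G H A
| prv_hyp : forall G H A, In A H -> prv Ax G H A
| prv_impI : forall G H A B, prv Ax G (A :: H) B -> prv Ax G H (A ==> B)
| prv_impE : forall G H A B,
    prv Ax G H (A ==> B) -> prv Ax G H A -> prv Ax G H B
| prv_raa : forall G H A, prv Ax G ((~ A) :: H) FBot -> prv Ax G H A
| prv_allI : forall G H a (A : fm (a :: G)),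
    prv Ax (a :: G) (map shift_fm H) A -> prv Ax G H (FAll a A)
| prv_allE : forall G H a (A : fm (a :: G)) t,
    prv Ax G H (FAll a A) -> prv Ax G H (inst A t)
| prv_eq_refl : forall G H t, prv Ax G H (t == t)
| prv_eq_subst : forall G H (A : fm (ty0 :: G)) s t,
    prv Ax G H (s == t) -> prv Ax G H (inst A s) -> prv Ax G H (inst A t).

Inductive semiring_axiom (G : ctx) : fm G -> Prop :=
| sr_add_assoc : semiring_axiom G
    (ALL x : ty0, ALL y : ty0, ALL z : ty0, (^x + ^y) + z == ^x + (^y + z))
| sr_add_comm : semiring_axiom G (ALL x : ty0, ALL y : ty0, ^x + y == y + ^x)
| sr_add_0 : semiring_axiom G (ALL x : ty0, x + 0 == x)
| sr_mul_assoc : semiring_axiom G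
    (ALL x : ty0, ALL y : ty0, ALL z : ty0, (^x * ^y) * z == ^x * (^y * z))
| sr_mul_comm : semiring_axiom G (ALL x : ty0, ALL y : ty0, ^x * y == y * ^x)
| sr_mul_1 : semiring_axiom G (ALL x : ty0, x * 1 == x)
| sr_mul_0 : semiring_axiom G (ALL x : ty0, x * 0 == 0)
| sr_distr : semiring_axiom G
    (ALL x : ty0, ALL y : ty0, ALL z : ty0, ^x * (^y + z) == ^x * ^y + ^x * z)
| sr_lt_irrefl : semiring_axiom G (ALL x : ty0, ~ (x < x))
| sr_lt_trans : semiring_axiom G
    (ALL x : ty0, ALL y : ty0, ALL z : ty0, ^x < ^y ==> ^y < z ==> ^x < z)
| sr_lt_total : semiring_axiom G
    (ALL x : ty0, ALL y : ty0, ^x < y \/ ^x == y \/ y < ^x)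
| sr_lt_add : semiring_axiom G
    (ALL x : ty0, ALL y : ty0, ALL z : ty0, ^x < ^y ==> ^x + z < ^y + z)
| sr_lt_mul : semiring_axiom G
    (ALL x : ty0, ALL y : ty0, ALL z : ty0, 0 < z ==> ^x < ^y ==> ^x * z < ^y * z)
| sr_le_0 : semiring_axiom G (ALL x : ty0, 0 <= x)
| sr_lt_0_1 : semiring_axiom G (0 < 1)
| sr_discrete : semiring_axiom G (ALL x : ty0, 0 < x ==> 1 <= x).

(** [A(n)] becomes [A(n+1)]. *)
Definition subst_succ {G} : substitution (ty0 :: G) (ty0 :: G) :=
  scons (Var vz + 1) (fun _ v => Var (vs v)).

(** In [A(f,n)], [n] is variable 0 and [f] variable 1.  The result is [A(f,Y f)]
    in a context where [f] is variable 0 and [Y] variable 1. *)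
Definition subst_choice {G} : substitution (ty0 :: ty1 :: G) (ty1 :: ty2 :: G) :=
  scons (Var (vs vz) @ Var vz)
    (scons (Var vz) (fun _ v => Var (vs (vs v)))).

Inductive RCA0w : axioms :=
| ax_semiring : forall G A, semiring_axiom G A -> RCA0w G A
| ax_Pi : forall G a b,
    RCA0w G (ALL x : a, ALL y : b, EqT (Cst (Pi a b) @ ^x @ y) ^x)
| ax_Sigma : forall G a b c,
    RCA0w G (ALL x : a ~> b ~> c, ALL y : a ~> b, ALL z : a,
      EqT (Cst (Sigma a b c) @ ^x @ ^y @ z) (^x @ z @ (^y @ z)))
| ax_Rec_0 : forall G,
    RCA0w G (ALL f : ty0 ~> ty0 ~> ty0, ALL m : ty0, Cst Rec @ ^f @ m @ 0 == m)
| ax_Rec_S : forall G,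
    RCA0w G (ALL f : ty0 ~> ty0 ~> ty0, ALL m : ty0, ALL n : ty0,
      Cst Rec @ ^f @ ^m @ (n + 1) == ^f @ n @ (Cst Rec @ ^f @ ^m @ n))
| ax_ext : forall G a b,
    RCA0w G (ALL x : a, ALL y : a, ALL f : a ~> b,
      EqT ^x ^y ==> EqT (f @ ^x) (f @ ^y))
| ax_QF_ind : forall G (A : fm (ty0 :: G)), qf A ->
    RCA0w G (inst A 0 ==> FAll ty0 (A ==> subst_fm A subst_succ) ==> FAll ty0 A)
| ax_QF_AC10 : forall G (A : fm (ty0 :: ty1 :: G)), qf A ->
    RCA0w G (FAll ty1 (Ex ty0 A) ==> Ex ty2 (FAll ty1 (subst_fm A subst_choice))).

Definition RCA0w_proves (A : fm []) : Prop := prv RCA0w [] [] A.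

Definition two {G} : tm G ty0 := 1 + 1.

Definition npred {G} (t : tm G ty0) : tm G ty0 :=
  Cst Rec @ (fn n : ty0 => fn v : ty0 => ^n) @ 0 @ t.

(** Truncated subtraction *)
Definition monus {G} (s t : tm G ty0) : tm G ty0 :=
  Cst Rec @ (fn n : ty0 => fn v : ty0 => npred v) @ s @ t.

(** [1] if [s = t], else [0] *)
Definition eqb {G} (s t : tm G ty0) : tm G ty0 :=
  monus 1 (monus s t + monus t s).

Definition parity {G} (t : tm G ty0) : tm G ty0 :=
  Cst Rec @ (fn n : ty0 => fn v : ty0 => monus 1 v) @ 0 @ t.

Definition half {G} (t : tm G ty0) : tm G ty0 :=
  Cst Rec @ (fn n : ty0 => fn v : ty0 => v + parity ^n) @ 0 @ t.

Definition pow2 {G} (t : tm G ty0) : tm G ty0 :=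
  Cst Rec @ (fn n : ty0 => fn v : ty0 => v + v) @ 1 @ t.

(** [0 + 1 + ... + t] *)
Definition triangle {G} (t : tm G ty0) : tm G ty0 :=
  Cst Rec @ (fn n : ty0 => fn v : ty0 => v + (^n + 1)) @ 0 @ t.

(** Cantor pairing [((s + t)^2 + 3 s + t) / 2] and its inverse; [diagonal] is
    the sum of the two components. *)
Definition npair {G} (s t : tm G ty0) : tm G ty0 := triangle (s + t) + s.

Definition diagonal {G} (t : tm G ty0) : tm G ty0 :=
  Cst Rec @ (fn n : ty0 => fn v : ty0 => v + eqb (^n + 1) (triangle (v + 1)))
    @ 0 @ t.

Definition nfst {G} (t : tm G ty0) : tm G ty0 := monus t (triangle (diagonal t)).
Definition nsnd {G} (t : tm G ty0) : tm G ty0 := monus (diagonal t) (nfst t).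

(** As in Kohlenbach's "Higher order reverse mathematics", [npair n m] codes
    (n/2)/(m+1) if n is even, and -((n+1)/2)/(m+1) if n is odd.  The rational
    with code [q] is thus (qpos q - qneg q) / qden q, where one of [qpos q] and
    [qneg q] is zero. *)

Definition qpos {G} (q : tm G ty0) : tm G ty0 :=
  monus 1 (parity (nfst q)) * half (nfst q).
Definition qneg {G} (q : tm G ty0) : tm G ty0 :=
  parity (nfst q) * half (nfst q + 1).
Definition qden {G} (q : tm G ty0) : tm G ty0 := nsnd q + 1.

(** A code of (a - b) / d, for d > 0 *)
Definition qmk {G} (a b d : tm G ty0) : tm G ty0 :=
  npair (two * monus a b + npred (two * monus b a)) (npred d).

Definition qnat {G} (n : tm G ty0) : tm G ty0 := qmk n 0 1.
Definition qpow2inv {G} (n : tm G ty0) : tm G ty0 := qmk 1 0 (pow2 n).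
Definition qadd {G} (q r : tm G ty0) : tm G ty0 :=
  qmk (qpos q * qden r + qpos r * qden q) (qneg q * qden r + qneg r * qden q)
    (qden q * qden r).
Definition qsub {G} (q r : tm G ty0) : tm G ty0 :=
  qmk (qpos q * qden r + qneg r * qden q) (qneg q * qden r + qpos r * qden q)
    (qden q * qden r).
Definition qabs {G} (q : tm G ty0) : tm G ty0 := qmk (qpos q + qneg q) 0 (qden q).

Definition RatLt {G} (q r : tm G ty0) : fm G :=
  qpos q * qden r + qneg r * qden q < qpos r * qden q + qneg q * qden r.
Definition RatLe {G} (q r : tm G ty0) : fm G :=
  qpos q * qden r + qneg r * qden q <= qpos r * qden q + qneg q * qden r.

(** |x_n - x_(n+i)| < 2^-n for all n, i *)
Definition Real {G} (x : tm G ty1) : fm G :=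
  ALL n : ty0, ALL i : ty0,
    RatLt (qabs (qsub (^x @ ^n) (^x @ (^n + i)))) (qpow2inv ^n).

(** |x_n - y_n| <= 2^(-n+1) for all n *)
Definition RealEq {G} (x y : tm G ty1) : fm G :=
  ALL n : ty0,
    RatLe (qabs (qsub (^x @ n) (^y @ n))) (qadd (qpow2inv n) (qpow2inv n)).

(** x_n + 2^(-n+1) < y_n for some n *)
Definition RealLt {G} (x y : tm G ty1) : fm G :=
  EX n : ty0,
    RatLt (qadd (^x @ n) (qadd (qpow2inv n) (qpow2inv n))) (^y @ n).

Definition RealLe {G} (x y : tm G ty1) : fm G := ~ RealLt y x.

Definition rnat {G} (n : tm G ty0) : tm G ty1 := fn k : ty0 => qnat ^n.

(** |x - y|, with the index shift that makes it converge fast *)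
Definition rdist {G} (x y : tm G ty1) : tm G ty1 :=
  fn n : ty0 => qabs (qsub (^x @ (n + 1)) (^y @ (n + 1))).

Definition in01 {G} (x : tm G ty1) : fm G :=
  Real x /\ RealLe (rnat 0) x /\ RealLe x (rnat 1).

(** Functions on (a subset of) the reals map equal reals to equal values. *)

Definition FunRR {G} (F : tm G (ty1 ~> ty1)) : fm G :=
  (ALL x : ty1, Real x ==> Real (^F @ x)) /\
  (ALL x : ty1, ALL y : ty1,
     Real ^x ==> Real y ==> RealEq ^x y ==> RealEq (^F @ ^x) (^F @ y)).

Definition FunRN {G} (Y : tm G ty2) : fm G :=
  ALL x : ty1, ALL y : ty1,
    Real ^x ==> Real y ==> RealEq ^x y ==> ^Y @ ^x == ^Y @ y.

Definition Fun01N {G} (Y : tm G ty2) : fm G :=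
  ALL x : ty1, ALL y : ty1,
    in01 ^x ==> in01 y ==> RealEq ^x y ==> ^Y @ ^x == ^Y @ y.

(** A set of reals is given by A : R -> R; its members are the reals x with
    A(x) > 0. *)
Definition mem {G} (x : tm G ty1) (A : tm G (ty1 ~> ty1)) : fm G :=
  Real x /\ RealLt (rnat 0) (A @ x).

Definition sub01 {G} (A : tm G (ty1 ~> ty1)) : fm G :=
  ALL x : ty1, mem x ^A ==> in01 x.

Definition ball {G} (y x r : tm G ty1) : fm G := Real y /\ RealLt (rdist x y) r.

(** Openness of a definable class of reals, so that it also applies to the
    complement of a set [A], which need not itself be given by a function *)
Definition open {G} (P : forall D, Sub G D -> tm D ty1 -> fm D) : fm G :=
  ALL x : ty1, Real x ==> P _ _ x ==>
    EX r : ty1, Real r /\ RealLt (rnat 0) r /\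
      ALL y : ty1, ball y ^x ^r ==> P _ _ y.

Definition closed {G} (A : tm G (ty1 ~> ty1)) : fm G :=
  open (fun D e x => ~ mem x ^A).

Definition limit_point {G} (x : tm G ty1) (A : tm G (ty1 ~> ty1)) : fm G :=
  ALL r : ty1, Real r ==> RealLt (rnat 0) r ==>
    EX y : ty1, mem y ^A /\ ball y ^x ^r /\ ~ RealEq y ^x.

Definition perfect {G} (A : tm G (ty1 ~> ty1)) : fm G :=
  closed A /\ ALL x : ty1, mem x ^A ==> limit_point x ^A.

Definition nonempty {G} (A : tm G (ty1 ~> ty1)) : fm G := EX x : ty1, mem x ^A.

Definition injective_on {G} (Y : tm G ty2) (A : tm G (ty1 ~> ty1)) : fm G :=
  ALL x : ty1, ALL y : ty1,
    mem ^x ^A ==> mem y ^A ==> ^Y @ ^x == ^Y @ y ==> RealEq ^x y.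

Definition onto_from {G} (Y : tm G ty2) (A : tm G (ty1 ~> ty1)) : fm G :=
  ALL n : ty0, EX x : ty1, mem x ^A /\ ^Y @ x == ^n.

Definition countable {G} (A : tm G (ty1 ~> ty1)) : fm G :=
  EX Y : ty2, FunRN Y /\ injective_on Y ^A.

Definition strongly_countable {G} (A : tm G (ty1 ~> ty1)) : fm G :=
  EX Y : ty2, FunRN Y /\ injective_on Y ^A /\ onto_from Y ^A.

Definition collision01 {G} (Y : tm G ty2) : fm G :=
  EX x : ty1, EX y : ty1, in01 ^x /\ in01 y /\ ~ RealEq ^x y /\ ^Y @ ^x == ^Y @ y.

Definition NIN : fm [] := ALL Y : ty2, Fun01N Y ==> collision01 Y.

Definition NBI : fm [] :=
  ALL Y : ty2, Fun01N Y ==>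
    collision01 Y \/ EX N : ty0, ALL x : ty1, in01 x ==> ~ (^Y @ x == ^N).

Definition misses_point_of_01 {G} (A : tm G (ty1 ~> ty1)) : fm G :=
  EX y : ty1, in01 y /\ ALL x : ty1, mem x ^A ==> ~ RealEq ^y x.

Definition principle_A : fm [] :=
  ALL A : ty1 ~> ty1, FunRR A ==> countable A ==> misses_point_of_01 A.

Definition principle_A' : fm [] :=
  ALL A : ty1 ~> ty1, FunRR A ==> strongly_countable A ==> misses_point_of_01 A.

Definition principle_B : fm [] :=
  ALL A : ty1 ~> ty1, FunRR A ==> sub01 A ==> countable A ==> ~ perfect A.

(** The empty set is perfect and countable, hence a counterexample to
    [principle_B]; the next principle excludes it.  Strongly countable sets are
    never empty. *)
Definition principle_B_nonempty : fm [] :=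
  ALL A : ty1 ~> ty1, FunRR A ==> sub01 A ==> nonempty A ==> countable A ==>
    ~ perfect A.

Definition principle_B' : fm [] :=
  ALL A : ty1 ~> ty1, FunRR A ==> sub01 A ==> strongly_countable A ==>
    ~ perfect A.

(* Main.v *)
(** By Henkin's completeness theorem it is enough to show that the sentences hold in
    every extensional model [M] of RCA_0^omega. The numbers of [M] form a discretely
    ordered semiring; its fractions interpret the coded rationals, and the completion
    [R] of that ordered field, by Cauchy sequences indexed by the numbers of [M],
    interprets the coded reals: [=_R] and [<_R] become equality and order in [R].

    Let [Y : [0,1] -> N] be injective. For [f : N -> N] the real [sum_i sg (f i) / 2^(i+2)]
    is zero iff [f] vanishes identically, so comparing its [Y]-value with [Y 0] yields
    Kleene's functional, which decides arithmetical formulas. In particular [0,1] is given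
    by a function; it is nonempty, perfect, and countable by means of [Y], strongly so if
    [Y] is onto. Hence (A), (B) each imply NIN, and (A'), (B') each imply NBI. (As stated,
    (B) is refuted by the empty set, but it implies its restriction to nonempty sets.)

    Conversely, if [Y] is injective on [A] and [A] misses no point of [0,1], then [Y] is
    injective on [0,1], contradicting NIN. If moreover [Y] maps [A] onto [N], composing it
    with a bijection from [0,1] to [A] contradicts NBI. Such a bijection exists as in
    Hilbert's hotel: with [e_k y = 2^-(m+1) (1 + y - floor y)], where [m] codes [k] and
    [floor y], send [e_0 y] to [y] and [e_(k+1) y] to [e_k y] for all [y] in [A] outside
    [0,1], and fix the other points. Kleene's functional and QF-AC^(1,0) make the
    composition a function of the model. *)

From Stdlib Require List Eqdep_dec Ring.
From HB Require Import structures.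
From mathcomp Require all_boot all_order all_algebra boolp ring lra.
From Pilot Require Import -(notations) Defs.

(* The module confines the notations of MathComp, which clash with those of [Defs]. *)
Module Completeness.
Import List Eqdep_dec Ring.
Import all_boot all_order all_algebra boolp.
Set Implicit Arguments. Unset Strict Implicit. Unset Printing Implicit Defensive.
Import Order.TTheory GRing.Theory Num.Theory.
Local Notation In := List.In.
Local Notation lmap := List.map.
Local Infix "+++" := List.app (at level 60, right associativity).

(** * Quotients *)

Section Quotient.
Variables (T : Type) (E : T -> T -> Prop).
Hypotheses (Er : forall x, E x x) (Es : forall x y, E x y -> E y x)
  (Et : forall x y z, E x y -> E y z -> E x z).

Definition quot := {P : T -> Prop | exists x, P = E x}.
Definition class (x : T) : quot := exist _ (E x) (ex_intro _ x erefl).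
Definition repr (q : quot) : T := projT1 (cid (proj2_sig q)).

Lemma reprK q : class (repr q) = q.
Proof. by case: q => P HP; apply: eq_exist; rewrite -(projT2 (cid HP)). Qed.

Lemma class_eq x y : class x = class y <-> E x y.
Proof.
split; last first.
  move=> xy; apply: eq_exist; apply: funext => z; apply: propext.
  by split; apply: Et => //; apply: Es.
move=> /(f_equal (@proj1_sig _ _)) /= /(congr1 (fun P => P y)) ->; exact: Er.
Qed.

Lemma repr_class x : E (repr (class x)) x.
Proof. by apply/class_eq; rewrite reprK. Qed.

End Quotient.

(** * Syntax and semantics *)

Lemma var_case b G (P : forall a, var (b :: G) a -> Prop) :
  P b vz -> (forall a (v : var G a), P a (vs v)) -> forall a v, P a v.
Proof.
move=> Hz Hs a v.
refine (match v as v' in var G' a' return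
  (match G' return var G' a' -> Prop with
   | nil => fun _ => True
   | c :: G'' => fun v' => forall P : (forall a, var (c :: G'') a -> Prop),
       P c vz -> (forall a (v : var G'' a), P a (vs v)) -> P a' v' end) v'
  with vz _ _ => _ | vs _ _ _ _ => _ end P Hz Hs).
- by move=> Q.
- by move=> Q _; apply.
Qed.

Definition var_nil (P : Type) a : var nil a -> P :=
  fun v => (match v as v' in var G' a' return
  (match G' with nil => P | c :: G'' => True end)
  with vz _ _ => I | vs _ _ _ _ => I end).

Definition env (F : ty -> Type) (G : ctx) := forall a, var G a -> F a.

Definition econs (F : ty -> Type) G b (x : F b) (e : env F G) : env F (b :: G) :=
  fun a v =>
    match v in var G' a' return
      match G' with nil => unit | c :: G'' => F c -> env F G'' -> F a' end
    with vz _ _ => fun x _ => x | vs _ _ _ v => fun _ e => e _ v end x e.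

Definition enil (F : ty -> Type) : env F nil := fun a v => var_nil (F a) v.

Lemma env_ext F G (e e' : env F G) : (forall a v, e a v = e' a v) -> e = e'.
Proof. by move=> H; apply: functional_extensionality_dep => a; apply: funext => v. Qed.

(** [eq0] interprets equality; it need not be Leibniz equality. *)
Record structure := Structure {
  dom :> ty -> Type;
  ap : forall a b, dom (Arr a b) -> dom a -> dom b;
  con : forall a, cst a -> dom a;
  eq0 : dom ty0 -> dom ty0 -> Prop;
  lt0 : dom ty0 -> dom ty0 -> Prop }.

Fixpoint eval (M : structure) G a (t : tm G a) (e : env M G) : M a :=
  match t with
  | Var _ v => e _ v
  | Cst _ c => con M c
  | App _ _ s t => ap (eval s e) (eval t e)
  end.

Fixpoint sat (M : structure) G (A : fm G) : env M G -> Prop :=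
  match A with
  | FBot => fun _ => False
  | FEq s t => fun e => eq0 (eval s e) (eval t e)
  | FLt s t => fun e => lt0 (eval s e) (eval t e)
  | FImp A B => fun e => sat A e -> sat B e
  | FAll a A => fun e => forall x : M a, sat A (econs x e)
  end.

Arguments sat : simpl never.

Lemma satE (M : structure) G (e : env M G) :
  (sat FBot e = False) *
  (forall s t, sat (FEq s t) e = eq0 (eval s e) (eval t e)) *
  (forall s t, sat (FLt s t) e = lt0 (eval s e) (eval t e)) *
  (forall A B, sat (FImp A B) e = (sat A e -> sat B e)) *
  (forall a (A : fm (a :: G)), sat (FAll a A) e = (forall x : M a, sat A (econs x e))).
Proof. by []. Qed.

Definition ren_subst G D (r : renaming G D) : substitution G D :=
  fun a v => Var (r a v).
Definition comp_subst G D E (s : substitution G D) (s' : substitution D E) :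
  substitution G E := fun a v => subst_tm s' (s a v).

Lemma subst_ext G D (s s' : substitution G D) :
  (forall a v, s a v = s' a v) -> s = s'.
Proof. by move=> H; apply: functional_extensionality_dep => a; apply: funext => v. Qed.

Lemma subst_ren_tm G D (r : renaming G D) a (t : tm G a) :
  subst_tm (ren_subst r) t = ren_tm r t.
Proof. by elim: t => //= b c s -> t ->. Qed.

Lemma subst_tm_comp G D E (s : substitution G D) (s' : substitution D E) a
  (t : tm G a) : subst_tm s' (subst_tm s t) = subst_tm (comp_subst s s') t.
Proof. by elim: t => //= b c u -> t ->. Qed.

Lemma subst_tm_id G a (t : tm G a) : subst_tm (fun _ v => Var v) t = t.
Proof. by elim: t => //= b c u -> t ->. Qed.

Lemma subst_tm_shift G D b (s : substitution G D) a (t : tm G a) :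
  subst_tm (lift_subst (b := b) s) (ren_tm shift t) = ren_tm shift (subst_tm s t).
Proof. by elim: t => //= c d u -> t ->. Qed.

Lemma lift_comp G D E b (s : substitution G D) (s' : substitution D E) :
  comp_subst (lift_subst (b := b) s) (lift_subst s') = lift_subst (comp_subst s s').
Proof.
apply: subst_ext; apply: var_case => //= a v.
by rewrite /comp_subst /= subst_tm_shift.
Qed.

Lemma lift_id G b : lift_subst (b := b) (fun _ (v : var G _) => Var v) = (fun _ v => Var v).
Proof. by apply: subst_ext; apply: var_case. Qed.

Lemma subst_fm_comp G (A : fm G) : forall D E (s : substitution G D) (s' : substitution D E),
  subst_fm (subst_fm A s) s' = subst_fm A (comp_subst s s').
Proof.
elim: A => {G} //= [G t u|G t u|G A IA B IB|G a A IA] D E s s'.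
- by rewrite !subst_tm_comp.
- by rewrite !subst_tm_comp.
- by rewrite IA IB.
- by rewrite IA lift_comp.
Qed.

Lemma subst_fm_id G (A : fm G) : subst_fm A (fun _ v => Var v) = A.
Proof.
elim: A => {G} //= [G t u|G t u|G A IA B IB|G a A IA].
- by rewrite !subst_tm_id.
- by rewrite !subst_tm_id.
- by rewrite IA IB.
- by rewrite lift_id IA.
Qed.

Lemma subst_scons_shift G D b (t : tm D b) (s : substitution G D) a (u : tm G a) :
  subst_tm (scons t s) (ren_tm shift u) = subst_tm s u.
Proof. by elim: u => //= c d v -> w ->. Qed.

Lemma subst_fm_inst G D b (A : fm (b :: G)) t (s : substitution G D) :
  subst_fm (inst A t) s = inst (subst_fm A (lift_subst s)) (subst_tm s t).
Proof.
rewrite /inst !subst_fm_comp; congr (subst_fm A _).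
apply: subst_ext; apply: var_case => //= a v.
by rewrite /comp_subst /= subst_scons_shift subst_tm_id.
Qed.

Lemma subst_fm_shift G D b (A : fm G) (s : substitution G D) :
  subst_fm (shift_fm (b := b) A) (lift_subst s) = shift_fm (subst_fm A s).
Proof.
rewrite /shift_fm !subst_fm_comp; congr (subst_fm A _).
apply: subst_ext => a v /=; rewrite /comp_subst /=.
exact: (esym (subst_ren_tm _ _)).
Qed.

Lemma inst_lift_scons G D b (A : fm (b :: G)) t (s : substitution G D) :
  inst (subst_fm A (lift_subst s)) t = subst_fm A (scons t s).
Proof.
rewrite /inst !subst_fm_comp; congr (subst_fm A _).
apply: subst_ext; apply: var_case => //= a v.
by rewrite /comp_subst /= subst_scons_shift subst_tm_id.
Qed.

Lemma subst_fm_EqT a : forall G D (t u : tm G a) (s : substitution G D),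
  subst_fm (EqT t u) s = EqT (subst_tm s t) (subst_tm s u).
Proof.
elim: a => //= b _ c IH G D t u s.
rewrite /all_ /= IH /=; apply: (f_equal (FAll b)).
by rewrite /weaken !(@subst_tm_shift _ _ b s).
Qed.

Section ProofTheory.
Variable Ax : axioms.
Hypothesis Ax_subst : forall G D (A : fm G) (s : substitution G D), @Ax G A -> @Ax D (subst_fm A s).

Lemma prv_subst G (H : list (fm G)) A : prv Ax _ H A ->
  forall D (s : substitution G D), prv Ax _ (lmap (fun B => subst_fm B s) H) (subst_fm A s).
Proof.
elim => {G H A}.
- by move=> G H A HA D s; apply: prv_ax; apply: Ax_subst.
- by move=> G H A HA D s; apply: prv_hyp; apply: in_map HA.
- by move=> G H A B _ IH D s; apply: prv_impI; apply: IH.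
- move=> G H A B _ IH1 _ IH2 D s; exact: prv_impE (IH1 _ s) (IH2 _ s).
- by move=> G H A _ IH D s; apply: prv_raa; apply: IH.
- move=> G H a A _ IH D s /=; apply: prv_allI.
  move: (IH _ (lift_subst s)); rewrite !map_map.
  congr prv; apply: map_ext => B; exact: subst_fm_shift.
- move=> G H a A t _ IH D s; rewrite subst_fm_inst.
  by apply: prv_allE; apply: IH.
- by move=> G H t D s; apply: prv_eq_refl.
- move=> G H A t u _ IH1 _; rewrite /= => IH2 D s.
  move: (IH1 _ s) (IH2 _ s); rewrite !subst_fm_inst /=.
  exact: prv_eq_subst.
Qed.

Lemma prv_weak G (H : list (fm G)) A : prv Ax _ H A ->
  forall H', (forall B, In B H -> In B H') -> prv Ax _ H' A.
Proof.
elim => {G H A}.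
- by move=> G H A HA H' _; apply: prv_ax.
- by move=> G H A HA H' sub; apply: prv_hyp; apply: sub.
- move=> G H A B _ IH H' sub; apply: prv_impI; apply: IH => C /= [|/sub]; by [left|right].
- move=> G H A B _ IH1 _ IH2 H' sub; exact: prv_impE (IH1 _ sub) (IH2 _ sub).
- move=> G H A _ IH H' sub; apply: prv_raa; apply: IH => C /= [|/sub]; by [left|right].
- move=> G H a A _ IH H' sub; apply: prv_allI; apply: IH => B /in_map_iff [C [<- /sub]].
  exact: in_map.
- move=> G H a A t _ IH H' sub; apply: prv_allE; exact: IH.
- by move=> *; apply: prv_eq_refl.
- move=> G H A t u _ IH1 _ IH2 H' sub; apply: prv_eq_subst (IH1 _ sub) (IH2 _ sub).
Qed.

Lemma prv_ren G D (H : list (fm G)) (H' : list (fm D)) (s : substitution G D) A :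
  (forall B, In B H -> In (subst_fm B s) H') -> prv Ax _ H A -> prv Ax _ H' (subst_fm A s).
Proof.
move=> sub /prv_subst /(_ _ s) /prv_weak; apply => B /in_map_iff [C [<-]]; exact: sub.
Qed.

Lemma prv_exfalso G (H : list (fm G)) A : prv Ax _ H FBot -> prv Ax _ H A.
Proof. by move=> HF; apply: prv_raa; move: HF => /prv_weak; apply => B; right. Qed.

End ProofTheory.

(** * Finiteness of the formulas of bounded rank *)

Fixpoint rank_ty (a : ty) : nat :=
  match a with ty0 => 0 | Arr b c => (maxn (rank_ty b) (rank_ty c)).+1 end.

Definition rank_cst a (c : cst a) : nat :=
  match c with
  | Pi a b => (maxn (rank_ty a) (rank_ty b)).+1
  | Sigma a b c => (maxn (rank_ty a) (maxn (rank_ty b) (rank_ty c))).+1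
  | _ => 0
  end.

Fixpoint rank_tm G a (t : tm G a) : nat :=
  match t with
  | Var _ _ => 0
  | Cst _ c => rank_cst c
  | App _ _ s t => (maxn (rank_tm s) (rank_tm t)).+1
  end.

Fixpoint rank_fm G (A : fm G) : nat :=
  match A with
  | FBot => 0
  | FEq s t | FLt s t => maxn (rank_tm s) (rank_tm t)
  | FImp A B => (maxn (rank_fm A) (rank_fm B)).+1
  | FAll a A => (maxn (rank_ty a) (rank_fm A)).+1
  end.

Lemma rank_tm_ren G D (r : renaming G D) a (t : tm G a) :
  rank_tm (subst_tm (ren_subst r) t) = rank_tm t.
Proof. by elim: t => //= b c s -> t ->. Qed.

Definition lift_ren G D b (r : renaming G D) : renaming (b :: G) (b :: D) :=
  fun a v =>
    match v in var G' a'
      return match G' with nil => unit | c :: G'' => renaming G'' D -> var (c :: D) a' end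
    with vz _ _ => fun _ => vz | vs _ _ _ w => fun r => vs (r _ w) end r.

Lemma lift_ren_subst G D b (r : renaming G D) :
  lift_subst (ren_subst r) = ren_subst (lift_ren (b := b) r).
Proof. by apply: subst_ext; apply: var_case. Qed.

Lemma rank_fm_ren G (A : fm G) : forall D (r : renaming G D),
  rank_fm (subst_fm A (ren_subst r)) = rank_fm A.
Proof.
elim: A => {G} //= [G s t|G s t|G A IA B IB|G a A IA] D r.
- by rewrite !rank_tm_ren.
- by rewrite !rank_tm_ren.
- by rewrite IA IB.
- by rewrite lift_ren_subst IA.
Qed.

Definition enumerable (T : Type) (P : T -> Prop) := exists l : list T, forall x, P x -> In x l.

Lemma enumerable_bind T U (P : T -> Prop) (Q : U -> Prop) (f : T -> list U) :
  enumerable P -> (forall y, Q y -> exists2 x, P x & In y (f x)) -> enumerable Q.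
Proof.
move=> [l Hl] H; exists (flat_map f l) => y /H [x /Hl xl yf].
by apply/in_flat_map; exists x.
Qed.

Lemma enumerable_bind2 T T' U (P : T -> Prop) (P' : T' -> Prop) (Q : U -> Prop)
  (f : T -> T' -> list U) : enumerable P -> enumerable P' ->
  (forall y, Q y -> exists x x', [/\ P x, P' x' & In y (f x x')]) -> enumerable Q.
Proof.
move=> [l Hl] [l' Hl'] H; exists (flat_map (fun x => flat_map (f x) l') l) => y.
move=> /H [x [x' [/Hl xl /Hl' xl' yf]]].
by apply/in_flat_map; exists x; split=> //; apply/in_flat_map; exists x'.
Qed.

Lemma enumerableU T (P Q : T -> Prop) :
  enumerable P -> enumerable Q -> enumerable (fun x => P x \/ Q x).
Proof.
move=> [l Hl] [l' Hl']; exists (l +++ l') => x H; apply/in_app_iff.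
by case: H => [/Hl|/Hl']; [left|right].
Qed.

Lemma enumerableS T (P Q : T -> Prop) :
  (forall x, Q x -> P x) -> enumerable P -> enumerable Q.
Proof. by move=> sub [l Hl]; exists l => x /sub /Hl. Qed.

Lemma enumerable_ty n : enumerable (fun a => rank_ty a <= n).
Proof.
elim: n => [|n IH]; first by exists [:: ty0] => -[|a b] //=; left.
have IH2 : enumerable (fun a => exists b c, a = Arr b c /\ rank_ty a <= n.+1).
  apply: (enumerable_bind2 (f := fun b c => [:: Arr b c]) IH IH) => a [b [c [-> /=]]].
  rewrite ltnS geq_max => /andP[Hb Hc]; exists b, c; split=> //; by left.
apply: enumerableS (enumerableU IH IH2) => -[|b c] H; first by left.
by right; exists b, c.
Qed.

Definition terms G := {a : ty & tm G a}.

Lemma enumerable_var G : enumerable (fun _ : {a : ty & var G a} => True).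
Proof.
elim: G => [|b G [l Hl]]; first by exists nil => -[a v] _; apply: var_nil v.
exists (existT (var _) b vz :: lmap (fun p => existT (var _) _ (vs (projT2 p))) l).
case=> a v _; move: a v; apply: var_case => [|a v]; first by left.
right; apply: (in_map (fun p => existT (var _) _ (vs (projT2 p))) l (existT (var G) a v)).
exact: Hl.
Qed.

Lemma enumerable_cst n : enumerable (fun p : {a : ty & cst a} => rank_cst (projT2 p) <= n).
Proof.
have [l Hl] := enumerable_ty n.
exists ([:: existT cst _ Zero; existT cst _ One; existT cst _ Plus; existT cst _ Times;
    existT cst _ Rec]
  +++ flat_map (fun a => lmap (fun b => existT cst _ (Pi a b)) l) l
  +++ flat_map (fun a => flat_map (fun b => lmap (fun c => existT cst _ (Sigma a b c)) l) l) l).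
move=> [a c] Hc; apply/in_app_iff.
case: c Hc => [||||a1 b1|a1 b1 c1|].
1-4,7: by left => /=; intuition.
- move/(leq_trans (leqnSn _)); rewrite geq_max => /andP[/Hl Ha /Hl Hb].
  right; apply/in_app_iff; left; apply/in_flat_map; exists a1; split=> //.
  exact: (in_map (fun b => existT cst _ (Pi a1 b))).
- move/(leq_trans (leqnSn _)); rewrite !geq_max => /and3P[/Hl Ha /Hl Hb /Hl Hc].
  right; apply/in_app_iff; right; apply/in_flat_map; exists a1; split=> //.
  apply/in_flat_map; exists b1; split=> //.
  exact: (in_map (fun c => existT cst _ (Sigma a1 b1 c))).
Qed.

Lemma ty_eq_dec (a b : ty) : {a = b} + {a <> b}.
Proof. decide equality. Defined.

Definition app_list G (p q : terms G) : list (terms G) :=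
  match projT1 p as c return tm G c -> _ with
  | ty0 => fun _ => nil
  | Arr a b => fun s =>
      match ty_eq_dec (projT1 q) a with
      | left e => [:: existT (tm G) b (App s (eq_rect _ (tm G) (projT2 q) _ e))]
      | right _ => nil
      end
  end (projT2 p).

Lemma app_listE G a b (s : tm G (Arr a b)) (t : tm G a) :
  app_list (existT (tm G) _ s) (existT (tm G) _ t) = [:: existT (tm G) _ (App s t)].
Proof.
rewrite /app_list /=; case: ty_eq_dec => // e.
by rewrite (UIP_dec ty_eq_dec e erefl).
Qed.

Lemma enumerable_terms G n : enumerable (fun p : terms G => rank_tm (projT2 p) <= n).
Proof.
have base m : enumerable (fun p : terms G => rank_tm (projT2 p) <= m /\
    match projT2 p with App _ _ _ _ => False | _ => True end).
  pose f (p : {a : ty & var G a}) := existT (tm G) _ (Var (projT2 p)).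
  pose g (p : {a : ty & cst a}) := existT (tm G) _ (@Cst G _ (projT2 p)).
  have [l Hl] := enumerable_var G; have [l' Hl'] := enumerable_cst m.
  exists (lmap f l +++ lmap g l') => -[a [b v|b c|b c s t]] [H I] //; apply/in_app_iff.
  - left; exact: (in_map f l (existT _ b v)) (Hl _ _).
  - right; exact: (in_map g l' (existT _ b c)) (Hl' _ _).
elim: n => [|n IH].
  by apply: enumerableS (base 0) => -[a []].
have IH2 : enumerable (fun p : terms G => rank_tm (projT2 p) <= n.+1 /\
    match projT2 p with App _ _ _ _ => True | _ => False end).
  apply: (enumerable_bind2 (f := @app_list G) IH IH) => -[a [b v|b c|b c s t]] [] //=.
  rewrite ltnS geq_max => /andP[Hs Ht] _.
  exists (existT _ _ s), (existT _ _ t); split=> //; rewrite app_listE; by left.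
apply: enumerableS (enumerableU (base n.+1) IH2) => -[a [b v|b c|b c s t]] /= H;
  try (by left); by right.
Qed.

Lemma enumerable_nat_terms G n : enumerable (fun t : tm G ty0 => rank_tm t <= n).
Proof.
apply: (enumerable_bind (f := fun p : terms G =>
   match projT1 p as c return tm G c -> list (tm G ty0) with
   | ty0 => fun t => [:: t] | Arr _ _ => fun _ => nil end (projT2 p)) (enumerable_terms G n)).
by move=> t Ht; exists (existT _ _ t) => //=; left.
Qed.

Lemma enumerable_fm n : forall G, enumerable (fun A : fm G => rank_fm A <= n).
Proof.
have base m G : enumerable (fun A : fm G => rank_fm A <= m /\
    match A with FImp _ _ | FAll _ _ => False | _ => True end).
  have H := enumerable_nat_terms G m.
  have [l Hl] : enumerable (fun A : fm G => rank_fm A <= m /\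
    match A with FEq _ _ | FLt _ _ => True | _ => False end).
    apply: (enumerable_bind2 (f := fun s t : tm G ty0 => [:: FEq s t; FLt s t]) H H).
    move=> [|s t|s t|A B|a A] //= [] //; rewrite geq_max => /andP[Hs Ht] _;
      by exists s, t; split=> //=; intuition.
  exists (FBot :: l) => -[|s t|s t|A B|a A] //= [] // HA _; first (by left); by right; apply: Hl.
elim: n => [|n IH] G.
  apply: enumerableS (base 0 G) => -[] //.
have HI : enumerable (fun A : fm G => rank_fm A <= n.+1 /\
    match A with FImp _ _ => True | _ => False end).
  apply: (enumerable_bind2 (f := fun A B : fm G => [:: FImp A B]) (IH G) (IH G)).
  move=> [|s t|s t|A B|a A] //= [] //; rewrite ltnS geq_max => /andP[Hs Ht] _.
  by exists A, B; split=> //; left.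
have HA : enumerable (fun A : fm G => rank_fm A <= n.+1 /\
    match A with FAll _ _ => True | _ => False end).
  pose f a := projT1 (cid (IH (a :: G))).
  have Hf a : forall A, rank_fm A <= n -> In A (f a) := projT2 (cid (IH (a :: G))).
  apply: (enumerable_bind (f := fun a => lmap (fun A => FAll a A) (f a)) (enumerable_ty n)).
  move=> [|s t|s t|A B|a A] //= [] //; rewrite ltnS geq_max => /andP[Ha HA] _.
  by exists a => //; apply: in_map; apply: Hf.
apply: enumerableS (enumerableU (base n.+1 G) (enumerableU HI HA)) => -[|s t|s t|A B|a A] /= H.
1-3: by left.
- by right; left.
- by right; right.
Qed.

(** * Henkin's construction *)

Section Henkin.
Variable Ax : axioms.
Hypothesis Ax_subst : forall G D (A : fm G) (s : substitution G D), @Ax G A -> @Ax D (subst_fm A s).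
Local Notation pr := (prv Ax _).

Record stage := Stage {
  sctx : ctx;
  shyp : list (fm sctx);
  sconsistent : ~ pr shyp FBot }.

Definition extends (S S' : stage) (r : renaming (sctx S) (sctx S')) :=
  forall B, In B (shyp S) -> In (subst_fm B (ren_subst r)) (shyp S').

Definition settled (S : stage) (C : fm (sctx S)) :=
  pr (shyp S) C \/
  pr (shyp S) (Neg C) /\
    match C with FAll a A => exists t, pr (shyp S) (Neg (inst A t)) | _ => True end.

Lemma extends_prv S S' r C : @extends S S' r -> pr (shyp S) C ->
  pr (shyp S') (subst_fm C (ren_subst r)).
Proof. by move=> sub; apply: prv_ren. Qed.

Lemma extends_settled S S' r C : @extends S S' r -> settled C ->
  settled (S := S') (subst_fm C (ren_subst r)).
Proof.
move=> E [/(extends_prv E)|[/(extends_prv E) N W]]; first by left.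
right; split=> //; case: C W {N} => //= a A [t /(extends_prv E)] /=.
by rewrite subst_fm_inst => Ht; exists (subst_tm (ren_subst r) t).
Qed.

Lemma settle S C : exists S' r, @extends S S' r /\ settled (S := S') (subst_fm C (ren_subst r)).
Proof.
case: (EM (pr (shyp S) C)) => [HC|NC].
  exists S, (fun _ v => v); split; first by move=> B; rewrite subst_fm_id.
  by left; rewrite subst_fm_id.
have con : ~ pr (Neg C :: shyp S) FBot by move=> /prv_raa.
case: (EM (exists a A, C = FAll a A)) => [[a [A eC]]|NA]; last first.
  exists (Stage con), (fun _ v => v); split.
    by move=> B; rewrite subst_fm_id; right.
  right; rewrite subst_fm_id; split; first by apply: prv_hyp; left.
  have Q (P : forall a, fm (a :: sctx S) -> Prop) :
      match C return Prop with FAll a A => P a A | _ => True end.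
    by case: (C) NA => // a A NA; case: NA; exists a, A.
  exact: (Q (fun a A => exists t, pr (Neg C :: shyp S) (Neg (inst A t)))).
subst C.
have con' : ~ pr (Neg A :: lmap shift_fm (Neg (FAll a A) :: shyp S)) FBot.
  move=> /prv_raa /prv_allI H.
  by apply: (con); apply: prv_impE H; apply: prv_hyp; left.
exists (Stage con'), (fun _ v => vs v); split.
  by move=> B HB /=; right; right; exact: (in_map shift_fm).
right; split.
  by apply: prv_hyp => /=; right; left.
rewrite /=; exists (Var vz); apply: prv_hyp => /=; left.
rewrite inst_lift_scons -[in LHS](subst_fm_id A); congr (Neg (subst_fm A _)).
by apply: subst_ext; apply: var_case.
Qed.

Lemma settle_list S (l : list (fm (sctx S))) : exists S' r, @extends S S' r /\
  forall C, In C l -> settled (S := S') (subst_fm C (ren_subst r)).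
Proof.
elim: l => [|C l [S1 [r1 [E1 H1]]]].
  by exists S, (fun _ v => v); split=> // B; rewrite subst_fm_id.
have [S2 [r2 [E2 H2]]] := settle (S := S1) (subst_fm C (ren_subst r1)).
exists S2, (fun a v => r2 a (r1 a v)).
have compE B : subst_fm B (ren_subst (fun a v => r2 a (r1 a v))) =
   subst_fm (subst_fm B (ren_subst r1)) (ren_subst r2) by rewrite subst_fm_comp.
split=> [B /E1 /E2|B [<-|/H1 HB]]; rewrite compE //.
exact: extends_settled HB.
Qed.

Lemma settle_rank n S : exists S' r, @extends S S' r /\
  forall C, rank_fm C <= n -> settled (S := S') (subst_fm C (ren_subst r)).
Proof.
have [l Hl] := enumerable_fm n (sctx S).
have [S' [r [E H]]] := settle_list l.
by exists S', r; split=> // C /Hl /H.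
Qed.

Variable S0 : stage.

Definition next_stage n S := projT1 (cid (settle_rank n S)).
Definition next_ren n S := projT1 (cid (projT2 (cid (settle_rank n S)))).

Fixpoint st n : stage := if n is m.+1 then next_stage m (st m) else S0.

Definition up n : renaming (sctx (st n)) (sctx (st n.+1)) := @next_ren n (st n).
Arguments up : clear implicits.

Lemma up_extends n : extends (up n).
Proof. exact: (projT2 (cid (projT2 (cid (settle_rank n (st n)))))).1. Qed.

Lemma up_settled n C : rank_fm C <= n -> settled (S := st n.+1) (subst_fm C (ren_subst (up n))).
Proof. exact: (projT2 (cid (projT2 (cid (settle_rank n (st n)))))).2. Qed.

(** The elements of the term model: from some stage on, each term is the image of the
    previous one. *)
Record germ a := Germ {
  gval :> forall n, tm (sctx (st n)) a;
  gcoh : exists N, forall n, N <= n -> gval n.+1 = ren_tm (up n) (gval n) }.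

Lemma app_coh a b (f : germ (Arr a b)) (x : germ a) :
  exists N, forall n, N <= n -> App (f n.+1) (x n.+1) = ren_tm (up n) (App (f n) (x n)).
Proof.
have [N HN] := gcoh f; have [M HM] := gcoh x; exists (maxn N M) => n.
by rewrite geq_max => /andP[/HN -> /HM ->].
Qed.

Definition gapp a b (f : germ (Arr a b)) (x : germ a) : germ b :=
  Germ (app_coh f x).

Lemma cst_coh a (c : cst a) : exists N, forall n, N <= n ->
  Cst (G := sctx (st n.+1)) c = ren_tm (up n) (Cst c).
Proof. by exists 0. Qed.

Definition gcst a (c : cst a) : germ a := Germ (cst_coh c).

Local Notation genv D := (env germ D).

Definition at_stage D (e : genv D) n : substitution D (sctx (st n)) := fun a v => e a v n.
Arguments at_stage {D} e n a v /.

Lemma at_stage_coh D (e : genv D) : exists N, forall n, N <= n ->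
  at_stage e n.+1 = comp_subst (at_stage e n) (ren_subst (up n)).
Proof.
elim: D e => [|b D IH] e.
  by exists 0 => n _; apply: subst_ext => a v; apply: var_nil v.
have [N HN] := IH (fun a v => e a (vs v)); have [M HM] := gcoh (e b vz).
exists (maxn N M) => n; rewrite geq_max => /andP[/HN En /HM Em].
apply: subst_ext; apply: var_case => [|a v].
  by rewrite /comp_subst /= Em subst_ren_tm.
exact: (f_equal (fun s : substitution _ _ => s a v) En).
Qed.

Definition holds D (A : fm D) (e : genv D) :=
  exists N, forall n, N <= n -> pr (shyp (st n)) (subst_fm A (at_stage e n)).

Lemma holdsP D (A : fm D) (e : genv D) N :
  (forall n, N <= n -> at_stage e n.+1 = comp_subst (at_stage e n) (ren_subst (up n))) ->
  (exists2 n, N <= n & pr (shyp (st n)) (subst_fm A (at_stage e n))) -> holds A e.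
Proof.
move=> HN [n Nn Hn]; exists n => m; elim: m => [|m IH].
  by rewrite leqn0 => /eqP <-.
rewrite leq_eqVlt => /orP[/eqP <- //|]; rewrite ltnS => nm.
rewrite HN ?(leq_trans Nn) // -subst_fm_comp.
by apply: extends_prv; [exact: up_extends|exact: IH].
Qed.

Lemma holds_or_not D (A : fm D) (e : genv D) :
  holds A e \/ exists N, forall n, N <= n ->
    at_stage e n.+1 = comp_subst (at_stage e n) (ren_subst (up n)) /\
    settled (S := st n) (subst_fm A (at_stage e n)) /\
    pr (shyp (st n)) (Neg (subst_fm A (at_stage e n))).
Proof.
have [N HN] := at_stage_coh e.
pose rk := rank_fm (subst_fm A (at_stage e N)).
have Hrk n : N <= n -> rank_fm (subst_fm A (at_stage e n)) = rk.
  elim: n => [|n IH]; first by rewrite leqn0 => /eqP <-.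
  rewrite leq_eqVlt => /orP[/eqP <- //|]; rewrite ltnS => nm.
  by rewrite HN // -subst_fm_comp rank_fm_ren IH.
have Hset n : maxn N rk <= n -> settled (S := st n.+1) (subst_fm A (at_stage e n.+1)).
  rewrite geq_max => /andP[Nn rn].
  by rewrite HN // -subst_fm_comp; apply: up_settled; rewrite Hrk.
case: (EM (holds A e)) => H; [by left | right].
exists (maxn N rk).+1 => -[//|n]; rewrite ltnS => Hn.
have Nn : N <= n by rewrite (leq_trans _ Hn) // leq_maxl.
split; first by apply: HN; apply: leqW.
split; first exact: Hset.
case: (Hset n Hn) => [HA|[]//]; case: H; apply: (holdsP HN); exists n.+1 => //; exact: leqW.
Qed.

Lemma at_stage_cons D b (x : germ b) (e : genv D) n :
  at_stage (econs x e : genv (b :: D)) n = scons (x n) (at_stage e n).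
Proof. by apply: subst_ext; apply: var_case. Qed.

Definition germs : structure := {|
  dom := germ;
  ap := gapp;
  con := gcst;
  eq0 x y := exists N, forall n, N <= n -> pr (shyp (st n)) (FEq (x n) (y n));
  lt0 x y := exists N, forall n, N <= n -> pr (shyp (st n)) (FLt (x n) (y n)) |}.

Lemma eval_germs D a (t : tm D a) (e : env germs D) n :
  (eval t e : germ a) n = subst_tm (at_stage e n) t.
Proof. by elim: t => //= b c s -> t ->. Qed.

Fixpoint default_tm G a : tm G a :=
  match a with
  | ty0 => Cst Zero
  | Arr b c => App (Cst (Pi c b)) (default_tm G c)
  end.

Fixpoint germ_from n a (t : tm (sctx (st n)) a) k : tm (sctx (st k)) a :=
  match eq_comparable n k with
  | left e => eq_rect n (fun k => tm (sctx (st k)) a) t k e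
  | right _ =>
      match k return tm (sctx (st k)) a with
      | 0 => default_tm _ a
      | k.+1 => ren_tm (up k) (germ_from t k)
      end
  end.

Lemma germ_from_coh n a (t : tm (sctx (st n)) a) :
  forall k, n <= k -> germ_from t k.+1 = ren_tm (up k) (germ_from t k).
Proof.
move=> k nk /=; case: eq_comparable => // e.
by move: nk; rewrite {1}e ltnn.
Qed.

Lemma germ_from_base n a (t : tm (sctx (st n)) a) : germ_from t n = t.
Proof.
have E k : germ_from t k = match eq_comparable n k with
  | left e => eq_rect n (fun k => tm (sctx (st k)) a) t k e
  | right _ => germ_from t k end by case: k => [|k] /=; case: eq_comparable.
rewrite E; case: eq_comparable => // e.
by rewrite (eq_irrelevance e erefl).
Qed.

Theorem truth D (A : fm D) : forall e : genv D, sat (M := germs) A e <-> holds A e.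
Proof.
elim: A => {D} [D|D s t|D s t|D A IA B IB|D a A IA] e; rewrite satE.
2,3: by split=> -[N HN]; exists N => n /HN; rewrite /= -!eval_germs.
- split=> // -[N HN]; exact: (sconsistent (HN N (leqnn N))).
- split.
  + move=> HAB; case: (holds_or_not A e) => [HA|[N HN]].
    * have [M HM] := (IB e).1 (HAB ((IA e).2 HA)).
      exists M => n /HM HB /=; apply: prv_impI; move: HB => /prv_weak; apply=> C; by right.
    * exists N => n /HN [_ [_ HnA]] /=; apply: prv_impI; apply: prv_exfalso.
      apply: (prv_impE _ _ _ (subst_fm A (at_stage e n))); last by apply: prv_hyp; left.
      by move: HnA => /prv_weak; apply=> C; right.
  + move=> [N HN] /IA [M HM]; apply/IB; exists (maxn N M) => n.
    rewrite geq_max => /andP[/HN Hi /HM Ha]; exact: prv_impE Hi Ha.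
- split.
  + move=> HA; case: (holds_or_not (FAll a A) e) => // -[N HN].
    have [cN [HS Hneg]] := HN N (leqnn N).
    case: HS => [Hall|[_ /= [t Ht]]].
      by case: (sconsistent (prv_impE _ _ _ _ _ Hneg Hall)).
    have xcoh := germ_from_coh t.
    pose x : germ a := Germ (ex_intro _ N xcoh).
    have /IA [M HM] := HA x.
    have Hx : holds (Neg A) (econs x e : genv (_ :: _)).
      apply: (holdsP (N := N)).
        move=> n Nn; apply: subst_ext; apply: var_case => [|b v].
          by rewrite /comp_subst subst_ren_tm; exact: (xcoh).
        exact: (f_equal (fun s : substitution _ _ => s b v) (HN n Nn).1).
      exists N => //; move: Ht; rewrite inst_lift_scons at_stage_cons /=.
      by rewrite germ_from_base.
    have [M' HM'] := Hx.
    have Hm := HM' (maxn M M') (leq_maxr _ _).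
    case: (sconsistent (prv_impE _ _ _ _ _ Hm (HM (maxn M M') (leq_maxl _ _)))).
  + move=> [N HN] x; apply/IA; exists N => n /HN /= /(prv_allE _ _ _ _ _ ((x : germ a) n)).
    by rewrite inst_lift_scons at_stage_cons.
Qed.

Lemma germs_prv D (A : fm D) (e : genv D) : pr nil A -> sat (M := germs) A e.
Proof.
move=> HA; apply/truth; exists 0 => n _.
by move: HA; apply: prv_ren.
Qed.

Lemma germs_hyp (A : fm (sctx S0)) (e : genv (sctx S0)) :
  In A (shyp S0) -> (forall a v, e a v 0 = Var v) ->
  (forall a v n, e a v n.+1 = ren_tm (up n) (e a v n)) -> sat (M := germs) A e.
Proof.
move=> HA e0 eS; apply/truth; apply: (holdsP (N := 0)).
  move=> n _; apply: subst_ext => a v; rewrite /comp_subst /= eS.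
  by rewrite subst_ren_tm.
exists 0 => //; have -> : at_stage e 0 = (fun _ v => Var v) by apply: subst_ext.
by rewrite subst_fm_id; apply: prv_hyp.
Qed.

End Henkin.

(** * Completeness *)

Lemma eval_ren (M : structure) G D (r : renaming G D) a (t : tm G a) (e : env M D) :
  eval (ren_tm r t) e = eval t (fun b v => e b (r b v)).
Proof. by elim: t => //= b c s -> t ->. Qed.

Lemma eval_shift (M : structure) G b (x : M b) (e : env M G) a (t : tm G a) :
  eval (ren_tm shift t) (econs x e) = eval t e.
Proof. by rewrite eval_ren. Qed.

Lemma eval_subst (M : structure) G D (s : substitution G D) a (t : tm G a) (e : env M D) :
  eval (subst_tm s t) e = eval t (fun b v => eval (s b v) e).
Proof. by elim: t => //= b c u -> t ->. Qed.

Lemma sat_subst (M : structure) G (A : fm G) : forall D (s : substitution G D) (e : env M D),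
  sat (subst_fm A s) e <-> sat A (fun b v => eval (s b v) e).
Proof.
elim: A => {G} [G|G t u|G t u|G A IA B IB|G a A IA] D s e; rewrite /= !satE //.
1,2: by rewrite !eval_subst.
- by split=> H /IA /H /IB.
- split=> H x; move: (H x); rewrite IA; congr sat;
    apply: env_ext; apply: var_case => //= b v; by rewrite eval_shift.
Qed.

Fixpoint eq_at (M : structure) a : M a -> M a -> Prop :=
  match a return M a -> M a -> Prop with
  | ty0 => @eq0 M
  | Arr b c => fun f g => forall x, eq_at (ap f x) (ap g x)
  end.

Lemma sat_EqT (M : structure) a : forall G (s t : tm G a) (e : env M G),
  sat (EqT s t) e <-> eq_at (eval s e) (eval t e).
Proof.
elim: a => [|b _ c IH] G s t e //.
rewrite /= satE.
split=> H x; move: (H x); rewrite IH /= /weaken !eval_ren //.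
Qed.

Record model := Model {
  str :> structure;
  eq0E : forall x y : str ty0, eq0 x y <-> x = y;
  extensional : forall a b (f g : str (Arr a b)), (forall x, ap f x = ap g x) -> f = g;
  model_ax : forall G (A : fm G) (e : env str G), @RCA0w G A -> sat A e }.

Lemma qf_subst G (A : fm G) : qf A -> forall D (s : substitution G D), qf (subst_fm A s).
Proof. by elim: A => //= G' A IA B IB [HA HB] D s; split; [exact: IA|exact: IB]. Qed.

Lemma RCA0w_subst G D (A : fm G) (s : substitution G D) :
  @RCA0w G A -> @RCA0w D (subst_fm A s).
Proof.
move=> H; case: H D s => {A G} [G A HA|G a b|G a b c|G|G|G a b|G A HA|G A HA] D s.
- by apply: ax_semiring; case: HA; constructor.
- rewrite /all_ /= subst_fm_EqT; exact: ax_Pi.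
- rewrite /all_ /= subst_fm_EqT; exact: ax_Sigma.
- exact: ax_Rec_0.
- exact: ax_Rec_S.
- rewrite /all_ /= !subst_fm_EqT; exact: ax_ext.
- rewrite /= subst_fm_inst.
  have -> : subst_fm (subst_fm A subst_succ) (lift_subst s) =
     subst_fm (subst_fm A (lift_subst s)) subst_succ.
    rewrite !subst_fm_comp; congr (subst_fm A); apply: subst_ext; apply: var_case => //= a v.
    by rewrite /comp_subst /= /subst_succ subst_scons_shift subst_ren_tm.
  by apply: ax_QF_ind; apply: qf_subst.
- rewrite /Ex /=.
  have -> : subst_fm (subst_fm A subst_choice) (lift_subst (lift_subst s)) =
     subst_fm (subst_fm A (lift_subst (lift_subst s))) subst_choice.
    rewrite !subst_fm_comp; congr (subst_fm A); apply: subst_ext.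
    do 2 apply: var_case => //=; move=> a v.
    rewrite /comp_subst /= /subst_choice !subst_scons_shift.
    by rewrite -!subst_ren_tm subst_tm_comp.
  by apply: ax_QF_AC10; apply: qf_subst.
Qed.

Section EqualityRules.
Variables (Ax : axioms) (G : ctx) (H : list (fm G)).
Local Notation pr := (prv Ax G H).

Lemma prv_eq_sym s t : pr (FEq s t) -> pr (FEq t s).
Proof.
move=> st; have := prv_eq_subst Ax G H (FEq (Var vz) (ren_tm shift s)) s t st.
rewrite /inst /= !subst_scons_shift !subst_tm_id; apply; exact: prv_eq_refl.
Qed.

Lemma prv_eq_trans s t u : pr (FEq s t) -> pr (FEq t u) -> pr (FEq s u).
Proof.
move=> st tu; have := prv_eq_subst Ax G H (FEq (ren_tm shift s) (Var vz)) t u tu.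
by rewrite /inst /= !subst_scons_shift !subst_tm_id; apply.
Qed.

Lemma prv_lt_eq s t s' t' : pr (FEq s s') -> pr (FEq t t') -> pr (FLt s t) -> pr (FLt s' t').
Proof.
move=> ss tt st; have := prv_eq_subst Ax G H (FLt (Var vz) (ren_tm shift t)) s s' ss.
rewrite /inst /= !subst_scons_shift !subst_tm_id => /(_ st) st'.
have := prv_eq_subst Ax G H (FLt (ren_tm shift s') (Var vz)) t t' tt.
by rewrite /inst /= !subst_scons_shift !subst_tm_id; apply.
Qed.
End EqualityRules.

Section QuotientModel.
Variable S0 : stage RCA0w.
Local Notation g := (germs RCA0w_subst S0).
Local Notation eqa a := (@eq_at g a).

Lemma eq_at_refl a (x : g a) : eqa a x x.
Proof.
elim: a x => [x|b _ c IH f] /=; last by move=> x; apply: IH.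
by exists 0 => n _; apply: prv_eq_refl.
Qed.

Lemma eq_at_sym a (x y : g a) : eqa a x y -> eqa a y x.
Proof.
elim: a x y => [x y|b _ c IH f h] /=; last by move=> H x; apply: IH.
by move=> [N HN]; exists N => n /HN; apply: prv_eq_sym.
Qed.

Lemma eq_at_trans a (x y z : g a) : eqa a x y -> eqa a y z -> eqa a x z.
Proof.
elim: a x y z => [x y z|b _ c IH f h k] /=; last by move=> H H' x; apply: IH (H x) (H' x).
move=> [N HN] [M HM]; exists (maxn N M) => n; rewrite geq_max => /andP[/HN H /HM].
exact: prv_eq_trans.
Qed.

Lemma germs_ax G (A : fm G) (e : env g G) : @RCA0w G A -> sat A e.
Proof. by move=> HA; apply: germs_prv; apply: prv_ax. Qed.

Lemma eq_at_ap a b (f h : g (Arr a b)) (x y : g a) :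
  eqa _ f h -> eqa _ x y -> eqa _ (ap f x) (ap h y).
Proof.
move=> fh xy; apply: eq_at_trans (_ : eqa _ (ap f y) _); last exact: fh.
have := germs_ax (enil g) (ax_ext nil a b).
rewrite /all_ satE => /(_ x); rewrite satE => /(_ y); rewrite satE => /(_ f).
by rewrite satE !sat_EqT; apply.
Qed.

Lemma germs_lt_eq (x y x' y' : g ty0) : eqa _ x x' -> eqa _ y y' ->
  lt0 x y -> lt0 x' y'.
Proof.
move=> [N HN] [M HM] [K HK]; exists (maxn N (maxn M K)) => n.
rewrite !geq_max => /and3P[/HN H1 /HM H2 /HK]; exact: prv_lt_eq.
Qed.

Local Notation cls := (class (@eq_at g _)).
Local Notation rep := (repr (E := @eq_at g _)).

Definition quotient : structure := {|
  dom a := quot (eqa a);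
  ap a b f x := cls (ap (rep f) (rep x));
  con a c := cls (con g c);
  eq0 x y := x = y;
  lt0 x y := lt0 (rep x) (rep y) |}.

Lemma rep_cls a (x : g a) : eqa a (rep (cls x)) x.
Proof. exact: (repr_class (@eq_at_refl a) (@eq_at_sym a) (@eq_at_trans a)). Qed.

Lemma cls_eq a (x y : g a) : cls x = cls y <-> eqa a x y.
Proof. exact: (class_eq (@eq_at_refl a) (@eq_at_sym a) (@eq_at_trans a)). Qed.

Lemma ap_cls a b (f : g (Arr a b)) (x : g a) :
  ap (s := quotient) (cls f) (cls x) = cls (ap f x).
Proof. by apply/cls_eq; apply: eq_at_ap; apply: rep_cls. Qed.

Definition cls_env G (e : env g G) : env quotient G := fun a v => cls (e a v).

Lemma cls_env_cons G b (x : g b) (e : env g G) :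
  econs (cls x : quotient b) (cls_env e) = cls_env (econs x e : env g (b :: G)).
Proof. by apply: env_ext; apply: var_case. Qed.

Lemma cls_env_surj G (e : env quotient G) : exists e', e = cls_env e'.
Proof.
exists (fun a v => rep (e a v)); apply: env_ext => a v.
by rewrite /cls_env reprK.
Qed.

Lemma eval_cls G a (t : tm G a) (e : env g G) :
  eval t (cls_env e) = cls (eval t e) :> quotient a.
Proof. by elim: t => //= b c s -> t ->; apply: ap_cls. Qed.

Lemma sat_cls G (A : fm G) : forall e : env g G,
  sat (M := quotient) A (cls_env e) <-> sat A e.
Proof.
elim: A => {G} [G|G s t|G s t|G A IA B IB|G a A IA] e; rewrite !satE //.
- rewrite !eval_cls; exact: cls_eq.
- rewrite !eval_cls /=; split; apply: germs_lt_eq; try exact: rep_cls; apply: eq_at_sym; exact: rep_cls.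
- by split=> H /IA /H /IB.
- split=> H x; first by apply/IA; rewrite -cls_env_cons.
  by rewrite -(reprK x) cls_env_cons; apply/IA.
Qed.

Lemma quotient_ext a b (f h : quotient (Arr a b)) :
  (forall x, ap f x = ap h x) -> f = h.
Proof.
rewrite -(reprK f) -(reprK h) => H; apply/cls_eq => x.
by apply/cls_eq; rewrite -!ap_cls; apply: H.
Qed.

Lemma quotient_ax G (A : fm G) (e : env quotient G) : @RCA0w G A -> sat A e.
Proof.
by move=> HA; have [e' ->] := cls_env_surj e; apply/sat_cls; apply: germs_ax.
Qed.

Definition quotient_model : model :=
  @Model quotient (fun x y => iff_refl _) quotient_ext quotient_ax.

End QuotientModel.

Theorem completeness (A : fm nil) :
  (forall M : model, sat A (enil M)) -> RCA0w_proves A.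
Proof.
move=> HA; apply: prv_raa; case: (EM (prv RCA0w nil (Neg A :: nil) FBot)) => // con.
have := HA (quotient_model (Stage con)).
have [e ->] := cls_env_surj (enil (quotient_model (Stage con))).
move=> /sat_cls HA'.
have /(_ HA') [] : sat (Neg A) e.
by apply: germs_hyp => [|a v|a v]; [left|apply: (var_nil _ v)|apply: (var_nil _ v)].
Qed.

(** * Ordered fields from congruences *)

Local Open Scope ring_scope.

Record prefield := Prefield {
  pf_car : Type;
  pf_eq : pf_car -> pf_car -> Prop;
  pf_add : pf_car -> pf_car -> pf_car;
  pf_opp : pf_car -> pf_car;
  pf_mul : pf_car -> pf_car -> pf_car;
  pf_0 : pf_car;
  pf_1 : pf_car;
  pf_pos : pf_car -> Prop;
  pf_refl : forall x, pf_eq x x;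
  pf_sym : forall x y, pf_eq x y -> pf_eq y x;
  pf_trans : forall x y z, pf_eq x y -> pf_eq y z -> pf_eq x z;
  pf_add_eq : forall x y z, pf_eq x y -> pf_eq (pf_add x z) (pf_add y z);
  pf_opp_eq : forall x y, pf_eq x y -> pf_eq (pf_opp x) (pf_opp y);
  pf_mul_eq : forall x y z, pf_eq x y -> pf_eq (pf_mul x z) (pf_mul y z);
  pf_pos_eq : forall x y, pf_eq x y -> pf_pos x -> pf_pos y;
  pf_addA : forall x y z, pf_eq (pf_add x (pf_add y z)) (pf_add (pf_add x y) z);
  pf_addC : forall x y, pf_eq (pf_add x y) (pf_add y x);
  pf_add0 : forall x, pf_eq (pf_add pf_0 x) x;
  pf_addN : forall x, pf_eq (pf_add (pf_opp x) x) pf_0;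
  pf_mulA : forall x y z, pf_eq (pf_mul x (pf_mul y z)) (pf_mul (pf_mul x y) z);
  pf_mulC : forall x y, pf_eq (pf_mul x y) (pf_mul y x);
  pf_mul1 : forall x, pf_eq (pf_mul pf_1 x) x;
  pf_mulD : forall x y z,
    pf_eq (pf_mul (pf_add x y) z) (pf_add (pf_mul x z) (pf_mul y z));
  pf_inv : forall x, pf_pos x -> exists y, pf_eq (pf_mul y x) pf_1;
  pf_pos1 : pf_pos pf_1;
  pf_posN : forall x, pf_pos x -> ~ pf_pos (pf_opp x);
  pf_pos_add : forall x y, pf_pos x -> pf_pos y -> pf_pos (pf_add x y);
  pf_pos_mul : forall x y, pf_pos x -> pf_pos y -> pf_pos (pf_mul x y);
  pf_total : forall x, pf_eq x pf_0 \/ pf_pos x \/ pf_pos (pf_opp x) }.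

Section FieldOf.
Variable P : prefield.
Local Notation T := (pf_car P).
Definition field_of := quot (@pf_eq P).
Definition fcl (x : T) : field_of := class (@pf_eq P) x.
Local Notation rp := (@repr _ (@pf_eq P)).

Lemma fcl_eq x y : fcl x = fcl y <-> pf_eq x y.
Proof. exact: (class_eq (@pf_refl P) (@pf_sym P) (@pf_trans P)). Qed.

Lemma fcl_rp q : fcl (rp q) = q.
Proof. exact: reprK. Qed.

Lemma rp_fcl x : pf_eq (rp (fcl x)) x.
Proof. by apply/fcl_eq; rewrite fcl_rp. Qed.

Lemma field_of_ind (Q : field_of -> Prop) : (forall x, Q (fcl x)) -> forall q, Q q.
Proof. by move=> H q; rewrite -(fcl_rp q). Qed.

HB.instance Definition _ := gen_eqMixin field_of.
HB.instance Definition _ := gen_choiceMixin field_of.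

Definition fadd (p q : field_of) := fcl (pf_add (rp p) (rp q)).
Definition fopp (p : field_of) := fcl (pf_opp (rp p)).
Definition fmul (p q : field_of) := fcl (pf_mul (rp p) (rp q)).
Definition fpos (p : field_of) := pf_pos (rp p).

Lemma faddE x y : fadd (fcl x) (fcl y) = fcl (pf_add x y).
Proof.
apply/fcl_eq; apply: pf_trans (pf_add_eq _ (rp_fcl x)) _.
apply: pf_trans (pf_addC _ _) _; apply: pf_trans (pf_add_eq _ (rp_fcl y)) _.
exact: pf_addC.
Qed.

Lemma foppE x : fopp (fcl x) = fcl (pf_opp x).
Proof. by apply/fcl_eq; apply: pf_opp_eq; apply: rp_fcl. Qed.

Lemma fmulE x y : fmul (fcl x) (fcl y) = fcl (pf_mul x y).
Proof.
apply/fcl_eq; apply: pf_trans (pf_mul_eq _ (rp_fcl x)) _.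
apply: pf_trans (pf_mulC _ _) _; apply: pf_trans (pf_mul_eq _ (rp_fcl y)) _.
exact: pf_mulC.
Qed.

Lemma fposE x : fpos (fcl x) <-> pf_pos x.
Proof. split; apply: pf_pos_eq; [|apply: pf_sym]; exact: rp_fcl. Qed.

Lemma faddA : associative fadd.
Proof. by do 3 elim/field_of_ind => ?; rewrite !faddE; apply/fcl_eq; apply: pf_addA. Qed.
Lemma faddC : commutative fadd.
Proof. by do 2 elim/field_of_ind => ?; rewrite !faddE; apply/fcl_eq; apply: pf_addC. Qed.
Lemma fadd0 : left_id (fcl (pf_0 P)) fadd.
Proof. by elim/field_of_ind => ?; rewrite !faddE; apply/fcl_eq; apply: pf_add0. Qed.
Lemma faddN : left_inverse (fcl (pf_0 P)) fopp fadd.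
Proof. by elim/field_of_ind => ?; rewrite foppE !faddE; apply/fcl_eq; apply: pf_addN. Qed.

HB.instance Definition _ := GRing.isZmodule.Build field_of faddA faddC fadd0 faddN.

Lemma fmulA : associative fmul.
Proof. by do 3 elim/field_of_ind => ?; rewrite !fmulE; apply/fcl_eq; apply: pf_mulA. Qed.
Lemma fmulC : commutative fmul.
Proof. by do 2 elim/field_of_ind => ?; rewrite !fmulE; apply/fcl_eq; apply: pf_mulC. Qed.
Lemma fmul1 : left_id (fcl (pf_1 P)) fmul.
Proof. by elim/field_of_ind => ?; rewrite !fmulE; apply/fcl_eq; apply: pf_mul1. Qed.
Lemma fmulD : left_distributive fmul fadd.
Proof.
by do 3 elim/field_of_ind => ?; rewrite !(fmulE, faddE); apply/fcl_eq; apply: pf_mulD.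
Qed.

Lemma fpos0 : ~ fpos 0.
Proof.
move=> /fposE H; apply: (pf_posN H); apply: pf_pos_eq H.
by apply/fcl_eq; rewrite -foppE -[LHS]/(0 : field_of) -[RHS]/(- 0 : field_of) oppr0.
Qed.

Lemma fone_neq0 : fcl (pf_1 P) != 0.
Proof. by apply/eqP => E; apply: fpos0; rewrite -E; apply/fposE/pf_pos1. Qed.

HB.instance Definition _ := GRing.Zmodule_isComNzRing.Build field_of
  fmulA fmulC fmul1 fmulD fone_neq0.

Lemma fclD x y : fcl (pf_add x y) = fcl x + fcl y.
Proof. by rewrite -faddE. Qed.
Lemma fclN x : fcl (pf_opp x) = - fcl x.
Proof. by rewrite -foppE. Qed.
Lemma fclM x y : fcl (pf_mul x y) = fcl x * fcl y.
Proof. by rewrite -fmulE. Qed.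

Lemma fpos_total (x : field_of) : x != 0 -> fpos x \/ fpos (- x).
Proof.
elim/field_of_ind: x => x; rewrite -fclN !fposE => /eqP x0.
by case: (pf_total x) => // /fcl_eq.
Qed.

Lemma finv_ex (x : field_of) :
  exists y : field_of, (x != 0 -> y * x = 1) /\ (x = 0 -> y = 0).
Proof.
have [->|x0] := eqVneq x 0; first by exists 0.
suff [y yx] : exists y : field_of, y * x = 1.
  by exists y; split=> // E; rewrite E eqxx in x0.
case: (fpos_total x0); elim/field_of_ind: x x0 => x _.
  move=> /fposE/pf_inv [y /fcl_eq yx]; exists (fcl y).
  by rewrite -fclM.
rewrite -fclN => /fposE/pf_inv [y /fcl_eq yx]; exists (- fcl y).
by rewrite mulNr -mulrN -fclN -fclM.
Qed.

Definition finv (x : field_of) : field_of := projT1 (cid (finv_ex x)).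

Lemma fmulV (x : field_of) : x != 0 -> finv x * x = 1.
Proof. exact: (projT2 (cid (finv_ex x))).1. Qed.

Lemma finv0 : finv 0 = 0.
Proof. exact: (projT2 (cid (finv_ex 0))).2. Qed.

HB.instance Definition _ := GRing.ComNzRing_isField.Build field_of fmulV finv0.

Definition flt (x y : field_of) : bool := `[< fpos (y - x) >].
Definition fle (x y : field_of) : bool := (x == y) || flt x y.
Definition fnorm (x : field_of) : field_of := if flt 0 x then x else - x.

Lemma flt0 x : flt 0 x <-> fpos x.
Proof. by rewrite /flt subr0; split=> /asboolP. Qed.
Lemma fgt0 x : flt x 0 <-> fpos (- x).
Proof. by rewrite /flt sub0r; split=> /asboolP. Qed.

Lemma flt0_add x y : flt 0 x -> flt 0 y -> flt 0 (x + y).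
Proof.
elim/field_of_ind: x => x; elim/field_of_ind: y => y.
rewrite -fclD; move=> /flt0/fposE Hx /flt0/fposE Hy; apply/flt0/fposE; exact: pf_pos_add.
Qed.

Lemma flt0_mul x y : flt 0 x -> flt 0 y -> flt 0 (x * y).
Proof.
elim/field_of_ind: x => x; elim/field_of_ind: y => y.
rewrite -fclM; move=> /flt0/fposE Hx /flt0/fposE Hy; apply/flt0/fposE; exact: pf_pos_mul.
Qed.

Lemma flt0_ngt0 x : flt 0 x -> ~~ flt x 0.
Proof.
elim/field_of_ind: x => x /flt0/fposE Hx; apply/negP => /fgt0.
by rewrite -fclN => /fposE; apply: pf_posN.
Qed.

Lemma fsub_gt0 x y : flt 0 (y - x) = flt x y.
Proof. by rewrite /flt subr0. Qed.

Lemma flt0_total x : x != 0 -> flt 0 x || flt x 0.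
Proof. by move=> /fpos_total [/flt0 ->|/fgt0 ->]; rewrite ?orbT. Qed.

Lemma fnormN x : fnorm (- x) = fnorm x.
Proof.
rewrite /fnorm; have [->|x0] := eqVneq x 0; first by rewrite !oppr0.
have E : flt 0 (- x) = flt x 0 by rewrite -[RHS]fsub_gt0 sub0r.
rewrite E opprK; case/orP: (flt0_total x0) => H; rewrite H.
  by rewrite (negbTE (flt0_ngt0 H)).
by case: ifP => // /flt0_ngt0; rewrite H.
Qed.

Lemma fge0_norm x : fle 0 x -> fnorm x = x.
Proof.
rewrite /fle /fnorm => /predU1P[<-|->] //.
by rewrite oppr0 if_same.
Qed.

HB.instance Definition _ := Num.IntegralDomain_isLtReal.Build field_of
  flt0_add flt0_mul flt0_ngt0 fsub_gt0 flt0_total fnormN fge0_norm (fun _ _ => erefl).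

Lemma fcl_gt0 x : (0 < fcl x) <-> pf_pos x.
Proof. by rewrite -fposE -flt0. Qed.

End FieldOf.

(** * Fractions over a discretely ordered semiring *)

Record discrete_semiring := DiscreteSemiring {
  dcar :> Type;
  dadd : dcar -> dcar -> dcar;
  dmul : dcar -> dcar -> dcar;
  d0 : dcar;
  d1 : dcar;
  dlt : dcar -> dcar -> Prop;
  daddA : forall x y z, dadd (dadd x y) z = dadd x (dadd y z);
  daddC : forall x y, dadd x y = dadd y x;
  dadd0 : forall x, dadd x d0 = x;
  dmulA : forall x y z, dmul (dmul x y) z = dmul x (dmul y z);
  dmulC : forall x y, dmul x y = dmul y x;
  dmul1 : forall x, dmul x d1 = x;
  dmul0 : forall x, dmul x d0 = d0;
  dmulD : forall x y z, dmul x (dadd y z) = dadd (dmul x y) (dmul x z);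
  dlt_irr : forall x, ~ dlt x x;
  dlt_trans : forall x y z, dlt x y -> dlt y z -> dlt x z;
  dlt_total : forall x y, [\/ dlt x y, x = y | dlt y x];
  dlt_add : forall x y z, dlt x y -> dlt (dadd x z) (dadd y z);
  dlt_mul : forall x y z, dlt d0 z -> dlt x y -> dlt (dmul x z) (dmul y z);
  dlt01 : dlt d0 d1;
  dge0 : forall x, dlt d0 x \/ d0 = x;
  dge1 : forall x, dlt d0 x -> dlt d1 x \/ d1 = x;
  dsub : forall x y, dlt x y -> exists z, dadd x z = y }.

Section Fractions.
Variable N : discrete_semiring.
Declare Scope N_scope.
Delimit Scope N_scope with dN.
Local Notation "x + y" := (dadd x y) : N_scope.
Local Notation "x * y" := (dmul x y) : N_scope.
Local Notation "0" := (d0 N) : N_scope.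
Local Notation "1" := (d1 N) : N_scope.
Local Notation "x < y" := (dlt x y) : N_scope.
Local Open Scope N_scope.

Lemma dsemiring : semi_ring_theory 0 1 (@dadd N) (@dmul N) eq.
Proof.
constructor=> *; rewrite ?daddA ?dmulA //.
- by rewrite daddC dadd0.
- exact: daddC.
- by rewrite dmulC dmul1.
- by rewrite dmulC dmul0.
- exact: dmulC.
- by rewrite dmulC dmulD; congr dadd; apply: dmulC.
Qed.

Add Ring dring : dsemiring.

Lemma dadd_cancel (x y z : N) : x + z = y + z -> x = y.
Proof.
move=> E; case: (dlt_total x y) => // /(dlt_add z); rewrite E => /dlt_irr [].
Qed.

Lemma dmul_cancel (x y z : N) : 0 < z -> x * z = y * z -> x = y.
Proof.
move=> z0 E; case: (dlt_total x y) => // /(dlt_mul z0); rewrite E => /dlt_irr [].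
Qed.

Lemma dlt_add_cancel (x y z : N) : x + z < y + z -> x < y.
Proof.
move=> E; case: (dlt_total x y) => [//|xy|/(dlt_add z)]; first by move: E; rewrite xy => /dlt_irr.
by move=> /(dlt_trans E) /dlt_irr.
Qed.

Lemma dlt_mul_cancel (x y z : N) : 0 < z -> x * z < y * z -> x < y.
Proof.
move=> z0 E; case: (dlt_total x y) => [//|xy|/(dlt_mul z0)]; first by move: E; rewrite xy => /dlt_irr.
by move=> /(dlt_trans E) /dlt_irr.
Qed.

Lemma dlt_subP (x y : N) : x < y -> exists2 z, 0 < z & y = x + z.
Proof.
move=> xy; have [z zE] := dsub xy; exists z => //.
case: (dge0 z) => // z0; move: xy; rewrite -zE -z0 dadd0 => /dlt_irr [].
Qed.

Lemma dlt_add2 (x y z t : N) : x < y -> z < t -> x + z < y + t.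
Proof.
by move=> /(dlt_add z) xy /(dlt_add y); rewrite !(daddC _ y); apply: dlt_trans.
Qed.

Lemma dlt0_mul (x y : N) : 0 < x -> 0 < y -> 0 < x * y.
Proof. by move=> x0 /dlt_mul /(_ x0); rewrite dmulC dmul0. Qed.

Lemma dlt_addl (x y : N) : 0 < y -> x < x + y.
Proof. by move=> /(dlt_add x); rewrite !(daddC _ x) dadd0. Qed.

Record fraction := Fraction { fnum : N; fneg : N; fden : N; fden_gt0 : 0 < fden }.

Definition fr_eq x y := fnum x * fden y + fneg y * fden x = fnum y * fden x + fneg x * fden y.
Definition fr_add x y := @Fraction (fnum x * fden y + fnum y * fden x)
  (fneg x * fden y + fneg y * fden x) _ (dlt0_mul (fden_gt0 x) (fden_gt0 y)).
Definition fr_opp x := @Fraction (fneg x) (fnum x) _ (fden_gt0 x).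
Definition fr_mul x y := @Fraction (fnum x * fnum y + fneg x * fneg y)
  (fnum x * fneg y + fneg x * fnum y) _ (dlt0_mul (fden_gt0 x) (fden_gt0 y)).
Definition fr_nat n := @Fraction n 0 _ (dlt01 N).
Definition fr_pos x := fneg x < fnum x.

Lemma fr_trans x y z : fr_eq x y -> fr_eq y z -> fr_eq x z.
Proof.
case: x y z => [a b c c0] [a' b' c' c'0] [a2 b2 c2 c20]; rewrite /fr_eq /= => E E'.
apply: (dmul_cancel c'0); apply: (@dadd_cancel _ _ (b' * c * c2 + a' * c * c2)).
transitivity ((a * c' + b' * c) * c2 + (a' * c2 + b2 * c') * c); first by ring.
rewrite E E'; ring.
Qed.

Lemma fr_pos_eq x y : fr_eq x y -> fr_pos x -> fr_pos y.
Proof.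
case: x y => [a b c c0] [a' b' c' c'0]; rewrite /fr_eq /fr_pos /= => E ba.
apply: (dlt_mul_cancel c0); apply: (@dlt_add_cancel _ _ (b * c')).
rewrite -E; have := dlt_add (b' * c) (dlt_mul c'0 ba).
by rewrite daddC.
Qed.

Lemma fr_pos_mul x y : fr_pos x -> fr_pos y -> fr_pos (fr_mul x y).
Proof.
case: x y => [a b c c0] [a' b' c' c'0]; rewrite /fr_pos /=.
move=> /dlt_subP [u u0 ->] /dlt_subP [v v0 ->].
have := dlt_addl ((b + u) * b' + b * (b' + v)) (dlt0_mul u0 v0).
congr (_ < _); ring.
Qed.

Lemma fr_inv x : fr_pos x -> exists y, fr_eq (fr_mul y x) (fr_nat 1).
Proof.
case: x => [a b c c0]; rewrite /fr_pos /= => /dlt_subP [u u0 ->].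
exists (@Fraction c 0 _ u0); rewrite /fr_eq /=; ring.
Qed.

Lemma fr_total x : fr_eq x (fr_nat 0) \/ fr_pos x \/ fr_pos (fr_opp x).
Proof.
case: x => [a b c c0]; rewrite /fr_eq /fr_pos /=.
case: (dlt_total a b) => [|->|]; [by right; right| |by right; left].
by left; ring.
Qed.

Definition fractions : prefield.
Proof.
refine (@Prefield fraction fr_eq fr_add fr_opp fr_mul (fr_nat 0) (fr_nat 1) fr_pos
  _ _ fr_trans _ _ _ fr_pos_eq _ _ _ _ _ _ _ _ fr_inv _ _ _ fr_pos_mul fr_total);
  rewrite /fr_eq /fr_pos.
- by [].
- by move=> x y.
- move=> [a b c c0] [a' b' c' c'0] [d e f f0] /= E.
  transitivity ((a * c' + b' * c) * f * f + (d * c * c' * f + e * c * c' * f)); first by ring.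
  by rewrite E; ring.
- move=> [a b c c0] [a' b' c' c'0] /= E.
  by rewrite daddC -E daddC.
- move=> [a b c c0] [a' b' c' c'0] [d e f f0] /= E.
  transitivity ((a * c' + b' * c) * d * f + (a' * c + b * c') * e * f); first by ring.
  transitivity ((a' * c + b * c') * d * f + (a * c' + b' * c) * e * f); first by rewrite E.
  by ring.
- by move=> [a b c c0] [a' b' c' c'0] [d e f f0] /=; ring.
- by move=> [a b c c0] [a' b' c' c'0] /=; ring.
- by move=> [a b c c0] /=; ring.
- by move=> [a b c c0] /=; ring.
- by move=> [a b c c0] [a' b' c' c'0] [d e f f0] /=; ring.
- by move=> [a b c c0] [a' b' c' c'0] /=; ring.
- by move=> [a b c c0] /=; ring.
- by move=> [a b c c0] [a' b' c' c'0] [d e f f0] /=; ring.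
- exact: dlt01.
- by move=> [a b c c0] /= ab /(dlt_trans ab) /dlt_irr.
- move=> [a b c c0] [a' b' c' c'0] /= ba ba'.
  by apply: dlt_add2; apply: dlt_mul.
Defined.

Definition fracs := field_of fractions.

Local Open Scope ring_scope.

Definition nat_frac (n : N) : fracs := fcl (P := fractions) (fr_nat n).

Lemma nat_frac0 : nat_frac (d0 N) = 0. Proof. by []. Qed.
Lemma nat_frac1 : nat_frac (d1 N) = 1. Proof. by []. Qed.

Lemma nat_fracD m n : nat_frac (dadd m n) = nat_frac m + nat_frac n.
Proof. rewrite -fclD; apply/fcl_eq; rewrite /= /fr_eq /=; ring. Qed.

Lemma nat_fracM m n : nat_frac (dmul m n) = nat_frac m * nat_frac n.
Proof. rewrite -fclM; apply/fcl_eq; rewrite /= /fr_eq /=; ring. Qed.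

Lemma nat_frac_lt m n : (nat_frac m < nat_frac n) <-> dlt m n.
Proof.
rewrite -subr_gt0 -fclN -fclD fcl_gt0 /= /fr_pos /=.
suff -> : dadd (dmul (d0 N) (d1 N)) (dmul m (d1 N)) = m.
  by suff -> : dadd (dmul n (d1 N)) (dmul (d0 N) (d1 N)) = n by []; ring.
ring.
Qed.

Lemma nat_frac_inj m n : nat_frac m = nat_frac n -> m = n.
Proof.
move=> E; case: (dlt_total m n) => // /nat_frac_lt; rewrite E ltxx //.
Qed.

Lemma nat_frac_ge0 n : 0 <= nat_frac n.
Proof.
rewrite -nat_frac0; case: (dge0 n) => [/nat_frac_lt/ltW //|<-]; exact: lexx.
Qed.

Lemma nat_frac_le m n : (nat_frac m <= nat_frac n) <-> dlt m n \/ m = n.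
Proof.
rewrite le_eqVlt; split; last by case=> [/nat_frac_lt ->|->]; rewrite ?orbT ?eqxx.
by case/orP=> [/eqP/nat_frac_inj|/nat_frac_lt]; [right|left].
Qed.

Lemma nat_frac_discrete m n : nat_frac m < nat_frac n -> nat_frac m + 1 <= nat_frac n.
Proof.
move=> /nat_frac_lt /dlt_subP [z z0 ->]; rewrite nat_fracD lerD2l.
by apply/nat_frac_le; apply: dge1.
Qed.

Lemma frac_gt0 (k : fracs) : 0 < k -> exists2 n, dlt (d0 N) n & (nat_frac n)^-1 <= k.
Proof.
elim/field_of_ind: k => -[a b c c0]; rewrite fcl_gt0 /= /fr_pos /= => /dlt_subP [u u0 ->].
exists c => //.
have c_gt0 : 0 < nat_frac c by rewrite -nat_frac0; apply/nat_frac_lt.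
have -> : fcl (P := fractions) (@Fraction (dadd b u) b _ c0) =
  nat_frac u / nat_frac c.
  apply: (mulIf (lt0r_neq0 c_gt0)); rewrite mulfVK ?lt0r_neq0 //.
  by rewrite -fclM; apply/fcl_eq; rewrite /= /fr_eq /=; ring.
rewrite ler_pdivlMr // mulVf ?lt0r_neq0 //; apply/nat_frac_le; exact: dge1.
Qed.

End Fractions.

(** Fields of fractions are used through this record, with its inhabitant opaque:
    conversion must not unfold the quotient. *)
Record fraction_field (S : discrete_semiring) := FractionField {
  ffield :> realFieldType;
  finj : S -> ffield;
  finj0 : finj (d0 S) = 0%R;
  finj1 : finj (d1 S) = 1%R;
  finjD : forall m n, finj (dadd m n) = (finj m + finj n)%R;
  finjM : forall m n, finj (dmul m n) = (finj m * finj n)%R;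
  finj_lt : forall m n, (finj m < finj n)%R <-> dlt m n;
  finj_inj : forall m n, finj m = finj n -> m = n;
  finj_ge0 : forall n, (0 <= finj n)%R;
  finj_le : forall m n, (finj m <= finj n)%R <-> dlt m n \/ m = n;
  finj_discrete : forall m n, (finj m < finj n)%R -> (finj m + 1 <= finj n)%R;
  ffield_gt0 : forall k : ffield, (0 < k)%R ->
    exists2 n, dlt (d0 S) n & ((finj n)^-1 <= k)%R }.

Lemma fraction_field_of S : fraction_field S.
Proof.
exact: (@FractionField S (fracs S) (@nat_frac S) (nat_frac0 S) (nat_frac1 S) (@nat_fracD S)
  (@nat_fracM S) (@nat_frac_lt S) (@nat_frac_inj S) (@nat_frac_ge0 S) (@nat_frac_le S)
  (@nat_frac_discrete S) (@frac_gt0 S)).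
Qed.

(** * Cauchy completion *)

Import ring lra.

Section Completion.
Variables (K : realFieldType) (I : Type) (le : I -> I -> Prop) (i0 : I).
Hypotheses (le_refl : forall i, le i i)
  (le_trans : forall i j k, le i j -> le j k -> le i k)
  (le_directed : forall i j, exists2 k, le i k & le j k).

Definition ev (P : I -> Prop) := exists i, forall j, le i j -> P j.

Lemma evI P Q : ev P -> ev Q -> ev (fun i => P i /\ Q i).
Proof.
move=> [i Hi] [j Hj]; have [k ik jk] := le_directed i j.
by exists k => l kl; split; [apply: Hi|apply: Hj]; apply: le_trans kl.
Qed.

Lemma evS P Q : (forall i, P i -> Q i) -> ev P -> ev Q.
Proof. by move=> H [i Hi]; exists i => j /Hi /H. Qed.

Lemma ev_ex P : ev P -> exists i, P i.
Proof. by move=> [i Hi]; exists i; apply: Hi. Qed.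

Lemma evT P : (forall i, P i) -> ev P.
Proof. by move=> H; exists i0. Qed.

Definition cauchy (f : I -> K) := forall e, 0 < e ->
  exists i, forall j k, le i j -> le i k -> `|f j - f k| < e.

Record cseq := Cseq { cval :> I -> K; cvalP : cauchy cval }.

Lemma cauchy_bounded f : cauchy f -> exists2 B, 0 < B & ev (fun i => `|f i| <= B).
Proof.
move=> /(_ 1 ltr01) [i Hi]; exists (`|f i| + 1); first by rewrite ltr_wpDl.
exists i => j ij; have := Hi _ _ ij (le_refl i).
rewrite -{2}(subrK (f i) (f j)) => H; apply: (Order.POrderTheory.le_trans (ler_normD _ _)).
by rewrite addrC lerD2l ltW.
Qed.

Lemma cauchy_add f g : cauchy f -> cauchy g -> cauchy (fun i => f i + g i).
Proof.
move=> Hf Hg e e0; have e2 : 0 < e / 2 by lra.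
have [i Hi] := Hf _ e2; have [j Hj] := Hg _ e2; have [k ik jk] := le_directed i j.
exists k => m n km kn.
have := Hi _ _ (le_trans ik km) (le_trans ik kn).
have := Hj _ _ (le_trans jk km) (le_trans jk kn).
rewrite !ltr_norml => /andP[? ?] /andP[? ?]; apply/andP; lra.
Qed.

Lemma cauchy_opp f : cauchy f -> cauchy (fun i => - f i).
Proof.
move=> Hf e /Hf [i Hi]; exists i => m n im in_.
by rewrite -opprD normrN; apply: Hi.
Qed.

Lemma cauchy_mul f g : cauchy f -> cauchy g -> cauchy (fun i => f i * g i).
Proof.
move=> Hf Hg e e0.
have [B B0 [i Hi]] := cauchy_bounded Hf; have [C C0 [j Hj]] := cauchy_bounded Hg.
have d0 : 0 < e / (B + C) by rewrite divr_gt0 // addr_gt0.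
have [i' Hi'] := Hf _ d0; have [j' Hj'] := Hg _ d0.
have [k1 ? ?] := le_directed i j; have [k2 ? ?] := le_directed i' j'.
have [k ? ?] := le_directed k1 k2.
exists k => m n km kn.
have -> : f m * g m - f n * g n = f m * (g m - g n) + (f m - f n) * g n by ring.
apply: (le_lt_trans (ler_normD _ _)); rewrite !normrM.
have Bm : `|f m| <= B by apply: Hi; eauto.
have Cn : `|g n| <= C by apply: Hj; eauto.
have gd : `|g m - g n| < e / (B + C) by apply: Hj'; eauto.
have fd : `|f m - f n| < e / (B + C) by apply: Hi'; eauto.
have BC : e = B * (e / (B + C)) + (e / (B + C)) * C.
  by rewrite (mulrC _ C) -mulrDl mulrCA divff ?mulr1 ?lt0r_neq0 // addr_gt0.
rewrite [ltRHS]BC.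
have h1 : `|f m| * `|g m - g n| <= B * `|g m - g n| by rewrite ler_wpM2r.
have h2 : B * `|g m - g n| < B * (e / (B + C)) by rewrite ltr_pM2l.
have h3 : `|f m - f n| * `|g n| <= e / (B + C) * C by rewrite ler_pM // ltW.
lra.
Qed.

Lemma cauchy_cst c : cauchy (fun=> c).
Proof. by move=> e e0; exists i0 => *; rewrite subrr normr0. Qed.

Definition c_eq (f g : cseq) := forall e, 0 < e -> ev (fun i => `|f i - g i| < e).
Definition c_pos (f : cseq) := exists2 e, 0 < e & ev (fun i => e < f i).
Definition c_add (f g : cseq) := Cseq (cauchy_add (cvalP f) (cvalP g)).
Definition c_mul (f g : cseq) := Cseq (cauchy_mul (cvalP f) (cvalP g)).
Definition c_opp (f : cseq) := Cseq (cauchy_opp (cvalP f)).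
Definition c_cst c := Cseq (cauchy_cst c).

Lemma c_eqT (f g : cseq) : (forall i, f i = g i) -> c_eq f g.
Proof. by move=> E e e0; apply: evT => i; rewrite E subrr normr0. Qed.

Lemma c_pos_or (f : cseq) : ~ c_eq f (c_cst 0) -> c_pos f \/ c_pos (c_opp f).
Proof.
move=> /existsNP [e /not_implyP [e0 H]].
have e2 : 0 < e / 2 by lra.
have e4 : 0 < e / 4 by lra.
have [i Hi] := cvalP f e4.
have [j ij fj] : exists2 j, le i j & ~ (`|f j| < e).
  apply: contrapT => N; apply: H; exists i => j ij; rewrite subr0.
  by apply: contrapT => fj; apply: N; exists j.
move/negP: fj; rewrite -leNgt ler_normr => /orP[fj|fj]; [left|right]; exists (e / 2) => //;
  exists i => k ik; have := Hi _ _ ij ik; rewrite ltr_norml => /andP[? ?] /=; lra.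
Qed.

Lemma c_inv f : c_pos f -> exists g, c_eq (c_mul g f) (c_cst 1).
Proof.
move=> [d d0 Hd].
have Hc : cauchy (fun i => (f i)^-1).
  move=> e e0; have ed : 0 < e * d * d by rewrite !mulr_gt0.
  have [i Hi] := cvalP f ed; have [j Hj] := Hd.
  have [k ik jk] := le_directed i j; exists k => m n km kn.
  have dm : d < f m by apply: Hj; apply: le_trans km.
  have dn : d < f n by apply: Hj; apply: le_trans kn.
  have m0 : 0 < f m by apply: lt_trans dm.
  have n0 : 0 < f n by apply: lt_trans dn.
  have -> : (f m)^-1 - (f n)^-1 = (f n - f m) / (f m * f n).
    by field; rewrite ?lt0r_neq0.
  have mn0 : 0 < f m * f n by rewrite mulr_gt0.
  rewrite normrM normfV (gtr0_norm mn0) ltr_pdivrMr //.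
  apply: (lt_trans (Hi _ _ (le_trans ik kn) (le_trans ik km))).
  by rewrite -mulrA ltr_pM2l // ltr_pM // ltW.
exists (Cseq Hc) => e e0; move: Hd; apply: evS => i di /=.
by rewrite mulVf ?subrr ?normr0 // lt0r_neq0 // (lt_trans d0).
Qed.

Lemma c_trans f g h : c_eq f g -> c_eq g h -> c_eq f h.
Proof.
move=> fg gh e e0; have e2 : 0 < e / 2 by lra.
move: (evI (fg _ e2) (gh _ e2)); apply: evS => i [].
rewrite !ltr_norml => /andP[? ?] /andP[? ?]; apply/andP; lra.
Qed.

Lemma c_mul_eq f g h : c_eq f g -> c_eq (c_mul f h) (c_mul g h).
Proof.
move=> fg e e0; have [B B0 HB] := cauchy_bounded (cvalP h).
have eB : 0 < e / B by rewrite divr_gt0.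
move: (evI (fg _ eB) HB); apply: evS => i [] /= H hB.
rewrite -mulrBl normrM.
have h1 : `|f i - g i| * `|h i| <= `|f i - g i| * B by rewrite ler_wpM2l.
have h2 : `|f i - g i| * B < e by rewrite -ltr_pdivlMr.
lra.
Qed.

Definition completion : prefield.
Proof.
refine (@Prefield cseq c_eq c_add c_opp c_mul (c_cst 0) (c_cst 1) c_pos
  _ _ c_trans _ _ c_mul_eq _ _ _ _ _ _ _ _ _ c_inv _ _ _ _ _).
- by move=> x; apply: c_eqT.
- move=> f g fg e e0; move: (fg e e0); apply: evS => i; by rewrite distrC.
- move=> f g h fg e e0; move: (fg e e0); apply: evS => i /=.
  have -> // : f i + h i - (g i + h i) = f i - g i by ring.
- move=> f g fg e e0; move: (fg e e0); apply: evS => i /=.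
  by rewrite -opprD normrN.
- move=> f g fg [e e0 He]; have e2 : 0 < e / 2 by lra.
  exists (e / 2) => //; move: (evI (fg _ e2) He); apply: evS => i [].
  by rewrite ltr_norml => /andP[? ?] ?; lra.
- by move=> f g h; apply: c_eqT => i /=; ring.
- by move=> f g; apply: c_eqT => i /=; ring.
- by move=> f; apply: c_eqT => i /=; ring.
- by move=> f; apply: c_eqT => i /=; ring.
- by move=> f g h; apply: c_eqT => i /=; ring.
- by move=> f g; apply: c_eqT => i /=; ring.
- by move=> f; apply: c_eqT => i /=; ring.
- by move=> f g h; apply: c_eqT => i /=; ring.
- by exists 2^-1; [lra|apply: evT => i /=; lra].
- move=> f [e e0 He] [d d0 Hd]; have [i [/= ? ?]] := ev_ex (evI He Hd); lra.
- move=> f g [e e0 He] [d d0 Hd]; exists (e + d); first lra.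
  by move: (evI He Hd); apply: evS => i [/= ? ?]; lra.
- move=> f g [e e0 He] [d d0 Hd]; exists (e * d); first by rewrite mulr_gt0.
  by move: (evI He Hd); apply: evS => i [/= ? ?]; rewrite ltr_pM // ltW.
- move=> f; case: (EM (c_eq f (c_cst 0))); [by left|by move=> /c_pos_or; right].
Defined.

Definition completed := field_of completion.
Definition clim (f : cseq) : completed := fcl (P := completion) f.
Definition cemb (k : K) : completed := clim (c_cst k).

Lemma clim_eq f g : clim f = clim g <-> c_eq f g.
Proof. exact: (@fcl_eq completion). Qed.

Lemma clim_lt f g : (clim f < clim g) <-> exists2 e, 0 < e & ev (fun i => f i + e < g i).
Proof.
rewrite -subr_gt0 -(@fclN completion) -(@fclD completion) (@fcl_gt0 completion) /= /c_pos /=.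
by split=> -[e e0 H]; exists e => //; move: H; apply: evS => i /=; rewrite ltrBrDl.
Qed.

Lemma cembD x y : cemb (x + y) = cemb x + cemb y.
Proof. by rewrite -(@fclD completion); apply/clim_eq; apply: c_eqT. Qed.
Lemma cembM x y : cemb (x * y) = cemb x * cemb y.
Proof. by rewrite -(@fclM completion); apply/clim_eq; apply: c_eqT. Qed.
Lemma cemb0 : cemb 0 = 0. Proof. by []. Qed.
Lemma cemb1 : cemb 1 = 1. Proof. by []. Qed.

Lemma cemb_lt x y : (cemb x < cemb y) = (x < y).
Proof.
apply/idP/idP => [/clim_lt [e e0 /ev_ex [i /=]]|xy]; first by lra.
apply/clim_lt; exists ((y - x) / 2); first lra.
by apply: evT => i /=; lra.
Qed.

Lemma clim_le_near (f g : cseq) (e : K) : ev (fun i => f i <= g i + e) -> clim f <= clim g + cemb e.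
Proof.
move=> H; rewrite leNgt; apply/negP.
rewrite -(@fclD completion) => /clim_lt [d d0 /= Hd].
by have [i [/= ? ?]] := ev_ex (evI H Hd); lra.
Qed.

Lemma completed_dense (x : completed) : 0 < x -> exists2 k, 0 < k & cemb k < x.
Proof.
elim/field_of_ind: x => f; rewrite (@fcl_gt0 completion) => -[e e0 H].
exists (e / 2); first lra.
apply/clim_lt; exists (e / 4); first lra.
by move: H; apply: evS => i /=; lra.
Qed.

Lemma completed_bounded (x : completed) : exists k, x < cemb k.
Proof.
elim/field_of_ind: x => f; have [B B0 H] := cauchy_bounded (cvalP f).
exists (B + 2); apply/clim_lt; exists 1 => //; move: H; apply: evS => i /=.
by rewrite ler_norml => /andP[? ?]; lra.
Qed.

End Completion.

Record complete_field (K : realFieldType) (I : Type) (le : I -> I -> Prop) := CompleteField {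
  cfield :> realFieldType;
  cinj : K -> cfield;
  cinjD : forall x y, cinj (x + y) = cinj x + cinj y;
  cinjM : forall x y, cinj (x * y) = cinj x * cinj y;
  cinj0 : cinj 0 = 0;
  cinj1 : cinj 1 = 1;
  cinj_lt : forall x y, (cinj x < cinj y) = (x < y);
  cinj_lim : forall f : I -> K, cauchy le f ->
    exists r, forall k i, (forall j, le i j -> `|f j - f i| <= k) -> `|r - cinj (f i)| <= cinj k;
  cinj_dense : forall x : cfield, 0 < x -> exists2 k, 0 < k & cinj k < x;
  cinj_bounded : forall x : cfield, exists k, x < cinj k }.

Lemma complete_field_of (K : realFieldType) (I : Type) (le : I -> I -> Prop) (i0 : I) :
  (forall i, le i i) -> (forall i j k, le i j -> le j k -> le i k) ->
  (forall i j, exists2 k, le i k & le j k) -> complete_field K le.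
Proof.
move=> Hr Ht Hd.
refine (@CompleteField K I le (@completed K I le i0 Hr Ht Hd) (@cemb _ _ _ i0 Hr Ht Hd)
  (@cembD _ _ _ i0 Hr Ht Hd) (@cembM _ _ _ i0 Hr Ht Hd) (@cemb0 _ _ _ i0 Hr Ht Hd)
  (@cemb1 _ _ _ i0 Hr Ht Hd)
  (@cemb_lt _ _ _ i0 Hr Ht Hd) _ (@completed_dense _ _ _ i0 Hr Ht Hd)
  (@completed_bounded _ _ _ i0 Hr Ht Hd)).
move=> f Hf; exists (@clim K I le i0 Hr Ht Hd (Cseq Hf)) => k i H.
rewrite ler_norml; apply/andP; split.
  rewrite lerBrDr addrC lerBlDr; apply: clim_le_near; exists i => j /H /=.
  by rewrite ler_norml => /andP[? ?]; lra.
rewrite lerBlDr addrC; apply: clim_le_near; exists i => j /H /=.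
by rewrite ler_norml => /andP[? ?]; lra.
Qed.

(** * The numbers of a model *)

Arguments eval : simpl never.

Lemma evalE (M : structure) G (e : env M G) :
  (forall a (v : var G a), eval (Var v) e = e a v) *
  (forall a (c : cst a), eval (Cst c) e = con M c) *
  (forall a b (s : tm G (Arr a b)) t, eval (App s t) e = ap (eval s e) (eval t e)).
Proof. by []. Qed.

Section Connectives.
Variables (M : model) (G : ctx) (e : env M G).

Lemma sat_eq s t : sat (FEq s t) e = (eval s e = eval t e).
Proof. by rewrite satE; apply: propext; apply: eq0E. Qed.

Lemma sat_neg A : sat (Neg A) e = ~ sat A e.
Proof. by []. Qed.

Lemma sat_and A B : sat (And A B) e = (sat A e /\ sat B e).
Proof.
rewrite /And sat_neg satE sat_neg; apply: propext; split; last by move=> [a b] /(_ a).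
by move=> H; split; apply: contrapT => N; apply: H => // a.
Qed.

Lemma sat_or A B : sat (Or A B) e = (sat A e \/ sat B e).
Proof.
rewrite /Or satE sat_neg; apply: propext; split; last by case=> // a /(_ a).
by move=> H; case: (EM (sat A e)) => a; [left|right; apply: H].
Qed.

Lemma sat_iff A B : sat (Iff A B) e = (sat A e <-> sat B e).
Proof. by rewrite /Iff sat_and !satE. Qed.

Lemma sat_all a A : sat (all_ a A) e = forall x : M a, sat (A (Var vz)) (econs x e).
Proof. by rewrite /all_ satE. Qed.

Lemma sat_Ex a (A : fm (a :: G)) : sat (Ex a A) e = exists x : M a, sat A (econs x e).
Proof.
rewrite /Ex sat_neg satE; apply: propext; split; last by move=> [x Hx] H; apply: (H x Hx).
by move=> /existsNP [x /contrapT Hx]; exists x.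
Qed.

Lemma sat_ex a A : sat (ex_ a A) e = exists x : M a, sat (A (Var vz)) (econs x e).
Proof. exact: sat_Ex. Qed.

End Connectives.

Definition logicE := (sat_eq, sat_and, sat_or, sat_iff, sat_neg, sat_all, sat_ex, satE).

Section Model.
Variable M : model.
Local Notation N := (M ty0).
Local Notation "f $ x" := (@ap M _ _ f x) (at level 11, left associativity).

Lemma all_elim G (e : env M G) a A : sat (all_ a A) e -> forall x, sat (A (Var vz)) (econs x e).
Proof. by []. Qed.

Lemma eq_at_eq a (x y : M a) : eq_at x y <-> x = y.
Proof.
elim: a x y => [x y|b _ c IH f g]; first exact: eq0E.
split=> [/= H|-> /=]; last by move=> x; apply/IH.
by apply: extensional => x; apply/IH.
Qed.

Lemma ap_Pi a b (x : M a) (y : M b) : con M (Pi a b) $ x $ y = x.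
Proof.
have H := @model_ax M nil _ (enil M) (ax_Pi nil a b).
by have := all_elim (all_elim H x) y; rewrite sat_EqT => /eq_at_eq.
Qed.

Lemma ap_Sigma a b c (x : M (Arr a (Arr b c))) (y : M (Arr a b)) z :
  con M (Sigma a b c) $ x $ y $ z = x $ z $ (y $ z).
Proof.
have H := @model_ax M nil _ (enil M) (ax_Sigma nil a b c).
by have := all_elim (all_elim (all_elim H x) y) z; rewrite sat_EqT => /eq_at_eq.
Qed.

Lemma ap_lam G a b (t : tm (a :: G) b) (e : env M G) x :
  eval (lam t) e $ x = eval t (econs x e).
Proof.
elim: t => [c v|c k|c d s IHs t IHt]; rewrite /= ?evalE.
- move: c v; apply: var_case => [|c v] /=; last by rewrite ap_Pi.
  by rewrite ap_Sigma !ap_Pi.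
- by rewrite ap_Pi.
- by rewrite ap_Sigma IHs IHt.
Qed.

Definition add (x y : N) : N := con M Plus $ x $ y.
Definition mul (x y : N) : N := con M Times $ x $ y.
Definition zero : N := con M Zero.
Definition one : N := con M One.
Definition lt (x y : N) : Prop := lt0 x y.

Lemma sat_semiring A : semiring_axiom nil A -> sat A (enil M).
Proof. by move=> HA; apply: model_ax; apply: ax_semiring. Qed.

Lemma addA x y z : add (add x y) z = add x (add y z).
Proof.
by have := all_elim (all_elim (all_elim (sat_semiring (sr_add_assoc nil)) x) y) z; rewrite sat_eq.
Qed.
Lemma addC x y : add x y = add y x.
Proof. by have := all_elim (all_elim (sat_semiring (sr_add_comm nil)) x) y; rewrite sat_eq. Qed.
Lemma add0 x : add x zero = x.
Proof. by have := all_elim (sat_semiring (sr_add_0 nil)) x; rewrite sat_eq. Qed.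
Lemma mulA x y z : mul (mul x y) z = mul x (mul y z).
Proof.
by have := all_elim (all_elim (all_elim (sat_semiring (sr_mul_assoc nil)) x) y) z; rewrite sat_eq.
Qed.
Lemma mulC x y : mul x y = mul y x.
Proof. by have := all_elim (all_elim (sat_semiring (sr_mul_comm nil)) x) y; rewrite sat_eq. Qed.
Lemma mul1 x : mul x one = x.
Proof. by have := all_elim (sat_semiring (sr_mul_1 nil)) x; rewrite sat_eq. Qed.
Lemma mul0 x : mul x zero = zero.
Proof. by have := all_elim (sat_semiring (sr_mul_0 nil)) x; rewrite sat_eq. Qed.
Lemma mulD x y z : mul x (add y z) = add (mul x y) (mul x z).
Proof.
by have := all_elim (all_elim (all_elim (sat_semiring (sr_distr nil)) x) y) z; rewrite sat_eq.
Qed.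
Lemma nlt_irr x : ~ lt x x.
Proof. exact (all_elim (sat_semiring (sr_lt_irrefl nil)) x). Qed.
Lemma nlt_trans x y z : lt x y -> lt y z -> lt x z.
Proof. exact (all_elim (all_elim (all_elim (sat_semiring (sr_lt_trans nil)) x) y) z). Qed.
Lemma nlt_total x y : [\/ lt x y, x = y | lt y x].
Proof.
have := all_elim (all_elim (sat_semiring (sr_lt_total nil)) x) y; rewrite !logicE !evalE.
by case=> [[H|H]|H]; [left|right; left|right; right] || case=> [|[]]; constructor.
Qed.
Lemma nlt_add x y z : lt x y -> lt (add x z) (add y z).
Proof. exact (all_elim (all_elim (all_elim (sat_semiring (sr_lt_add nil)) x) y) z). Qed.
Lemma nlt_mul x y z : lt zero z -> lt x y -> lt (mul x z) (mul y z).
Proof. exact (all_elim (all_elim (all_elim (sat_semiring (sr_lt_mul nil)) x) y) z). Qed.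
Lemma lt01 : lt zero one.
Proof. exact (sat_semiring (sr_lt_0_1 nil)). Qed.
Lemma ge0 x : lt zero x \/ zero = x.
Proof. by have := all_elim (sat_semiring (sr_le_0 nil)) x; rewrite !logicE. Qed.
Lemma ge1 x : lt zero x -> lt one x \/ one = x.
Proof. by have := all_elim (sat_semiring (sr_discrete nil)) x; rewrite !logicE. Qed.

Lemma qf_ind G (A : fm (ty0 :: G)) (e : env M G) : qf A ->
  sat A (econs zero e) ->
  (forall n, sat A (econs n e) -> sat A (econs (add n one) e)) ->
  forall n, sat A (econs n e).
Proof.
move=> /ax_QF_ind /(@model_ax M _ _ e); rewrite !satE /inst sat_subst => H H0 HS.
have cE x : (fun (b : ty) (v : var (ty0 :: G) b) => eval (scons x (fun a v => Var v) b v) e) =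
   econs (eval x e : M ty0) e by apply: env_ext; apply: var_case.
apply: H; first by rewrite cE.
move=> n; rewrite satE sat_subst => /HS; congr sat.
by apply: env_ext; apply: var_case.
Qed.

Lemma rec0 F m : con M Rec $ F $ m $ zero = m.
Proof.
have H := @model_ax M nil _ (enil M) (ax_Rec_0 nil).
by have := all_elim (all_elim H F) m; rewrite sat_eq.
Qed.

Lemma recS F m n : con M Rec $ F $ m $ (add n one) = F $ n $ (con M Rec $ F $ m $ n).
Proof.
have H := @model_ax M nil _ (enil M) (ax_Rec_S nil).
by have := all_elim (all_elim (all_elim H F) m) n; rewrite sat_eq.
Qed.

Lemma lam2_eq G (e : env M G) a b c (t : tm (b :: a :: G) c) F :
  (forall x y, eval t (econs y (econs x e)) = F $ x $ y) -> eval (lam (lam t)) e = F.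
Proof.
by move=> H; do 2 (apply: extensional => ?); rewrite !ap_lam.
Qed.

(** Sealed, as comparing numbers of [M] by unfolding these terms is too slow. *)
Lemma step_sealed (t : tm [:: ty0; ty0] ty0) :
  {F : M (Arr ty0 (Arr ty0 ty0)) |
    forall x y, F $ x $ y = eval t (econs y (econs x (enil M)))}.
Proof. by exists (eval (lam (lam t)) (enil M)) => x y; rewrite !ap_lam. Qed.

Definition step t := sval (step_sealed t).

Lemma stepE t x y : step t $ x $ y = eval t (econs y (econs x (enil M))).
Proof. exact: (svalP (step_sealed t)). Qed.

Definition pred (x : N) : N := con M Rec $ step (Var (vs vz)) $ zero $ x.
Definition sub (x y : N) : N := con M Rec $ step (npred (Var vz)) $ x $ y.
Definition eqn (x y : N) : N := sub one (add (sub x y) (sub y x)).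
Definition par (x : N) : N := con M Rec $ step (monus (Cst One) (Var vz)) $ zero $ x.
Definition hlf (x : N) : N :=
  con M Rec $ step (App (App (Cst Plus) (Var vz)) (parity (Var (vs vz)))) $ zero $ x.
Definition pw (x : N) : N := con M Rec $ step (App (App (Cst Plus) (Var vz)) (Var vz)) $ one $ x.
Definition tri (x : N) : N := con M Rec $
  step (App (App (Cst Plus) (Var vz)) (App (App (Cst Plus) (Var (vs vz))) (Cst One))) $ zero $ x.
Definition diag (x : N) : N := con M Rec $ step (App (App (Cst Plus) (Var vz))
  (Defs.eqb (App (App (Cst Plus) (Var (vs vz))) (Cst One))
     (triangle (App (App (Cst Plus) (Var vz)) (Cst One))))) $ zero $ x.
Definition pair (x y : N) : N := add (tri (add x y)) x.
Lemma fst_sealed : {f : N -> N | f = fun x => sub x (tri (diag x))}. Proof. by eexists. Qed.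
Definition fst_ := sval fst_sealed.
Lemma fst_E x : fst_ x = sub x (tri (diag x)).
Proof. by rewrite /fst_ (svalP fst_sealed). Qed.
Lemma snd_sealed : {f : N -> N | f = fun x => sub (diag x) (fst_ x)}. Proof. by eexists. Qed.
Definition snd_ := sval snd_sealed.
Lemma snd_E x : snd_ x = sub (diag x) (fst_ x).
Proof. by rewrite /snd_ (svalP snd_sealed). Qed.

Section Eval.
Variables (G : ctx) (e : env M G).
Implicit Types s t : tm G ty0.

Lemma eval_rec (t : tm (ty0 :: ty0 :: G) ty0) (t0 : tm [:: ty0; ty0] ty0) s u :
  (forall x y, eval t (econs y (econs x e)) = eval t0 (econs y (econs x (enil M)))) ->
  eval (App (App (App (Cst Rec) (lam (lam t))) s) u) e =
  con M Rec $ step t0 $ eval s e $ eval u e.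
Proof. by move=> H; rewrite !evalE (lam2_eq (F := step t0)) // => x y; rewrite stepE. Qed.

Lemma eval_npred t : eval (npred t) e = pred (eval t e).
Proof. exact: eval_rec. Qed.
End Eval.

Lemma eval_monus G (e : env M G) s t : eval (monus s t) e = sub (eval s e) (eval t e).
Proof. exact: eval_rec. Qed.

Lemma eval_eqb G (e : env M G) s t : eval (Defs.eqb s t) e = eqn (eval s e) (eval t e).
Proof. by rewrite /Defs.eqb !(eval_monus, evalE). Qed.

Lemma eval_parity G (e : env M G) t : eval (parity t) e = par (eval t e).
Proof. exact: eval_rec. Qed.

Lemma eval_half G (e : env M G) t : eval (Defs.half t) e = hlf (eval t e).
Proof. exact: eval_rec. Qed.

Lemma eval_pow2 G (e : env M G) t : eval (pow2 t) e = pw (eval t e).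
Proof. exact: eval_rec. Qed.

Lemma eval_triangle G (e : env M G) t : eval (triangle t) e = tri (eval t e).
Proof. exact: eval_rec. Qed.

Lemma eval_diagonal G (e : env M G) t : eval (diagonal t) e = diag (eval t e).
Proof. exact: eval_rec. Qed.

Lemma eval_npair G (e : env M G) s t : eval (npair s t) e = pair (eval s e) (eval t e).
Proof. by rewrite /npair !(eval_triangle, evalE). Qed.

Lemma eval_nfst G (e : env M G) t : eval (nfst t) e = fst_ (eval t e).
Proof. by rewrite fst_E /nfst eval_monus eval_triangle eval_diagonal. Qed.

Lemma eval_nsnd G (e : env M G) t : eval (nsnd t) e = snd_ (eval t e).
Proof. by rewrite snd_E /nsnd eval_monus eval_nfst eval_diagonal. Qed.

Lemma pred0 : pred zero = zero. Proof. exact: rec0. Qed.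
Lemma predS n : pred (add n one) = n. Proof. by rewrite /pred recS stepE. Qed.
Lemma sub0 n : sub n zero = n. Proof. exact: rec0. Qed.
Lemma subS n m : sub n (add m one) = pred (sub n m).
Proof. by rewrite /sub recS stepE eval_npred. Qed.

Lemma N_cases n : n = zero \/ n = add (pred n) one.
Proof.
pose A := Or (FEq (Var vz) (Cst Zero)) (FEq (Var vz)
  (App (App (Cst Plus) (npred (Var vz))) (Cst One))) : fm [:: ty0].
have E x : sat A (econs x (enil M)) = (x = zero \/ x = add (pred x) one).
  by rewrite /A !logicE !(eval_npred, evalE).
rewrite -E; apply: (@qf_ind nil A) => //; first by rewrite E; left.
by move=> x; rewrite !E predS => _; right.
Qed.

Lemma lt_succ n : lt n (add n one).
Proof. by rewrite -{1}(add0 n) !(addC n); apply: nlt_add; apply: lt01. Qed.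

Definition le x y := lt x y \/ x = y.

Lemma le_succ n m : le (add n one) m -> lt n m.
Proof. by case=> [|<-]; [apply: nlt_trans|]; apply: lt_succ. Qed.

Lemma sub_add_le n m : le m n -> add (sub n m) m = n.
Proof.
pose A := FImp (Or (FLt (Var vz) (Var (vs vz))) (FEq (Var vz) (Var (vs vz))))
  (FEq (App (App (Cst Plus) (monus (Var (vs vz)) (Var vz))) (Var vz)) (Var (vs vz))) :
  fm [:: ty0; ty0].
have E x : sat A (econs x (econs n (enil M))) = (le x n -> add (sub n x) x = n).
  by rewrite /A !logicE !(eval_monus, evalE).
rewrite -E; apply: (@qf_ind _ A) => //; first by rewrite E sub0 add0.
move=> x; rewrite !E subS => IH /le_succ xn.
have {IH} := IH (or_introl xn).
case: (N_cases (sub n x)) => [->|{1}->].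
  by rewrite addC add0 => H; case: (@nlt_irr x); rewrite {2}H.
by rewrite addA (addC one).
Qed.

Lemma dsub_N x y : lt x y -> exists z, add x z = y.
Proof. by move=> xy; exists (sub y x); rewrite addC; apply: sub_add_le; left. Qed.

Definition dN : discrete_semiring :=
  DiscreteSemiring addA addC add0 mulA mulC mul1 mul0 mulD nlt_irr nlt_trans nlt_total
    nlt_add nlt_mul lt01 ge0 ge1 dsub_N.

End Model.

Section Arithmetic.
Variable M : model.
Local Notation N := (M ty0).
Local Notation "f $ x" := (@ap M _ _ f x) (at level 11, left associativity).
Local Notation zero := (zero M).
Local Notation one := (one M).

Definition Q : fraction_field (dN M) := fraction_field_of (dN M).
Local Notation K := (ffield Q).

Definition iN (n : N) : K := finj Q (n : dN M).

Lemma iN0 : iN zero = 0. Proof. exact: finj0. Qed.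
Lemma iN1 : iN one = 1. Proof. exact: finj1. Qed.
Lemma iND m n : iN (add m n) = iN m + iN n. Proof. exact: (@finjD (dN M)). Qed.
Lemma iNM m n : iN (mul m n) = iN m * iN n. Proof. exact: (@finjM (dN M)). Qed.
Lemma iN_inj m n : iN m = iN n -> m = n. Proof. exact: (@finj_inj (dN M)). Qed.
Lemma iN_ge0 n : 0 <= iN n. Proof. exact: (@finj_ge0 (dN M)). Qed.
Lemma iN_lt m n : lt m n <-> iN m < iN n.
Proof. by split=> /(@finj_lt (dN M)). Qed.
Lemma iN_le m n : le m n <-> iN m <= iN n.
Proof. by split=> /(@finj_le (dN M)). Qed.
Lemma iN_discrete m n : iN m < iN n -> iN m + 1 <= iN n.
Proof. exact: (@finj_discrete (dN M)). Qed.

Definition iNE := (iN0, iN1, iND, iNM).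

Lemma le_or_lt (m n : N) : le m n \/ lt n m.
Proof. by case: (leP (iN m) (iN n)) => [/iN_le|/iN_lt]; [left|right]. Qed.

Lemma sub_ge m n : le n m -> iN (sub m n) = iN m - iN n.
Proof. by move=> /sub_add_le/(congr1 iN); rewrite iND; lra. Qed.

Lemma sub_le m n : le m n -> sub m n = zero.
Proof.
pose A := FImp (Or (FLt (Var (vs vz)) (Var vz)) (FEq (Var (vs vz)) (Var vz)))
  (FEq (monus (Var (vs vz)) (Var vz)) (Cst Zero)) : fm [:: ty0; ty0].
have E x : sat A (econs x (econs m (enil M))) = (le m x -> sub m x = zero).
  by rewrite /A !logicE !(eval_monus, evalE).
rewrite -E; apply: (@qf_ind _ _ A) => //.
  by rewrite E sub0 => /iN_le; rewrite iN0 => H; apply: iN_inj; rewrite iN0; have := iN_ge0 m; lra.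
move=> x; rewrite !E => IH /iN_le; rewrite iND iN1 => mx1.
rewrite subS; case: (le_or_lt m x) => [/IH ->|/iN_lt xm]; first exact: pred0.
have {}mx1 : m = add x one.
  by apply: iN_inj; rewrite iND iN1; have := iN_discrete xm; lra.
suff -> : sub m x = one by rewrite -[one]add0 addC predS.
apply: iN_inj; rewrite sub_ge; first by rewrite mx1 !iNE; lra.
by apply/iN_le; rewrite mx1 !iNE; lra.
Qed.

Definition dfn a b (f : M a -> M b) := exists F, forall x, F $ x = f x.

Lemma dfn_cst a b (c : M b) : dfn (fun _ : M a => c).
Proof. by exists (con M (Pi b a) $ c) => x; rewrite ap_Pi. Qed.

Lemma dfn_id a : dfn (fun x : M a => x).
Proof. by exists (con M (Sigma a (Arr a a) a) $ con M (Pi a (Arr a a)) $ con M (Pi a a)) => x;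
  rewrite ap_Sigma !ap_Pi. Qed.

Lemma dfn_ap a b c (f : M a -> M (Arr b c)) g :
  dfn f -> dfn g -> dfn (fun x => f x $ g x).
Proof.
by move=> [F HF] [H HH]; exists (con M (Sigma a b c) $ F $ H) => x; rewrite ap_Sigma HF HH.
Qed.

Definition dec (P : N -> Prop) := exists2 f, dfn f & forall n, P n <-> f n = zero.

Lemma neq0_ge1 n : n <> zero -> le one n.
Proof.
move=> H; case: (ge0 n) => [/ge1 [n1|<-]|/esym //]; by [left|right].
Qed.

Lemma not_eq0 n : sub one n = zero <-> n <> zero.
Proof.
split=> [H n0|/neq0_ge1/sub_le //].
by move: H; rewrite n0 sub0 => /(congr1 iN); rewrite iN1 iN0; lra.
Qed.

Lemma add_eq0 m n : add m n = zero <-> m = zero /\ n = zero.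
Proof.
split=> [/(congr1 iN)|[-> ->]]; last by rewrite add0.
rewrite iND iN0 => H; have := iN_ge0 m; have := iN_ge0 n.
by split; apply: iN_inj; rewrite iN0; lra.
Qed.

Lemma mul_eq0 m n : mul m n = zero <-> m = zero \/ n = zero.
Proof.
split; last by case=> ->; rewrite ?mul0 // mulC mul0.
move=> /(congr1 iN); rewrite iNM iN0 => /eqP; rewrite mulf_eq0 => /orP[]/eqP H; [left|right];
  by apply: iN_inj; rewrite iN0.
Qed.

Lemma sub_eq0 m n : sub m n = zero <-> le m n.
Proof.
split=> [H|/sub_le //]; case: (le_or_lt m n) => // nm.
have := sub_ge (or_introl nm); rewrite H iN0; move/iN_lt: nm; lra.
Qed.

Lemma dfn_op (op : M (Arr ty0 (Arr ty0 ty0))) a (f g : M a -> N) :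
  dfn f -> dfn g -> dfn (fun x => op $ f x $ g x).
Proof. by move=> Hf Hg; do 2 apply: dfn_ap => //; apply: dfn_cst. Qed.

Lemma dfn_add a (f g : M a -> N) : dfn f -> dfn g -> dfn (fun x => add (f x) (g x)).
Proof. exact: dfn_op. Qed.
Lemma dfn_mul a (f g : M a -> N) : dfn f -> dfn g -> dfn (fun x => mul (f x) (g x)).
Proof. exact: dfn_op. Qed.
Lemma dfn_sub a (f g : M a -> N) : dfn f -> dfn g -> dfn (fun x => sub (f x) (g x)).
Proof. move=> Hf Hg; do 2 (apply: dfn_ap => //); exact: dfn_cst. Qed.

Lemma dec_le (f g : N -> N) : dfn f -> dfn g -> dec (fun n => le (f n) (g n)).
Proof.
move=> Hf Hg; exists (fun n => sub (f n) (g n)); first exact: dfn_sub.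
by move=> n; rewrite sub_eq0.
Qed.

Lemma dec_and P Q : dec P -> dec Q -> dec (fun n => P n /\ Q n).
Proof.
move=> [f Hf Pf] [g Hg Qg]; exists (fun n => add (f n) (g n)); first exact: dfn_add.
by move=> n; rewrite add_eq0 Pf Qg.
Qed.

Lemma dec_or P Q : dec P -> dec Q -> dec (fun n => P n \/ Q n).
Proof.
move=> [f Hf Pf] [g Hg Qg]; exists (fun n => mul (f n) (g n)); first exact: dfn_mul.
by move=> n; rewrite mul_eq0 Pf Qg.
Qed.

Lemma dec_not P : dec P -> dec (fun n => ~ P n).
Proof.
move=> [f Hf Pf]; exists (fun n => sub one (f n)).
  by apply: dfn_sub => //; apply: dfn_cst.
by move=> n; rewrite not_eq0 Pf.
Qed.

Lemma dec_iff P Q : (forall n, P n <-> Q n) -> dec P -> dec Q.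
Proof. by move=> H [f Hf Pf]; exists f => // n; rewrite -H. Qed.

Lemma dec_eq (f g : N -> N) : dfn f -> dfn g -> dec (fun n => f n = g n).
Proof.
move=> Hf Hg; apply: dec_iff (dec_and (dec_le Hf Hg) (dec_le Hg Hf)) => n.
split=> [[/iN_le ? /iN_le ?]|->]; last by split; right.
apply: iN_inj; lra.
Qed.

Lemma dec_lt (f g : N -> N) : dfn f -> dfn g -> dec (fun n => lt (f n) (g n)).
Proof.
move=> Hf Hg; apply: dec_iff (dec_not (dec_le Hg Hf)) => n.
split; last by move=> /iN_lt ? /iN_le; lra.
by case: (le_or_lt (g n) (f n)).
Qed.

Lemma dec_ind P : dec P -> P zero -> (forall n, P n -> P (add n one)) -> forall n, P n.
Proof.
move=> [f [F HF] Pf] P0 PS n; apply/Pf; rewrite -HF.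
have E x : sat (FEq (App (Var (vs vz)) (Var vz)) (Cst Zero)) (econs x (econs F (enil M)))
   = (F $ x = zero) by rewrite !logicE !evalE.
rewrite -E; apply: qf_ind => //; first by rewrite E HF -Pf.
by move=> x; rewrite !E !HF -!Pf; apply: PS.
Qed.

Lemma dfn_pw a (f : M a -> N) : dfn f -> dfn (fun x => pw (f x)).
Proof. by move=> Hf; apply: dfn_ap => //; apply: dfn_cst. Qed.
Lemma dfn_par a (f : M a -> N) : dfn f -> dfn (fun x => par (f x)).
Proof. by move=> Hf; apply: dfn_ap => //; apply: dfn_cst. Qed.
Lemma dfn_hlf a (f : M a -> N) : dfn f -> dfn (fun x => hlf (f x)).
Proof. by move=> Hf; apply: dfn_ap => //; apply: dfn_cst. Qed.
Lemma dfn_tri a (f : M a -> N) : dfn f -> dfn (fun x => tri (f x)).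
Proof. by move=> Hf; apply: dfn_ap => //; apply: dfn_cst. Qed.
Lemma dfn_diag a (f : M a -> N) : dfn f -> dfn (fun x => diag (f x)).
Proof. by move=> Hf; apply: dfn_ap => //; apply: dfn_cst. Qed.

End Arithmetic.

Ltac dfn := cbv beta; first
  [ exact: dfn_cst | exact: dfn_id
  | apply: dfn_add; dfn | apply: dfn_mul; dfn | apply: dfn_sub; dfn
  | apply: dfn_pw; dfn | apply: dfn_par; dfn | apply: dfn_hlf; dfn | apply: dfn_tri; dfn
  | apply: dfn_diag; dfn | apply: dfn_ap; dfn ].
Ltac dec := cbv beta; first
  [ apply: dec_eq; dfn | apply: dec_lt; dfn | apply: dec_le; dfn
  | apply: dec_and; dec | apply: dec_or; dec ].

Section Coding.
Variable M : model.
Local Notation N := (M ty0).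
Local Notation "f $ x" := (@ap M _ _ f x) (at level 11, left associativity).
Local Notation K := (ffield (Q M)).
Local Notation zero := (zero M).
Local Notation one := (one M).

Lemma pw0 : pw zero = one. Proof. exact: rec0. Qed.
Lemma pwS n : pw (add n one) = add (pw n) (pw n).
Proof. by rewrite /pw recS stepE !evalE. Qed.

Lemma pwD (m n : N) : pw (add m n) = mul (pw m) (pw n).
Proof.
apply: (@dec_ind _ (fun n => pw (add m n) = mul (pw m) (pw n))); first dec.
  by rewrite add0 pw0 mul1.
by move=> k; rewrite -addA !pwS => ->; rewrite mulD.
Qed.

Lemma pw_gt (n : N) : iN n + 1 <= iN (pw n).
Proof.
suff : le (add n one) (pw n) by move=> /iN_le; rewrite iND iN1.
apply: (@dec_ind _ (fun n => le (add n one) (pw n))); first dec.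
  by rewrite addC add0 pw0; right.
move=> k /iN_le H; apply/iN_le; move: H; rewrite pwS !iNE.
have := iN_ge0 k; lra.
Qed.

Lemma parS n : par (add n one) = sub one (par n).
Proof. by rewrite /par recS stepE !(eval_monus, evalE). Qed.
Lemma hlfS n : hlf (add n one) = add (hlf n) (par n).
Proof. by rewrite /hlf recS stepE !(eval_parity, evalE). Qed.

Lemma par_hlf (n : N) : (par n = zero \/ par n = one) /\ add (add (hlf n) (hlf n)) (par n) = n.
Proof.
apply: (@dec_ind _ (fun n => (par n = zero \/ par n = one) /\ add (add (hlf n) (hlf n)) (par n) = n)).
- by dec.
- have -> : par zero = zero by exact: rec0.
  have -> : hlf zero = zero by exact: rec0.
  by rewrite !add0; split=> //; left.
- move=> k [Hp /(congr1 (@iN M))]; rewrite parS hlfS; case: Hp => ->.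
    rewrite sub0 !iNE => H; split; [by right|apply: iN_inj; rewrite !iNE; lra].
  have -> : sub one one = zero by apply: sub_le; right.
  rewrite !iNE => H; split; [by left|apply: iN_inj; rewrite !iNE; lra].
Qed.

Lemma iN_eq_half (a b : N) : iN a + iN a <> iN b + iN b + 1.
Proof.
case: (ltrP (iN b) (iN a)) => [/iN_discrete|]; lra.
Qed.

Lemma par_even (a n : N) : iN n = iN a + iN a -> par n = zero /\ hlf n = a.
Proof.
have [[E|E] /(congr1 (@iN M))] := par_hlf n; rewrite E !iNE => H1 H2.
  by split=> //; apply: iN_inj; lra.
by case: (@iN_eq_half a (hlf n)); lra.
Qed.

Lemma par_odd (a n : N) : iN n = iN a + iN a + 1 -> par n = one /\ hlf n = a.
Proof.
have [[E|E] /(congr1 (@iN M))] := par_hlf n; rewrite E !iNE => H1 H2.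
  by case: (@iN_eq_half (hlf n) a); lra.
by split=> //; apply: iN_inj; lra.
Qed.

Lemma triE (n : N) : iN (tri n) = iN n * (iN n + 1) / 2.
Proof.
suff : add (tri n) (tri n) = mul n (add n one) by move=> /(congr1 (@iN M)); rewrite !iNE; lra.
apply: (@dec_ind _ (fun n => add (tri n) (tri n) = mul n (add n one))); first dec.
  have -> : tri zero = zero by exact: rec0.
  by rewrite add0 mulC mul0.
move=> k /(congr1 (@iN M)) H; apply: iN_inj.
have -> : tri (add k one) = add (tri k) (add k one) by rewrite /tri recS stepE !evalE.
by move: H; rewrite !iNE; lra.
Qed.

Lemma tri_le (m n : N) : iN m <= iN n -> iN (tri m) <= iN (tri n).
Proof. by rewrite !triE; have := iN_ge0 m; nra. Qed.

Lemma tri_uniq (d d' n : N) :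
  iN (tri d) <= iN n -> iN n < iN (tri (add d one)) ->
  iN (tri d') <= iN n -> iN n < iN (tri (add d' one)) -> d = d'.
Proof.
move=> h1 h2 h3 h4; apply: iN_inj; apply/eqP; rewrite eq_le !leNgt.
apply/andP; split; apply/negP => /iN_discrete.
  by rewrite -iN1 -iND => /tri_le; lra.
by rewrite -iN1 -iND => /tri_le; lra.
Qed.

Lemma eqn_eq (m n : N) : m = n -> eqn m n = one.
Proof.
move=> ->; have E : sub n n = zero by apply: sub_le; right.
by rewrite /eqn E add0 sub0.
Qed.

Lemma eqn_neq (m n : N) : m <> n -> eqn m n = zero.
Proof.
move=> mn; rewrite /eqn; apply/not_eq0 => /add_eq0 [/sub_eq0/iN_le ? /sub_eq0/iN_le ?].
by apply: mn; apply: iN_inj; lra.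
Qed.

Lemma diagS n : diag (add n one) =
  add (diag n) (eqn (add n one) (tri (add (diag n) one))).
Proof. by rewrite /diag recS stepE !(eval_eqb, eval_triangle, evalE). Qed.

Lemma diag_spec (n : N) : le (tri (diag n)) n /\ lt n (tri (add (diag n) one)).
Proof.
apply: (@dec_ind _ (fun n => le (tri (diag n)) n /\ lt n (tri (add (diag n) one)))); first dec.
  have -> : diag zero = zero by exact: rec0.
  by split; [apply/iN_le|apply/iN_lt]; rewrite triE !iNE; lra.
move=> k [/iN_le h1 /iN_lt h2].
have h3 := iN_discrete h2.
have k0 := iN_ge0 (diag k).
case: (EM (add k one = tri (add (diag k) one))) => E.
  rewrite diagS (eqn_eq E) E; split; [by right|apply/iN_lt].
  by rewrite !triE !iNE; nra.
rewrite diagS (eqn_neq E) add0; split; [apply/iN_le|apply/iN_lt]; rewrite !(iND k) iN1.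
  by lra.
rewrite lt_neqAle h3 andbT; apply/eqP => E'; apply: E; apply: iN_inj.
by rewrite iND iN1.
Qed.

Lemma diag_pair (s t : N) : diag (pair s t) = add s t.
Proof.
have [/iN_le h1 /iN_lt h2] := diag_spec (pair s t).
apply: (tri_uniq h1 h2); rewrite /pair !triE !iNE triE !iNE; have := iN_ge0 s; have := iN_ge0 t; lra.
Qed.

Lemma fst_pair s t : fst_ (pair s t) = s :> N.
Proof.
apply: iN_inj; rewrite fst_E diag_pair sub_ge /pair ?iND; first lra.
by apply/iN_le; rewrite iND; have := iN_ge0 s; lra.
Qed.

Lemma snd_pair s t : snd_ (pair s t) = t :> N.
Proof.
apply: iN_inj; rewrite snd_E diag_pair fst_pair sub_ge ?iND; first lra.
by apply/iN_le; rewrite iND; have := iN_ge0 t; lra.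
Qed.

Lemma pair_inj (s t s' t' : N) : pair s t = pair s' t' -> s = s' /\ t = t'.
Proof.
by move=> E; have := fst_pair s t; have := snd_pair s t; rewrite E fst_pair snd_pair.
Qed.

Lemma rpos_sealed : {f : N -> N | f = fun q => mul (sub one (par (fst_ q))) (hlf (fst_ q))}.
Proof. by eexists. Qed.
Definition rpos := sval rpos_sealed.
Lemma rposE q : rpos q = mul (sub one (par (fst_ q))) (hlf (fst_ q)).
Proof. by rewrite /rpos (svalP rpos_sealed). Qed.
Lemma rneg_sealed : {f : N -> N | f = fun q => mul (par (fst_ q)) (hlf (add (fst_ q) one))}.
Proof. by eexists. Qed.
Definition rneg := sval rneg_sealed.
Lemma rnegE q : rneg q = mul (par (fst_ q)) (hlf (add (fst_ q) one)).
Proof. by rewrite /rneg (svalP rneg_sealed). Qed.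
Lemma rden_sealed : {f : N -> N | f = fun q => add (snd_ q) one}.
Proof. by eexists. Qed.
Definition rden := sval rden_sealed.
Lemma rdenE q : rden q = add (snd_ q) one.
Proof. by rewrite /rden (svalP rden_sealed). Qed.
Definition twice (x : N) : N := mul (add one one) x.
Definition rmk (a b d : N) : N :=
  pair (add (twice (sub a b)) (pred (twice (sub b a)))) (pred d).

Definition rval (q : N) : K := (iN (rpos q) - iN (rneg q)) / iN (rden q).

Lemma rden_gt0 (q : N) : 0 < iN (rden q).
Proof. by rewrite rdenE iND iN1; have := iN_ge0 (snd_ q); lra. Qed.

Lemma predK (d : N) : 0 < iN d -> iN (pred d) = iN d - 1.
Proof.
case: (N_cases d) => [->|/(congr1 (@iN M))]; first by rewrite iN0 ltxx.
by rewrite iND iN1; lra.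
Qed.

Lemma rval_mk (a b d : N) : 0 < iN d -> rval (rmk a b d) = (iN a - iN b) / iN d.
Proof.
move=> d0; have dE : iN (rden (rmk a b d)) = iN d.
  by rewrite rdenE /rmk snd_pair iND iN1 predK // subrK.
rewrite /rval dE.
suff -> : iN (rpos (rmk a b d)) - iN (rneg (rmk a b d)) = iN a - iN b by [].
rewrite rposE rnegE /rmk fst_pair.
case: (le_or_lt b a) => [ba|ab].
  have -> : sub b a = zero by apply: sub_le.
  have -> : twice zero = zero by rewrite /twice mul0.
  rewrite pred0 add0; have [] := @par_even (sub a b) (twice (sub a b)).
    by rewrite /twice !iNE; lra.
  by move=> -> ->; rewrite sub0 !iNE sub_ge //; lra.
have ab' : le a b by left.
have -> : sub a b = zero by apply: sub_le.
have -> : twice zero = zero by rewrite /twice mul0.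
have E : iN (twice (sub b a)) = iN (sub b a) + iN (sub b a) by rewrite /twice !iNE; lra.
have s1 : 1 <= iN (sub b a).
  by move/iN_lt: ab => /iN_discrete; rewrite sub_ge //; lra.
have pE : iN (pred (twice (sub b a))) = iN (pred (sub b a)) + iN (pred (sub b a)) + 1.
  by rewrite !predK ?E; lra.
rewrite addC add0.
have [-> _] := par_odd pE.
have -> : sub one one = zero by apply: sub_le; right.
have [|_ ->] := @par_even (sub b a) (add (pred (twice (sub b a))) one).
  by rewrite iND iN1 predK E; lra.
by rewrite !iNE sub_ge //; lra.
Qed.

End Coding.

(** * Rationals and reals of a model *)

Section Reals.
Variable M : model.
Local Notation N := (M ty0).
Local Notation "f $ x" := (@ap M _ _ f x) (at level 11, left associativity).
Local Notation K := (ffield (Q M)).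
Local Notation zero := (zero M).
Local Notation one := (one M).

Lemma nle_refl (m : N) : le m m. Proof. by right. Qed.
Lemma nle_trans (m n k : N) : le m n -> le n k -> le m k.
Proof. move=> /iN_le ? /iN_le ?; apply/iN_le; lra. Qed.
Lemma nle_directed (m n : N) : exists2 k, le m k & le n k.
Proof.
exists (add m n); apply/iN_le; rewrite iND; [have := iN_ge0 n|have := iN_ge0 m]; lra.
Qed.

Definition Rc : complete_field K (@le M) :=
  complete_field_of K zero nle_refl nle_trans nle_directed.
Local Notation R := (cfield Rc).

Lemma cinjN (x : K) : cinj Rc (- x) = - cinj Rc x.
Proof. by apply/eqP; rewrite -addr_eq0 -cinjD addNr cinj0. Qed.

Lemma cinj_neq0 (x : K) : x != 0 -> cinj Rc x != 0.
Proof. by rewrite !neq_lt -!cinj0 !cinj_lt. Qed.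

Lemma cinjV (x : K) : x != 0 -> cinj Rc x^-1 = (cinj Rc x)^-1.
Proof.
move=> x0; apply: (mulIf (cinj_neq0 x0)).
by rewrite -cinjM !mulVf ?cinj1 // cinj_neq0.
Qed.

Definition jN (n : N) : R := cinj Rc (iN n).
(** The rational with code [q]. *)
Definition rv (q : N) : R := cinj Rc (rval q).
Definition halfpow (n : N) : R := (jN (pw n))^-1.

Lemma jN0 : jN zero = 0. Proof. by rewrite /jN iN0 cinj0. Qed.
Lemma jN1 : jN one = 1. Proof. by rewrite /jN iN1 cinj1. Qed.
Lemma jND m n : jN (add m n) = jN m + jN n. Proof. by rewrite /jN iND cinjD. Qed.
Lemma jNM m n : jN (mul m n) = jN m * jN n. Proof. by rewrite /jN iNM cinjM. Qed.
Definition jNE := (jN0, jN1, jND, jNM).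

Lemma cinj_le (x y : K) : (cinj Rc x <= cinj Rc y) = (x <= y).
Proof. by rewrite !leNgt cinj_lt. Qed.

Lemma jN_lt m n : lt m n <-> jN m < jN n.
Proof. by rewrite /jN cinj_lt; apply: iN_lt. Qed.
Lemma jN_le m n : le m n <-> jN m <= jN n.
Proof. by rewrite /jN cinj_le; apply: iN_le. Qed.
Lemma jN_inj m n : jN m = jN n -> m = n.
Proof. by move=> E; apply: iN_inj; apply/le_anti; rewrite -!cinj_le -/(jN _) -/(jN _) E lexx. Qed.
Lemma jN_ge0 n : 0 <= jN n.
Proof. by rewrite -cinj0 cinj_le; apply: iN_ge0. Qed.
Lemma jN_discrete m n : jN m < jN n -> jN m + 1 <= jN n.
Proof. by rewrite /jN cinj_lt -cinj1 -cinjD cinj_le; apply: iN_discrete. Qed.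

Lemma rden_gt0R q : 0 < jN (rden q).
Proof. by rewrite -cinj0 cinj_lt; apply: rden_gt0. Qed.

Lemma rvE q : rv q = (jN (rpos q) - jN (rneg q)) / jN (rden q).
Proof.
by rewrite /rv /rval cinjM cinjD cinjN cinjV // lt0r_neq0 // rden_gt0.
Qed.

Lemma rv_mk a b d : 0 < jN d -> rv (rmk a b d) = (jN a - jN b) / jN d.
Proof.
rewrite -cinj0 /jN cinj_lt => d0.
by rewrite /rv rval_mk // cinjM cinjD cinjN cinjV // lt0r_neq0.
Qed.

Lemma jN_pw_gt n : jN n + 1 <= jN (pw n).
Proof. by rewrite -cinj1 -cinjD cinj_le; apply: pw_gt. Qed.

Lemma jN_pw_gt0 n : 0 < jN (pw n).
Proof. have := jN_pw_gt n; have := jN_ge0 n; lra. Qed.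

Lemma halfpow_gt0 n : 0 < halfpow n.
Proof. by rewrite invr_gt0 jN_pw_gt0. Qed.

Lemma halfpow0 : halfpow zero = 1.
Proof. by rewrite /halfpow pw0 jN1 invr1. Qed.

Lemma halfpowS n : halfpow (add n one) = halfpow n / 2.
Proof. by rewrite /halfpow pwS jND -[_ + _]mulr2n -[_ *+ 2]mulr_natr invfM. Qed.

Lemma halfpowD m n : halfpow (add m n) = halfpow m * halfpow n.
Proof. by rewrite /halfpow pwD jNM invfM. Qed.

Lemma halfpow_le1 n : halfpow n <= 1.
Proof. by rewrite invf_le1 ?jN_pw_gt0 //; have := jN_pw_gt n; have := jN_ge0 n; lra. Qed.

Lemma le_exists (m n : N) : le m n -> exists k, n = add m k.
Proof. by move=> /sub_add_le <-; exists (sub n m); rewrite addC. Qed.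

Lemma halfpow_le m n : le m n -> halfpow n <= halfpow m.
Proof.
move=> /le_exists [k ->]; rewrite halfpowD ler_piMr ?halfpow_le1 //; exact/ltW/halfpow_gt0.
Qed.

Lemma halfpow_small (r : R) : 0 < r -> exists n, halfpow n < r.
Proof.
move=> /cinj_dense [k k0 kr]; have [n n0 nk] := ffield_gt0 k0.
exists n; apply: le_lt_trans kr.
have n0' : 0 < jN n by rewrite -jN0; apply/jN_lt.
apply: (@le_trans _ _ (jN n)^-1).
  by rewrite /halfpow lef_pV2 ?posrE ?jN_pw_gt0 //; have := jN_pw_gt n; lra.
rewrite /jN -cinjV ?cinj_le //; rewrite /iN.
by move: n0'; rewrite /jN -cinj0 cinj_lt => /lt0r_neq0.
Qed.

Lemma eq_of_close (r s : R) c : (forall n, `|r - s| <= c * halfpow n) -> r = s.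
Proof.
move=> H; apply/eqP; rewrite -subr_eq0 -normr_le0 leNgt; apply/negP => r0.
have c0 : 0 < c.
  by have := H zero; rewrite halfpow0 mulr1; apply: lt_le_trans.
have [n Hn] := halfpow_small (divr_gt0 r0 c0).
by move: (H n); rewrite leNgt -ltr_pdivlMl // mulrC Hn.
Qed.

Definition radd (q r : N) : N :=
  rmk (add (mul (rpos q) (rden r)) (mul (rpos r) (rden q)))
      (add (mul (rneg q) (rden r)) (mul (rneg r) (rden q))) (mul (rden q) (rden r)).
Definition rsub (q r : N) : N :=
  rmk (add (mul (rpos q) (rden r)) (mul (rneg r) (rden q)))
      (add (mul (rneg q) (rden r)) (mul (rpos r) (rden q))) (mul (rden q) (rden r)).
Definition rabs (q : N) : N := rmk (add (rpos q) (rneg q)) zero (rden q).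

Lemma rv_add q r : rv (radd q r) = rv q + rv r.
Proof.
have d0 : 0 < jN (mul (rden q) (rden r)) by rewrite jNM mulr_gt0 ?rden_gt0R.
rewrite rv_mk // !jNE !rvE.
by rewrite addf_div ?lt0r_neq0 ?rden_gt0R //; congr (_ / _); ring.
Qed.

Lemma rv_sub q r : rv (rsub q r) = rv q - rv r.
Proof.
have d0 : 0 < jN (mul (rden q) (rden r)) by rewrite jNM mulr_gt0 ?rden_gt0R.
rewrite rv_mk // !jNE !rvE.
by rewrite -mulNr addf_div ?lt0r_neq0 ?rden_gt0R //; congr (_ / _); ring.
Qed.

Lemma rpos_rneg q : rpos q = zero \/ rneg q = zero :> N.
Proof.
rewrite rposE rnegE; have [[-> _|-> _]] := par_hlf (fst_ q).
  by right; rewrite mulC mul0.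
by left; rewrite sub_le ?(mulC zero) ?mul0 //; apply: nle_refl.
Qed.

Lemma rv_abs q : rv (rabs q) = `|rv q|.
Proof.
rewrite rv_mk ?rden_gt0R // rvE normrM normfV (gtr0_norm (rden_gt0R q)) !jNE.
congr (_ / _); case: (rpos_rneg q) => ->; rewrite jN0 !(subr0, sub0r, add0r, addr0) ?normrN;
  by rewrite ger0_norm // jN_ge0.
Qed.

Lemma rv_lt (q r : N) : lt (add (mul (rpos q) (rden r)) (mul (rneg r) (rden q)))
  (add (mul (rpos r) (rden q)) (mul (rneg q) (rden r))) <-> rv q < rv r.
Proof.
rewrite jN_lt !jNE !rvE ltr_pdivrMr ?rden_gt0R // mulrAC ltr_pdivlMr ?rden_gt0R //.
by split=> H; lra.
Qed.

Lemma rv_le (q r : N) : le (add (mul (rpos q) (rden r)) (mul (rneg r) (rden q)))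
  (add (mul (rpos r) (rden q)) (mul (rneg q) (rden r))) <-> rv q <= rv r.
Proof.
rewrite jN_le !jNE !rvE ler_pdivrMr ?rden_gt0R // mulrAC ler_pdivlMr ?rden_gt0R //.
by split=> H; lra.
Qed.

Section EvalRational.
Variables (G : ctx) (e : env M G).
Implicit Types q r : tm G ty0.

Definition codeE := (@eval_npair M, @eval_nfst M, @eval_nsnd M, @eval_diagonal M,
  @eval_triangle M, @eval_pow2 M, @eval_half M, @eval_parity M, @eval_eqb M, @eval_monus M,
  @eval_npred M).

Lemma eval_qpos q : eval (qpos q) e = rpos (eval q e).
Proof. by rewrite /qpos rposE !(codeE, evalE). Qed.
Lemma eval_qneg q : eval (qneg q) e = rneg (eval q e).
Proof. by rewrite /qneg rnegE !(codeE, evalE). Qed.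
Lemma eval_qden q : eval (qden q) e = rden (eval q e).
Proof. by rewrite /qden rdenE !(codeE, evalE). Qed.
Lemma eval_qmk (a b d : tm G ty0) : eval (qmk a b d) e = rmk (eval a e) (eval b e) (eval d e).
Proof. by rewrite /qmk /two !(codeE, evalE). Qed.
Lemma eval_qadd q r : eval (qadd q r) e = radd (eval q e) (eval r e).
Proof. by rewrite /qadd !(eval_qmk, eval_qpos, eval_qneg, eval_qden, evalE). Qed.
Lemma eval_qsub q r : eval (qsub q r) e = rsub (eval q e) (eval r e).
Proof. by rewrite /qsub !(eval_qmk, eval_qpos, eval_qneg, eval_qden, evalE). Qed.
Lemma eval_qabs q : eval (qabs q) e = rabs (eval q e).
Proof. by rewrite /qabs !(eval_qmk, eval_qpos, eval_qneg, eval_qden, evalE). Qed.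
Lemma eval_qnat (n : tm G ty0) : eval (qnat n) e = rmk (eval n e) zero one.
Proof. by rewrite /qnat eval_qmk !evalE. Qed.
Lemma eval_qpow2inv (n : tm G ty0) : eval (qpow2inv n) e = rmk one zero (pw (eval n e)).
Proof. by rewrite /qpow2inv eval_qmk eval_pow2 !evalE. Qed.

Definition ratE := (eval_qadd, eval_qsub, eval_qabs, eval_qnat, eval_qpow2inv, eval_qmk).

Lemma sat_RatLt q r : sat (RatLt q r) e = (rv (eval q e) < rv (eval r e)).
Proof.
rewrite /RatLt satE !(eval_qpos, eval_qneg, eval_qden, evalE).
by apply: propext; rewrite -rv_lt.
Qed.

Lemma sat_RatLe q r : sat (RatLe q r) e = (rv (eval q e) <= rv (eval r e)).
Proof.
rewrite /RatLe sat_or satE sat_eq !(eval_qpos, eval_qneg, eval_qden, evalE).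
by apply: propext; rewrite -rv_le.
Qed.

End EvalRational.

End Reals.

Section RealNumbers.
Variable M : model.
Local Notation N := (M ty0).
Local Notation "f $ x" := (@ap M _ _ f x) (at level 11, left associativity).
Local Notation zero := (zero M).
Local Notation one := (one M).
Local Notation R := (cfield (Rc M)).

Definition is_real (x : M ty1) := forall n i, `|rv (x $ n) - rv (x $ (add n i))| < halfpow n.
Definition req (x y : M ty1) := forall n, `|rv (x $ n) - rv (y $ n)| <= halfpow n + halfpow n.
Definition rlt (x y : M ty1) := exists n, rv (x $ n) + (halfpow n + halfpow n) < rv (y $ n).

Lemma is_real_le x m n : is_real x -> le m n -> `|rv (x $ m) - rv (x $ n)| < halfpow m.
Proof. by move=> Hx /le_exists [k ->]. Qed.

Lemma cinj_norm (y : ffield (Q M)) : cinj (Rc M) `|y| = `|cinj (Rc M) y|.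
Proof.
case: (lerP 0 y) => y0; first by rewrite !ger0_norm // -cinj0 cinj_le.
by rewrite !ltr0_norm ?cinjN // -cinj0 cinj_lt.
Qed.

Lemma real_lim x : exists r : R, is_real x -> forall n, `|r - rv (x $ n)| <= halfpow n.
Proof.
case: (EM (is_real x)) => Hx; last by exists 0.
have Hc : cauchy (@le M) (fun n => rval (x $ n)).
  move=> e e0; have e2 : 0 < cinj (Rc M) e / 2 by rewrite divr_gt0 // -cinj0 cinj_lt.
  have [n Hn] := halfpow_small e2; exists n => j k nj nk.
  rewrite -(@cinj_lt _ _ _ (Rc M)).
  have h1 := is_real_le Hx nj; have h2 := is_real_le Hx nk.
  have -> : cinj (Rc M) `|rval (x $ j) - rval (x $ k)| = `|rv (x $ j) - rv (x $ k)|.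
    by rewrite cinj_norm cinjD cinjN.
  move: h1 h2; rewrite !ltr_norml => /andP[? ?] /andP[? ?]; apply/andP; lra.
have [r Hr] := cinj_lim (Rc M) Hc; exists r => _ n.
have := Hr (iN (pw n))^-1 n; rewrite cinjV; last first.
  by rewrite lt0r_neq0 //; have := pw_gt n; have := iN_ge0 n; lra.
apply=> j nj; rewrite -(@cinj_le M) cinjV; last first.
  by rewrite lt0r_neq0 //; have := pw_gt n; have := iN_ge0 n; lra.
by rewrite cinj_norm cinjD cinjN distrC; apply/ltW; apply: is_real_le.
Qed.

(** The real represented by [x], and a junk value if [x] represents none. *)
Definition rho (x : M ty1) : R := projT1 (cid (real_lim x)).

Lemma rhoP x : is_real x -> forall n, `|rho x - rv (x $ n)| <= halfpow n.
Proof. exact: (projT2 (cid (real_lim x))). Qed.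

Lemma rho_eq x r c : is_real x -> (forall n, `|r - rv (x $ n)| <= c * halfpow n) -> rho x = r.
Proof.
move=> Hx H; apply: (@eq_of_close M _ _ (c + 1)) => n; have := rhoP Hx n; have := H n.
rewrite mulrDl mul1r !ler_norml => /andP[? ?] /andP[? ?]; apply/andP; lra.
Qed.

Lemma reqP x y : is_real x -> is_real y -> (req x y <-> rho x = rho y).
Proof.
move=> Hx Hy; split=> [H|E n].
  apply: (@rho_eq _ _ 3) => // n; have := rhoP Hy n; have := H n.
  rewrite !ler_norml => /andP[? ?] /andP[? ?]; apply/andP; lra.
have := rhoP Hx n; have := rhoP Hy n; rewrite E.
rewrite !ler_norml => /andP[? ?] /andP[? ?]; apply/andP; lra.
Qed.

Lemma rltP x y : is_real x -> is_real y -> (rlt x y <-> rho x < rho y).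
Proof.
move=> Hx Hy; split=> [[n]|H].
  have := rhoP Hx n; have := rhoP Hy n.
  rewrite !ler_norml => /andP[? ?] /andP[? ?]; lra.
have d0 : 0 < (rho y - rho x) / 4 by lra.
have [n Hn] := halfpow_small d0; exists n.
have := rhoP Hx n; have := rhoP Hy n.
rewrite !ler_norml => /andP[? ?] /andP[? ?]; lra.
Qed.

Lemma rv_halfpow n : rv (rmk one zero (pw n)) = halfpow n.
Proof. by rewrite rv_mk ?jN_pw_gt0 // jN1 jN0 subr0 mul1r. Qed.

Lemma rv_nat n : rv (rmk n zero one) = jN n.
Proof. by rewrite rv_mk ?jN1 // jN0 subr0 divr1. Qed.

Lemma const_real (x : M ty1) q : (forall n, x $ n = q) -> is_real x /\ rho x = rv q.
Proof.
move=> H; have Hx : is_real x by move=> n i; rewrite !H subrr normr0 halfpow_gt0.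
split=> //; apply: (@rho_eq _ _ 1) => // n.
by rewrite H subrr normr0 mul1r; apply/ltW/halfpow_gt0.
Qed.

Section SatReal.

Lemma eval_weaken_skip G D (s : Defs.Sub G D) b (x : M b) (e : env M D) a (t : tm G a) :
  eval (@weaken G (b :: D) (Sub_skip s) a t) (econs x e) = eval (@weaken G D s a t) e.
Proof. by rewrite /weaken !eval_ren. Qed.

Lemma eval_weaken_refl G (e : env M G) a (t : tm G a) :
  eval (@weaken G G Sub_refl a t) e = eval t e.
Proof. by rewrite /weaken eval_ren. Qed.

Lemma eval_vz G (e : env M G) b (x : M b) : eval (Var vz) (econs x e) = x.
Proof. by []. Qed.

Lemma eval_vs G (e : env M G) b (x : M b) a (v : var G a) :
  eval (Var (vs v)) (econs x e) = eval (Var v) e.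
Proof. by []. Qed.

Definition varE := (eval_weaken_skip, eval_weaken_refl, eval_vz, eval_vs).

Lemma eval_fn G (e : env M G) a b (t : tm (a :: G) a -> tm (a :: G) b) x :
  eval (lam_ a t) e $ x = eval (t (Var vz)) (econs x e).
Proof. exact: ap_lam. Qed.

Variables (G : ctx) (e : env M G).
Implicit Types x y : tm G ty1.

Lemma sat_Real x : sat (Real x) e = is_real (eval x e).
Proof.
rewrite /Real sat_all; apply: eq_forall => n; rewrite sat_all; apply: eq_forall => i.
rewrite sat_RatLt !(eval_qabs, eval_qsub, eval_qpow2inv, varE, evalE).
by rewrite rv_halfpow rv_abs rv_sub.
Qed.

Lemma sat_RealEq x y : sat (RealEq x y) e = req (eval x e) (eval y e).
Proof.
rewrite /RealEq sat_all; apply: eq_forall => n.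
by rewrite sat_RatLe !(ratE, varE, evalE) rv_add !rv_halfpow rv_abs rv_sub.
Qed.

Lemma sat_RealLt x y : sat (RealLt x y) e = rlt (eval x e) (eval y e).
Proof.
rewrite /RealLt sat_ex; apply: eq_exists => n.
by rewrite sat_RatLt !(eval_qadd, eval_qpow2inv, varE, evalE) !rv_add !rv_halfpow.
Qed.

Lemma sat_RealLe x y : sat (RealLe x y) e = ~ rlt (eval y e) (eval x e).
Proof. by rewrite /RealLe sat_neg sat_RealLt. Qed.

Lemma rnatP (n : tm G ty0) :
  is_real (eval (rnat n) e) /\ rho (eval (rnat n) e) = jN (eval n e).
Proof.
rewrite -rv_nat; apply: const_real => k.
by rewrite /rnat eval_fn !(ratE, varE).
Qed.

Lemma rdistP x y : is_real (eval x e) -> is_real (eval y e) ->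
  is_real (eval (rdist x y) e) /\
  rho (eval (rdist x y) e) = `|rho (eval x e) - rho (eval y e)|.
Proof.
move=> Hx Hy.
have E n : rv (eval (rdist x y) e $ n) =
    `|rv (eval x e $ (add n one)) - rv (eval y e $ (add n one))|.
  by rewrite /rdist eval_fn !(ratE, varE, evalE) rv_abs rv_sub.
have Hr : is_real (eval (rdist x y) e).
  move=> n i; rewrite !E.
  apply: (le_lt_trans (ler_dist_dist _ _)).
  have -> : add (add n i) one = add (add n one) i by rewrite !addA (addC i).
  have := Hx (add n one) i; have := Hy (add n one) i; rewrite halfpowS !ltr_norml.
  by move=> /andP[? ?] /andP[? ?]; apply/andP; lra.
split=> //; apply: (@rho_eq _ _ 1) => // n; rewrite E mul1r.
apply: (le_trans (ler_dist_dist _ _)).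
have := rhoP Hx (add n one); have := rhoP Hy (add n one); rewrite halfpowS !ler_norml.
by move=> /andP[? ?] /andP[? ?]; apply/andP; lra.
Qed.

Definition unit_real (x : M ty1) := is_real x /\ 0 <= rho x <= 1.

Lemma sat_in01 x : sat (in01 x) e = unit_real (eval x e).
Proof.
rewrite /in01 !sat_and sat_Real !sat_RealLe; apply: propext.
have [r0 e0] := rnatP (Cst Zero); have [r1 e1] := rnatP (Cst One).
have E0 : rho (eval (rnat (Cst Zero)) e) = 0 by rewrite e0 evalE jN0.
have E1 : rho (eval (rnat (Cst One)) e) = 1 by rewrite e1 evalE jN1.
split.
  move=> [Hx [h0 h1]]; split=> //; apply/andP; split; rewrite leNgt; apply/negP => H.
    by apply: h0; apply/rltP => //; rewrite E0.
  by apply: h1; apply/rltP => //; rewrite E1.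
move=> [Hx /andP[h0 h1]]; split=> //; split.
  by move=> /(rltP Hx r0); rewrite E0 ltNge h0.
by move=> /(rltP r1 Hx); rewrite E1 ltNge h1.
Qed.

End SatReal.
End RealNumbers.

(** * Kleene's functional *)

(** The characteristic term of an arithmetical formula, given a term [E] for
    Kleene's functional; it vanishes iff the formula holds. *)
Fixpoint chi G (A : fm G) : tm G ty2 -> tm G ty0 :=
  match A with
  | FBot => fun _ => Cst One
  | FEq s t => fun _ => monus (Cst One) (Defs.eqb s t)
  | FLt s t => fun _ => monus (Cst One) (monus t s)
  | FImp A B => fun E =>
      App (App (Cst Times) (monus (Cst One) (chi A E))) (chi B E)
  | FAll a A => fun E =>
      match a return tm (a :: G) ty0 -> tm G ty0 with
      | ty0 => fun t => App E (lam t)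
      | Arr _ _ => fun _ => Cst Zero
      end (chi A (ren_tm shift E))
  end.

Fixpoint arith G (A : fm G) : Prop :=
  match A with
  | FBot | FEq _ _ | FLt _ _ => True
  | FImp A B => arith A /\ arith B
  | FAll a A => match a with ty0 => arith A | Arr _ _ => False end
  end.

Section Kleene.
Variable M : model.
Local Notation N := (M ty0).
Local Notation "f $ x" := (@ap M _ _ f x) (at level 11, left associativity).
Local Notation zero := (zero M).
Local Notation one := (one M).
Local Notation R := (cfield (Rc M)).

Definition kleene (E : M ty2) := forall f, E $ f = zero <-> forall n, f $ n = zero.

Lemma eqn_eq0 (m n : N) : sub one (eqn m n) = zero <-> m = n.
Proof.
rewrite not_eq0; case: (EM (m = n)) => [E|mn].
  by rewrite (eqn_eq E); split=> // _ /(congr1 (@iN M)); rewrite iN0 iN1; lra.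
by rewrite (eqn_neq mn); split.
Qed.

Lemma chiP G (A : fm G) : arith A -> forall (E : tm G ty2) (e : env M G),
  kleene (eval E e) -> sat A e <-> eval (chi A E) e = zero.
Proof.
elim: A => {G} [G|G s t|G s t|G A IA B IB|G a A IA] HA E e HE; rewrite /= ?satE.
- by rewrite evalE; split=> // /(congr1 (@iN M)); rewrite iN0 iN1; lra.
- by rewrite !(eval_monus, eval_eqb, evalE) eqn_eq0 eq0E.
- rewrite !(eval_monus, evalE) not_eq0 sub_eq0; split.
    by move=> /iN_lt ? /iN_le; lra.
  by move=> H; case: (le_or_lt (eval t e) (eval s e)).
- case: HA => HA HB; rewrite IA // IB //.
  rewrite !(eval_monus, evalE) -/(mul _ _) mul_eq0 not_eq0.
  split=> [H|[]//]; case: (EM (eval (chi A E) e = zero)) => [/H|]; by [right|left].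
- case: a A IA HA => [|//] A IA /= HA; rewrite !evalE.
  have HE' n : kleene (eval (ren_tm shift E) (econs (n : M ty0) e)) by rewrite eval_shift.
  rewrite (HE _); split=> H n; first by rewrite ap_lam; apply/IA.
  by apply/(IA HA _ _ (HE' n)); rewrite -ap_lam.
Qed.

Lemma arith_ind G (A : fm (ty0 :: G)) (E : tm G ty2) (e : env M G) :
  arith A -> kleene (eval E e) -> sat A (econs zero e) ->
  (forall n, sat A (econs n e) -> sat A (econs (add n one) e)) ->
  forall n, sat A (econs n e).
Proof.
move=> HA HE A0 AS.
have C n : sat A (econs n e) <-> sat (FEq (chi A (ren_tm shift E)) (Cst Zero)) (econs n e).
  by rewrite sat_eq (chiP HA (E := ren_tm shift E)) ?evalE // eval_shift.
move=> n; apply/C; apply: qf_ind => //; first exact/C.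
by move=> k /C/AS/C.
Qed.

Lemma arith_choice G (A : fm (ty0 :: ty1 :: G)) (E : tm G ty2) (e : env M G) :
  arith A -> kleene (eval E e) ->
  (forall x : M ty1, exists n : N, sat A (econs n (econs x e))) ->
  exists Z : M ty2, forall x, sat A (econs (Z $ x) (econs x e)).
Proof.
move=> HA HE H; pose E' := ren_tm shift (ren_tm shift E) : tm (ty0 :: ty1 :: G) ty2.
have C n x : sat A (econs n (econs x e)) <->
    sat (FEq (chi A E') (Cst Zero)) (econs n (econs x e)).
  by rewrite sat_eq (chiP HA (E := E')) ?evalE // /E' !eval_shift.
have := @model_ax M _ _ e (@ax_QF_AC10 G (FEq (chi A E') (Cst Zero)) I).
rewrite satE sat_Ex => -[|Z HZ].
  by rewrite satE => x; rewrite sat_Ex; have [n /C Hn] := H x; exists n.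
exists Z => x; apply/C; move: HZ; rewrite satE => /(_ x); rewrite sat_subst.
congr sat; apply: env_ext; do 2 (apply: var_case => //).
Qed.

Lemma rho_ge x m c : is_real x -> (forall n, le m n -> c <= rv (x $ n)) -> c <= rho x.
Proof.
move=> Hx H; rewrite leNgt; apply/negP => xc.
have [n Hn] : exists n, halfpow n < c - rho x by apply: halfpow_small; lra.
have [k mk nk] := nle_directed m n.
have := rhoP Hx k; have := H k mk; have := halfpow_le nk.
rewrite ler_norml => ? ? /andP[? ?]; lra.
Qed.

Lemma rho_le x m c : is_real x -> (forall n, le m n -> rv (x $ n) <= c) -> rho x <= c.
Proof.
move=> Hx H; rewrite leNgt; apply/negP => xc.
have [n Hn] : exists n, halfpow n < rho x - c by apply: halfpow_small; lra.
have [k mk nk] := nle_directed m n.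
have := rhoP Hx k; have := H k mk; have := halfpow_le nk.
rewrite ler_norml => ? ? /andP[? ?]; lra.
Qed.

Definition sign_step : tm [:: ty0; ty0; ty1] ty0 :=
  App (App (Cst Plus) (App (App (Cst Plus) (Var vz)) (Var vz)))
    (monus (Cst One) (monus (Cst One) (App (Var (vs (vs vz))) (Var (vs vz))))).

Lemma sign_step_sealed (f : M ty1) :
  {F : M (Arr ty0 (Arr ty0 ty0)) | F = eval (lam (lam sign_step)) (econs f (enil M))}.
Proof. by eexists. Qed.

Definition sign_stepM f := sval (sign_step_sealed f).

Lemma sign_stepME f n v :
  sign_stepM f $ n $ v = add (add v v) (sub one (sub one (f $ n))).
Proof.
rewrite /sign_stepM (svalP (sign_step_sealed f)) (@ap_lam M _ _ _ (lam sign_step)).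
by rewrite (@ap_lam M _ _ _ sign_step) /sign_step !(eval_monus, evalE).
Qed.

Definition sign_sum (f : M ty1) (n : N) : N :=
  con M Rec $ sign_stepM f $ zero $ n.

Lemma sign_sum0 f : sign_sum f zero = zero. Proof. exact: rec0. Qed.
Lemma sign_sumS f n : sign_sum f (add n one) =
  add (add (sign_sum f n) (sign_sum f n)) (sub one (sub one (f $ n))).
Proof. by rewrite /sign_sum recS sign_stepME. Qed.

(** The binary expansion of [f], i.e. the sum of the [sg (f i) / 2^(i + 2)]. *)
Definition expansion_body : tm [:: ty0; ty1] ty0 :=
  qmk (App (App (App (Cst Rec) (ren_tm shift (lam (lam sign_step)))) (Cst Zero)) (Var vz))
    (Cst Zero) (pow2 (App (App (Cst Plus) (Var vz)) (Cst One))).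

Lemma expansion_sealed : {X : M (Arr ty1 ty1) |
  forall f n, X $ f $ n = rmk (sign_sum f n) zero (pw (add n one))}.
Proof.
exists (eval (lam (lam expansion_body)) (enil M)) => f n.
have -> := ap_lam (lam expansion_body) (enil M) f.
have -> := ap_lam expansion_body (econs f (enil M)) n.
have E := eval_shift n (econs f (enil M)) (lam (lam sign_step)).
have <- : con M Rec $ eval (ren_tm shift (lam (lam sign_step))) (econs n (econs f (enil M)))
    $ zero $ n = sign_sum f n.
  by rewrite E /sign_sum /sign_stepM (svalP (sign_step_sealed f)).
have <- := eval_pow2 (econs n (econs f (enil M))) (App (App (Cst Plus) (Var vz)) (Cst One)).
exact: eval_qmk.
Qed.

Definition expansion := sval expansion_sealed.

Lemma rv_expansion f n : rv (expansion $ f $ n) = jN (sign_sum f n) * halfpow (add n one).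
Proof.
by rewrite (svalP expansion_sealed) rv_mk ?jN_pw_gt0 // jN0 subr0.
Qed.

Lemma sgn_le1 m : le (sub one (sub one m)) one :> Prop.
Proof.
apply/iN_le; case: (le_or_lt (sub one m) one) => [/sub_ge ->|H].
  by rewrite iN1; have := iN_ge0 (sub one m); lra.
by rewrite sub_le ?iN0 ?iN1 ?ler01 //; left.
Qed.

Lemma sign_sum_ge f n i : jN (sign_sum f n) * jN (pw i) <= jN (sign_sum f (add n i)).
Proof.
suff : le (mul (sign_sum f n) (pw i)) (sign_sum f (add n i)) by move=> /jN_le; rewrite jNM.
move: i; apply: dec_ind; first dec.
  by rewrite add0 pw0 mul1; right.
move=> i /jN_le; rewrite -addA sign_sumS pwS => H; apply/jN_le; move: H; rewrite !jNE.
have := jN_ge0 (sub one (sub one (f $ (add n i)))); lra.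
Qed.

Lemma sign_sum_le f n i :
  jN (sign_sum f (add n i)) + 1 <= (jN (sign_sum f n) + 1) * jN (pw i).
Proof.
suff : le (add (sign_sum f (add n i)) one) (mul (add (sign_sum f n) one) (pw i)).
  by move=> /jN_le; rewrite !jNE.
move: i; apply: dec_ind; first dec.
  by rewrite add0 pw0 mul1; right.
move=> i /jN_le; rewrite -addA sign_sumS pwS => H; apply/jN_le; move: H; rewrite !jNE.
have /jN_le := sgn_le1 (f $ (add n i)); rewrite jN1; lra.
Qed.

Lemma expansion_bounds f n i :
  jN (sign_sum f n) * halfpow (add n one) <= rv (expansion $ f $ (add n i)) <
  (jN (sign_sum f n) + 1) * halfpow (add n one).
Proof.
have -> : rv (expansion $ f $ (add n i)) =
    jN (sign_sum f (add n i)) / jN (pw i) * halfpow (add n one).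
  have E : add (add n i) one = add i (add n one) by rewrite (addC n) addA.
  by rewrite rv_expansion E halfpowD mulrA.
have p0 := jN_pw_gt0 i; have q0 := halfpow_gt0 (add n one).
rewrite ler_pM2r // ltr_pM2r // ler_pdivlMr // ltr_pdivrMr //.
have := sign_sum_ge f n i; have := sign_sum_le f n i; lra.
Qed.

Lemma expansion_real f : is_real (expansion $ f).
Proof.
move=> n i; have /andP[h1 h2] := expansion_bounds f n i; have := halfpow_gt0 n.
rewrite (rv_expansion f n); move: h1 h2; rewrite halfpowS ltr_norml => *.
by apply/andP; lra.
Qed.

Lemma expansion_unit f : unit_real (expansion $ f).
Proof.
split; first exact: expansion_real.
have B n : 0 <= rv (expansion $ f $ n) <= 1.
  have := expansion_bounds f zero n; rewrite !(addC zero) !add0 sign_sum0 jN0.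
  have -> : halfpow one = 1 / 2 :> R by rewrite -[one]add0 addC halfpowS halfpow0.
  by move=> /andP[? ?]; apply/andP; lra.
apply/andP; split; [apply: (@rho_ge _ zero)|apply: (@rho_le _ zero)];
  try exact: expansion_real; by move=> n _; case/andP: (B n).
Qed.

Lemma expansion_eq0 f : rho (expansion $ f) = 0 <-> forall n, f $ n = zero.
Proof.
split=> [E n|H]; last first.
  have S0 : forall n, sign_sum f n = zero.
    apply: dec_ind; first dec.
      exact: sign_sum0.
    move=> n Hn; rewrite sign_sumS Hn H sub0 add0.
    by rewrite sub_le //; [rewrite add0|right].
  apply: (@rho_eq _ _ _ 1); first exact: expansion_real.
  by move=> n; rewrite rv_expansion S0 jN0 mul0r subrr normr0 mul1r; apply/ltW/halfpow_gt0.
apply: contrapT => fn; have s1 : 1 <= jN (sign_sum f (add n one)).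
  rewrite sign_sumS !jND.
  have -> : sub one (f $ n) = zero by apply: sub_le; apply: neq0_ge1.
  by rewrite sub0 jN1; have := jN_ge0 (sign_sum f n); lra.
have p0 := halfpow_gt0 (add (add n one) one).
suff : halfpow (add (add n one) one) <= rho (expansion $ f) by rewrite E; lra.
apply: (@rho_ge _ (add n one)) => [|k /le_exists [i ->]]; first exact: expansion_real.
have /andP[h1 _] := expansion_bounds f (add n one) i.
by apply: le_trans h1; rewrite ler_peMl // ltW.
Qed.

Definition real_zero : M ty1 := eval (rnat (Cst Zero)) (enil M).

Lemma real_zeroP : is_real real_zero /\ rho real_zero = 0.
Proof. by have := rnatP (enil M) (Cst Zero); rewrite evalE jN0. Qed.

Lemma unit_zero : unit_real real_zero.
Proof. by have [? E] := real_zeroP; split=> //; rewrite E lexx ler01. Qed.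

Definition fun_unit (Y : M ty2) :=
  forall x y, unit_real x -> unit_real y -> req x y -> Y $ x = Y $ y.

Definition inj_unit (Y : M ty2) :=
  forall x y, unit_real x -> unit_real y -> Y $ x = Y $ y -> req x y.

Lemma dfn_eqn a (f g : M a -> N) : dfn f -> dfn g -> dfn (fun x => eqn (f x) (g x)).
Proof.
move=> Hf Hg; apply: dfn_sub; first exact: dfn_cst.
by apply: dfn_add; apply: dfn_sub.
Qed.

Lemma injection_kleene Y : fun_unit Y -> inj_unit Y -> exists E, kleene E.
Proof.
move=> FY IY.
have [E HE] : dfn (fun f => sub one (eqn (Y $ (expansion $ f)) (Y $ real_zero))).
  apply: dfn_sub; first exact: dfn_cst.
  by apply: dfn_eqn; dfn.
exists E => f; rewrite HE eqn_eq0 -expansion_eq0.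
have [z0 ez] := real_zeroP; have Hf := expansion_real f.
split=> [/IY|E0].
  by move=> /(_ (expansion_unit f) unit_zero) /(reqP Hf z0); rewrite ez.
by apply: FY; [exact: expansion_unit|exact: unit_zero|apply/reqP; rewrite // ez].
Qed.

End Kleene.

(** * Affine maps *)

Section Affine.
Variable M : model.
Local Notation N := (M ty0).
Local Notation "f $ x" := (@ap M _ _ f x) (at level 11, left associativity).
Local Notation zero := (zero M).
Local Notation one := (one M).
Local Notation R := (cfield (Rc M)).

(** A term for the real number [(a x + c - d) / b]. *)
Definition affine_tm G (a b c d : tm G ty0) (x : tm G ty1) : tm G ty1 :=
  let a' := ren_tm shift a in let d' := ren_tm shift d in
  let r := App (ren_tm (shift (b := ty0)) x) (App (App (Cst Plus) (Var vz)) a') in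
  lam (qmk
    (App (App (Cst Plus) (App (App (Cst Times) a') (qpos r)))
       (App (App (Cst Times) (ren_tm shift c)) (qden r)))
    (App (App (Cst Plus) (App (App (Cst Times) a') (qneg r)))
       (App (App (Cst Times) d') (qden r)))
    (App (App (Cst Times) (ren_tm shift b)) (qden r))).

Definition affine_code (a b c d r : N) : N :=
  rmk (add (mul a (rpos r)) (mul c (rden r))) (add (mul a (rneg r)) (mul d (rden r)))
    (mul b (rden r)).

Lemma affine_tmP G (e : env M G) a b c d x n :
  eval (affine_tm a b c d x) e $ n = affine_code (eval a e) (eval b e) (eval c e) (eval d e)
    (eval x e $ (add n (eval a e))).
Proof.
rewrite /affine_tm ap_lam !(eval_qmk, eval_qpos, eval_qneg, eval_qden, evalE).
by rewrite !eval_shift.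
Qed.

Lemma affine_sealed (a b c d : N) (x : M ty1) :
  {y : M ty1 | forall n, y $ n = affine_code a b c d (x $ (add n a))}.
Proof.
pose e := econs a (econs b (econs c (econs d (econs x (enil M))))).
exists (eval (affine_tm (Var vz) (Var (vs vz)) (Var (vs (vs vz))) (Var (vs (vs (vs vz))))
  (Var (vs (vs (vs (vs vz)))))) e) => n.
by rewrite affine_tmP.
Qed.

Definition affine a b c d x := sval (affine_sealed a b c d x).

Lemma eval_affine G (e : env M G) a b c d x :
  eval (affine_tm a b c d x) e =
  affine (eval a e) (eval b e) (eval c e) (eval d e) (eval x e).
Proof. by apply: extensional => n; rewrite affine_tmP (svalP (affine_sealed _ _ _ _ _)). Qed.

Lemma affineP a b c d x : 0 < jN b -> is_real x ->
  is_real (affine a b c d x) /\ rho (affine a b c d x) = (jN a * rho x + jN c - jN d) / jN b.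
Proof.
move=> b0 Hx.
have E n : rv (affine a b c d x $ n) = (jN a * rv (x $ (add n a)) + jN c - jN d) / jN b.
  rewrite (svalP (affine_sealed _ _ _ _ _)) /affine_code rv_mk; last first.
    by rewrite jNM mulr_gt0 ?rden_gt0R.
  rewrite !jND !jNM; set r := x $ _; have r0 := rden_gt0R r.
  have -> : jN (rpos r) = rv r * jN (rden r) + jN (rneg r).
    by rewrite rvE mulfVK ?lt0r_neq0 // subrK.
  by apply/eqP; rewrite eqr_div ?mulf_neq0 ?lt0r_neq0 //; apply/eqP; ring.
have b1 : 1 <= jN b by move: b0; rewrite -jN0 => /jN_discrete; rewrite jN0 add0r.
have small n (u v : R) k : 0 <= k -> `|u - v| <= k * halfpow (add n a) ->
    `|(jN a * u + jN c - jN d) / jN b - (jN a * v + jN c - jN d) / jN b| <= k * halfpow n.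
  move=> k0 uv.
  have -> : (jN a * u + jN c - jN d) / jN b - (jN a * v + jN c - jN d) / jN b =
     jN a / jN b * (u - v) by rewrite -mulrBl; ring.
  have a0 := jN_ge0 a.
  rewrite normrM ger0_norm ?divr_ge0 ?(ltW b0) //.
  have ab : jN a / jN b <= jN a by rewrite ler_pdivrMr // ler_peMr.
  have h1 : jN a / jN b * `|u - v| <= jN a * (k * halfpow (add n a)) by rewrite ler_pM ?divr_ge0 ?(ltW b0).
  apply: (le_trans h1); rewrite halfpowD.
  have pa : jN a * halfpow a <= 1.
    by rewrite /halfpow ler_pdivrMr ?jN_pw_gt0 // mul1r; have := jN_pw_gt a; lra.
  have -> : jN a * (k * (halfpow n * halfpow a)) = k * halfpow n * (jN a * halfpow a) by ring.
  by rewrite ler_piMr // mulr_ge0 // ltW // halfpow_gt0.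
have Hr : is_real (affine a b c d x).
  move=> n i; rewrite !E.
  have Hi := Hx (add n a) i.
  pose k := `|rv (x $ (add n a)) - rv (x $ (add (add n a) i))| / halfpow (add n a).
  have k0 : 0 <= k by rewrite divr_ge0 // ltW // halfpow_gt0.
  have k1 : k < 1 by rewrite ltr_pdivrMr ?halfpow_gt0 // mul1r.
  have eA : add (add n i) a = add (add n a) i by rewrite !addA (addC i).
  apply: (le_lt_trans (@small n _ _ k k0 _)).
    by rewrite eA mulfVK ?lt0r_neq0 ?halfpow_gt0.
  by rewrite -[ltRHS]mul1r ltr_pM2r ?halfpow_gt0.
split=> //; apply: (@rho_eq _ _ _ 1) => // n; rewrite E.
by apply: small => //; rewrite mul1r; apply: rhoP.
Qed.

End Affine.

(** * Sets of reals *)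

Section Principles.
Variable M : model.
Local Notation N := (M ty0).
Local Notation "f $ x" := (@ap M _ _ f x) (at level 11, left associativity).
Local Notation zero := (zero M).
Local Notation one := (one M).
Local Notation R := (cfield (Rc M)).

Lemma eval_real_zero G (e : env M G) : eval (rnat (Cst Zero)) e = real_zero M.
Proof.
by apply: extensional => n; rewrite /real_zero /rnat !eval_fn !(ratE, varE, evalE).
Qed.

Lemma eval_rdist_ap G (e : env M G) x y n : eval (rdist x y) e $ n =
  rabs (rsub (eval x e $ (add n one)) (eval y e $ (add n one))).
Proof. by rewrite /rdist eval_fn !(ratE, varE, evalE). Qed.

Definition dist (x y : M ty1) : M ty1 :=
  eval (rdist (Var vz) (Var (vs vz))) (econs x (econs y (enil M))).

Lemma eval_rdist G (e : env M G) x y : eval (rdist x y) e = dist (eval x e) (eval y e).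
Proof. by apply: extensional => n; rewrite /dist !eval_rdist_ap. Qed.

Lemma distP x y : is_real x -> is_real y ->
  is_real (dist x y) /\ rho (dist x y) = `|rho x - rho y|.
Proof. by move=> Hx Hy; apply: rdistP. Qed.

Definition fun_real (F : M (Arr ty1 ty1)) :=
  (forall x, is_real x -> is_real (F $ x)) /\
  (forall x y, is_real x -> is_real y -> req x y -> req (F $ x) (F $ y)).
Definition fun_nat (Y : M ty2) :=
  forall x y, is_real x -> is_real y -> req x y -> Y $ x = Y $ y.
Definition member x (A : M (Arr ty1 ty1)) := is_real x /\ rlt (real_zero M) (A $ x).
Definition in_ball y x r := is_real y /\ rlt (dist x y) r.
Definition closed_set A := forall x, is_real x -> ~ member x A -> exists r,
  is_real r /\ rlt (real_zero M) r /\ forall y, in_ball y x r -> ~ member y A.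
Definition limit_pt x A := forall r, is_real r -> rlt (real_zero M) r ->
  exists y, member y A /\ in_ball y x r /\ ~ req y x.
Definition perfect_set A := closed_set A /\ forall x, member x A -> limit_pt x A.
Definition injective_set (Y : M ty2) A :=
  forall x y, member x A -> member y A -> Y $ x = Y $ y -> req x y.
Definition onto_set (Y : M ty2) A := forall n, exists x, member x A /\ Y $ x = n.
Definition misses A := exists y, unit_real y /\ forall x, member x A -> ~ req y x.
Definition collides (Y : M ty2) := exists x y,
  unit_real x /\ unit_real y /\ ~ req x y /\ Y $ x = Y $ y.

Section Sat.
Variables (G : ctx) (e : env M G).

Lemma sat_FunRR F : sat (FunRR F) e = fun_real (eval F e).
Proof.
rewrite /FunRR sat_and; congr (_ /\ _); rewrite sat_all; apply: eq_forall => x.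
  by rewrite !(sat_Real, satE) !(varE, evalE).
rewrite sat_all; apply: eq_forall => y.
by rewrite !(sat_Real, sat_RealEq, satE) !(varE, evalE).
Qed.

Lemma sat_FunRN Y : sat (FunRN Y) e = fun_nat (eval Y e).
Proof.
rewrite /FunRN sat_all; apply: eq_forall => x; rewrite sat_all; apply: eq_forall => y.
by rewrite !(sat_Real, sat_RealEq, sat_eq, satE) !(varE, evalE).
Qed.

Lemma sat_Fun01N Y : sat (Fun01N Y) e = fun_unit (eval Y e).
Proof.
rewrite /Fun01N sat_all; apply: eq_forall => x; rewrite sat_all; apply: eq_forall => y.
by rewrite !(sat_in01, sat_RealEq, sat_eq, satE) !(varE, evalE).
Qed.

Lemma sat_mem x A : sat (Defs.mem x A) e = member (eval x e) (eval A e).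
Proof. by rewrite /Defs.mem sat_and sat_Real sat_RealLt eval_real_zero evalE. Qed.

Lemma sat_not_mem x A : sat (Neg (Defs.mem x A)) e = ~ member (eval x e) (eval A e).
Proof. by rewrite sat_neg sat_mem. Qed.

Lemma sat_ball y x r : sat (ball y x r) e = in_ball (eval y e) (eval x e) (eval r e).
Proof. by rewrite /ball sat_and sat_Real sat_RealLt eval_rdist. Qed.
End Sat.

Lemma sat_closed G (e : env M G) A : sat (Defs.closed A) e = closed_set (eval A e).
Proof.
rewrite /Defs.closed /Defs.open sat_all; apply: eq_forall => x.
rewrite satE sat_Real satE sat_not_mem !(varE, evalE).
congr (_ -> _ -> _); rewrite sat_ex; apply: eq_exists => r.
rewrite !sat_and sat_Real sat_RealLt eval_real_zero; congr (_ /\ (_ /\ _)).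
rewrite sat_all; apply: eq_forall => y.
by rewrite satE sat_ball sat_not_mem !(varE, evalE).
Qed.

Lemma sat_limit_point G (e : env M G) x A :
  sat (limit_point x A) e = limit_pt (eval x e) (eval A e).
Proof.
rewrite /limit_point sat_all; apply: eq_forall => r.
rewrite satE sat_Real satE sat_RealLt eval_real_zero; congr (_ -> _ -> _).
rewrite sat_ex; apply: eq_exists => y.
by rewrite !(sat_mem, sat_ball, sat_RealEq, sat_and, sat_neg) !(varE, evalE).
Qed.

Lemma sat_perfect G (e : env M G) A : sat (perfect A) e = perfect_set (eval A e).
Proof.
rewrite /perfect sat_and sat_closed sat_all; congr (_ /\ _); apply: eq_forall => x.
by rewrite !(sat_mem, sat_limit_point, satE) !(varE, evalE).
Qed.

Lemma sat_sub01 G (e : env M G) A :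
  sat (sub01 A) e = forall x, member x (eval A e) -> unit_real x.
Proof.
rewrite /sub01 sat_all; apply: eq_forall => x.
by rewrite !(sat_mem, sat_in01, satE) !(varE, evalE).
Qed.

Lemma sat_nonempty G (e : env M G) A :
  sat (nonempty A) e = exists x, member x (eval A e).
Proof.
by rewrite /nonempty sat_ex; apply: eq_exists => x; rewrite sat_mem !(varE, evalE).
Qed.

Lemma sat_injective_on G (e : env M G) Y A :
  sat (injective_on Y A) e = injective_set (eval Y e) (eval A e).
Proof.
rewrite /injective_on sat_all; apply: eq_forall => x; rewrite sat_all; apply: eq_forall => y.
by rewrite !(sat_mem, sat_RealEq, sat_eq, satE) !(varE, evalE).
Qed.

Lemma sat_onto_from G (e : env M G) Y A :
  sat (onto_from Y A) e = onto_set (eval Y e) (eval A e).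
Proof.
rewrite /onto_from sat_all; apply: eq_forall => n; rewrite sat_ex; apply: eq_exists => x.
by rewrite !(sat_mem, sat_and, sat_eq) !(varE, evalE).
Qed.

Lemma sat_countable G (e : env M G) A : sat (countable A) e =
  exists Y, fun_nat Y /\ injective_set Y (eval A e).
Proof.
rewrite /countable sat_ex; apply: eq_exists => Y.
by rewrite !(sat_FunRN, sat_injective_on, sat_and) !(varE, evalE).
Qed.

Lemma sat_strongly_countable G (e : env M G) A : sat (strongly_countable A) e =
  exists Y, fun_nat Y /\ injective_set Y (eval A e) /\ onto_set Y (eval A e).
Proof.
rewrite /strongly_countable sat_ex; apply: eq_exists => Y.
by rewrite !(sat_FunRN, sat_injective_on, sat_onto_from, sat_and) !(varE, evalE).
Qed.

Lemma sat_misses G (e : env M G) A : sat (misses_point_of_01 A) e = misses (eval A e).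
Proof.
rewrite /misses_point_of_01 sat_ex; apply: eq_exists => y.
rewrite sat_and sat_in01 sat_all; congr (_ /\ _); apply: eq_forall => x.
by rewrite !(sat_mem, sat_RealEq, sat_neg, satE) !(varE, evalE).
Qed.

Lemma sat_collision G (e : env M G) Y : sat (collision01 Y) e = collides (eval Y e).
Proof.
rewrite /collision01 sat_ex; apply: eq_exists => x; rewrite sat_ex; apply: eq_exists => y.
by rewrite !(sat_in01, sat_RealEq, sat_and, sat_eq, sat_neg) !(varE, evalE).
Qed.

Lemma collides_inj Y : ~ collides Y -> inj_unit Y.
Proof.
move=> H x y Hx Hy xy; apply: contrapT => N; apply: H; exists x, y; by [].
Qed.

Lemma const_fun_real q : exists r : M ty1, is_real r /\ rho r = rv q.
Proof. by exists (con M (Pi ty0 ty0) $ q); apply: (const_real (q := q)) => n; rewrite ap_Pi. Qed.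

Lemma perfect_unit A : (forall x, member x A <-> unit_real x) -> perfect_set A.
Proof.
move=> HA; have [z0 ez] := real_zeroP M; split.
- move=> x Hx /HA nx.
  have [d d0 Hd] : exists2 d, 0 < d &
      forall s : R, `|rho x - s| < d -> ~ (0 <= s <= 1).
    case: (ltrP (rho x) 0) => x0.
      exists (- rho x); first lra.
      by move=> s; rewrite ltr_norml => /andP[? ?] /andP[? ?]; lra.
    case: (ltrP 1 (rho x)) => x1.
      exists (rho x - 1); first lra.
      by move=> s; rewrite ltr_norml => /andP[? ?] /andP[? ?]; lra.
    by case: nx; split=> //; rewrite x0 x1.
  have [m Hm] := halfpow_small d0.
  have [r [Hr er]] := const_fun_real (rmk one zero (pw m)); rewrite rv_halfpow in er.
  exists r; split=> //; split; first by apply/rltP; rewrite ?ez ?er ?halfpow_gt0.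
  move=> y [Hy]; have [Hd' ed] := distP Hx Hy.
  move=> /(rltP Hd' Hr); rewrite ed er => h /HA [_]; apply: Hd; lra.
- move=> x /HA [Hx /andP[x0 x1]] r Hr /(rltP z0 Hr); rewrite ez => r0.
  have [m Hm] : exists m, halfpow m < Num.min (rho r) (1 / 2).
    by apply: halfpow_small; rewrite lt_min r0 /=; lra.
  move: Hm; rewrite lt_min => /andP[mr m2].
  have pm := halfpow_gt0 m; have p0 := jN_pw_gt0 m.
  have aff (c d : N) : exists y, is_real y /\ rho y = rho x + (jN c - jN d) * halfpow m.
    exists (affine (pw m) (pw m) c d x); have [Hy ->] := affineP (pw m) c d p0 Hx.
    split=> //; rewrite -addrA mulrDl [jN (pw m) * _]mulrC mulfK ?lt0r_neq0 //.
  have use y : is_real y -> 0 <= rho y <= 1 -> `|rho x - rho y| = halfpow m ->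
      exists y, member y A /\ in_ball y x r /\ ~ req y x.
    move=> Hy y01 xy; exists y; split; first by apply/HA.
    have [Hd ed] := distP Hx Hy; split.
      by split=> //; apply/rltP => //; rewrite ed xy.
    move=> /(reqP Hy Hx) E; move: xy; rewrite E subrr normr0; lra.
  case: (lerP (rho x) (1 / 2)) => xh.
    have [y [Hy ey]] := aff one zero; move: ey; rewrite jN1 jN0 subr0 mul1r => ey.
    apply: (use y) => //; first by rewrite ey; apply/andP; lra.
    by rewrite ey opprD addrA subrr sub0r normrN gtr0_norm.
  have [y [Hy ey]] := aff zero one; move: ey; rewrite jN1 jN0 sub0r mulN1r => ey.
  apply: (use y) => //; first by rewrite ey; apply/andP; lra.
  by rewrite ey opprB addrC subrK gtr0_norm.
Qed.

Definition unit_graph : fm [:: ty0; ty1; ty2] :=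
  Or (And (in01 (Var (vs vz))) (FEq (Var vz) (Cst One)))
     (And (Neg (in01 (Var (vs vz)))) (FEq (Var vz) (Cst Zero))).

Lemma arith_unit_graph : arith unit_graph.
Proof. by rewrite /=; repeat split. Qed.

Lemma unit_indicator (E : M ty2) : kleene E -> exists C : M ty2,
  forall x, (unit_real x -> C $ x = one) /\ (~ unit_real x -> C $ x = zero).
Proof.
move=> HE; have S x n : sat unit_graph (econs n (econs x (econs E (enil M)))) =
    (unit_real x /\ n = one \/ ~ unit_real x /\ n = zero).
  by rewrite /unit_graph !(sat_in01, sat_or, sat_and, sat_neg, sat_eq) !(varE, evalE).
have [|x|C HC] := @arith_choice M [:: ty2] unit_graph (Var vz) (econs E (enil M))
  arith_unit_graph; first by rewrite varE.
  by case: (EM (unit_real x)) => Hx; [exists one|exists zero]; rewrite S; [left|right].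
by exists C => x; have := HC x; rewrite S => -[[? ?]|[? ?]].
Qed.

Lemma unit_real_eq (x y : M ty1) : is_real x -> is_real y -> req x y -> unit_real x -> unit_real y.
Proof. by move=> Hx Hy /(reqP Hx Hy) E [_]; rewrite E. Qed.

Lemma unit_set (Y : M ty2) : fun_unit Y -> inj_unit Y -> exists A Y', [/\ fun_real A,
  forall x, member x A <-> unit_real x, fun_nat Y' &
  forall x, unit_real x -> Y' $ x = Y $ x].
Proof.
move=> FY IY; have [E HE] := injection_kleene FY IY.
have [C HC] := unit_indicator HE.
have Ceq x y : is_real x -> is_real y -> req x y -> C $ x = C $ y.
  move=> Hx Hy xy; have yx : req y x by apply/reqP => //; apply/esym/reqP.
  case: (EM (unit_real x)) => ux.
    by rewrite !(HC _).1 //; apply: unit_real_eq xy ux.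
  by rewrite !(HC _).2 // => /(unit_real_eq Hy Hx yx).
have [A HA] : exists A : M (Arr ty1 ty1), forall x n, A $ x $ n = rmk (C $ x) zero one.
  pose t : tm [:: ty0; ty1; ty2] ty0 := qnat (App (Var (vs (vs vz))) (Var (vs vz))).
  exists (eval (lam (lam t)) (econs C (enil M))) => x n.
  have -> := ap_lam (lam t) (econs C (enil M)) x.
  have -> := ap_lam t (econs x (econs C (enil M))) n.
  exact: eval_qnat.
have AP x : is_real (A $ x) /\ rho (A $ x) = jN (C $ x).
  by rewrite -rv_nat; apply: const_real.
have [Y' HY'] : dfn (fun x => mul (C $ x) (Y $ x)) by dfn.
have Y'E x : unit_real x -> Y' $ x = Y $ x.
  by move=> ux; rewrite HY' (HC x).1 // mulC mul1.
have [z0 ez] := real_zeroP M.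
exists A, Y'; split=> //.
- split=> [x _|x y Hx Hy xy]; first exact: (AP x).1.
  by apply/reqP; [exact: (AP x).1|exact: (AP y).1|rewrite !(AP _).2 (Ceq x y)].
- move=> x; split=> [[Hx /(rltP z0 (AP x).1)]|ux].
    rewrite ez (AP x).2; case: (EM (unit_real x)) => // /(HC x).2 ->.
    by rewrite jN0 ltxx.
  split; first exact: ux.1.
  by apply/(rltP z0 (AP x).1); rewrite ez (AP x).2 (HC x).1 // jN1.
- move=> x y Hx Hy xy.
  case: (EM (unit_real x)) => ux.
    have uy := unit_real_eq Hx Hy xy ux.
    by rewrite !Y'E //; apply: FY.
  by rewrite !HY' -(Ceq x y Hx Hy xy) (HC x).2 // !(mulC zero) !mul0.
Qed.

End Principles.

(** * Hilbert's hotel *)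

Section Hotel.
Variable M : model.
Local Notation N := (M ty0).
Local Notation "f $ x" := (@ap M _ _ f x) (at level 11, left associativity).
Local Notation zero := (zero M).
Local Notation one := (one M).
Local Notation R := (cfield (Rc M)).

Definition room (k a b : N) : N := pair k (pair a b).

(** [r] is the point [e_k y], where [a - b] is the integral part of [y]. *)
Definition lodged (k a b : N) (r y : R) :=
  [/\ a = zero \/ b = zero, 0 <= y - jN a + jN b < 1 &
      r = (1 + (y - jN a + jN b)) * halfpow (add (room k a b) one)].

Lemma lodged_dyadic k a b r y : lodged k a b r y ->
  halfpow (add (room k a b) one) <= r < halfpow (room k a b).
Proof.
move=> [_ /andP[t0 t1] ->]; have := halfpow_gt0 (room k a b); rewrite halfpowS.
by move: t0 t1; set t := y - jN a + jN b => t0 t1 p0; apply/andP; split; nra.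
Qed.

Lemma dyadic_uniq (m m' : N) r : halfpow (add m one) <= r < halfpow m ->
  halfpow (add m' one) <= r < halfpow m' -> m = m'.
Proof.
move=> /andP[h1 h2] /andP[h3 h4]; case: (nlt_total m m') => // H.
  have : le (add m one) m' by apply/jN_le; rewrite jND jN1; apply: jN_discrete; apply/jN_lt.
  by move=> {H} /halfpow_le H; have := lt_le_trans h4 (le_trans H h1); rewrite ltxx.
have : le (add m' one) m by apply/jN_le; rewrite jND jN1; apply: jN_discrete; apply/jN_lt.
by move=> {H} /halfpow_le H; have := lt_le_trans h2 (le_trans H h3); rewrite ltxx.
Qed.

Lemma lodged_inj k a b k' a' b' r y y' : lodged k a b r y -> lodged k' a' b' r y' ->
  [/\ k = k', a = a', b = b' & y = y'].
Proof.
move=> L L'; have E := dyadic_uniq (lodged_dyadic L) (lodged_dyadic L').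
have [ek /pair_inj [ea eb]] := pair_inj E.
split=> //; move: L L' => [_ _ ->] [_ _]; rewrite E => /(mulIf (lt0r_neq0 (halfpow_gt0 _))).
by rewrite ea eb; lra.
Qed.

Lemma int_part_uniq (a b a' b' : N) (y : R) : a = zero \/ b = zero -> a' = zero \/ b' = zero ->
  0 <= y - jN a + jN b < 1 -> 0 <= y - jN a' + jN b' < 1 -> a = a' /\ b = b'.
Proof.
move=> ab ab' /andP[h1 h2] /andP[h3 h4].
have E : jN a + jN b' = jN a' + jN b.
  move=> {ab ab'}; rewrite -!jND; congr jN; case: (nlt_total (add a b') (add a' b)) => // /jN_lt;
    move=> /jN_discrete; rewrite !jND => ?; exfalso; lra.
have := jN_ge0 a; have := jN_ge0 b; have := jN_ge0 a'; have := jN_ge0 b'.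
by case: ab ab' E => -> [] ->; rewrite !jN0 => *; split; apply: jN_inj; rewrite ?jN0; lra.
Qed.

Lemma lodged_fun k a b a' b' r r' y : lodged k a b r y -> lodged k a' b' r' y -> r = r'.
Proof.
move=> [ab t ->] [ab' t' ->]; by have [-> ->] := int_part_uniq ab ab' t t'.
Qed.

Lemma lodged_unit k a b r y : lodged k a b r y -> 0 <= r <= 1.
Proof.
move=> /lodged_dyadic /andP[h1 h2]; have := halfpow_gt0 (add (room k a b) one).
have := halfpow_le1 (room k a b); move=> ? ?; apply/andP; lra.
Qed.

Lemma lodge k a b (y : M ty1) : is_real y -> a = zero \/ b = zero ->
  0 <= rho y - jN a + jN b < 1 -> exists x, unit_real x /\ lodged k a b (rho x) (rho y).
Proof.
move=> Hy ab t; have p0 := jN_pw_gt0 (add (room k a b) one).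
have [Hx ex] := affineP one (add one b) a p0 Hy.
have L : lodged k a b (rho (affine one (pw (add (room k a b) one)) (add one b) a y)) (rho y).
  by split=> //; rewrite ex jND jN1 /halfpow; congr (_ / _); ring.
by exists (affine one (pw (add (room k a b) one)) (add one b) a y); split=> //; split=> //;
  apply: lodged_unit L.
Qed.

Lemma jN_bound (r : R) : exists n, r < jN n.
Proof.
have [k rk] := cinj_bounded r; case: (lerP k 0) => k0.
  by exists zero; apply: lt_le_trans rk _; rewrite jN0 -cinj0 cinj_le.
have ik : 0 < k^-1 by rewrite invr_gt0.
have [n n0 nk] := ffield_gt0 ik.
exists n; apply: lt_le_trans rk _; rewrite /jN cinj_le.
have n0' : 0 < iN n by rewrite -iN0; apply/iN_lt.
by rewrite -lef_pV2 ?posrE.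
Qed.

Lemma floor_nonneg (E : M ty2) (x : M ty1) : kleene E -> is_real x -> 0 <= rho x ->
  exists n, jN n <= rho x < jN n + 1.
Proof.
move=> HE Hx x0; pose A : fm [:: ty0; ty1; ty2] := RealLe (rnat (Var vz)) (Var (vs vz)).
pose e := econs x (econs E (enil M)).
have S n : sat A (econs n e) <-> jN n <= rho x.
  rewrite /A sat_RealLe !varE leNgt.
  have [Hn en] := rnatP (econs n e) (Var vz); rewrite varE in en.
  split=> [H|/negP H]; [apply/negP => h; apply: H|move=> h; apply: H];
    by move: h; rewrite -en => /(rltP Hx Hn).
apply: contrapT => H; have [n] := jN_bound (rho x); rewrite ltNge => /negP; apply.
apply/S; apply: (@arith_ind M [:: ty1; ty2] A (Var (vs vz)) e).
- by rewrite /=; repeat split.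
- by rewrite !varE.
- by apply/S; rewrite jN0.
- move=> k /S Hk; apply/S; rewrite jND jN1 leNgt; apply/negP => Hk'; apply: H.
  by exists k; rewrite Hk Hk'.
Qed.

Lemma int_part (E : M ty2) (x : M ty1) : kleene E -> is_real x ->
  exists a b, (a = zero \/ b = zero) /\ 0 <= rho x - jN a + jN b < 1.
Proof.
move=> HE Hx; case: (lerP 0 (rho x)) => x0.
  have [n /andP[h1 h2]] := floor_nonneg HE Hx x0.
  by exists n, zero; split; [right|rewrite jN0; apply/andP; lra].
have [z0 ez] := real_zeroP M; have [Hd] := distP Hx z0; rewrite ez subr0 ltr0_norm // => ed.
have d0 : 0 <= rho (dist x (real_zero M)) by rewrite ed; lra.
have [n] := floor_nonneg HE Hd d0; rewrite ed => /andP[h1 h2].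
case: (lerP (- rho x) (jN n)) => h3.
  by exists zero, n; split; [left|rewrite jN0; apply/andP; lra].
by exists zero, (add n one); split; [left|rewrite jN0 jND jN1; apply/andP; lra].
Qed.

Definition room_tm G (k a b : tm G ty0) : tm G ty0 := npair k (npair a b).
Definition frac_tm G (k a b : tm G ty0) (x : tm G ty1) : tm G ty1 :=
  affine_tm (pow2 (App (App (Cst Plus) (room_tm k a b)) (Cst One))) (Cst One)
    (Cst Zero) (Cst One) x.
Definition guest_tm G (k a b : tm G ty0) (x : tm G ty1) : tm G ty1 :=
  affine_tm (pow2 (App (App (Cst Plus) (room_tm k a b)) (Cst One))) (Cst One)
    a (App (App (Cst Plus) b) (Cst One)) x.
Definition move_tm G (k a b j : tm G ty0) (x : tm G ty1) : tm G ty1 :=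
  affine_tm (pow2 (room_tm k a b)) (pow2 (room_tm j a b)) (Cst Zero) (Cst Zero) x.

Definition real_one : M ty1 := eval (rnat (Cst One)) (enil M).

Definition frac k a b x := affine (pw (add (room k a b) one)) one zero one x.
Definition guest k a b x := affine (pw (add (room k a b) one)) one a (add b one) x.
Definition move_ k a b j x := affine (pw (room k a b)) (pw (room j a b)) zero zero x.

Definition occupied_fm G (k a b : tm G ty0) (x : tm G ty1) (A : tm G (Arr ty1 ty1)) : fm G :=
  And (Or (FEq a (Cst Zero)) (FEq b (Cst Zero)))
    (And (RealLe (rnat (Cst Zero)) (frac_tm k a b x))
      (And (RealLt (frac_tm k a b x) (rnat (Cst One)))
        (And (Defs.mem (guest_tm k a b x) A) (Neg (in01 (guest_tm k a b x)))))).

Definition occupied k a b x A :=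
  (a = zero \/ b = zero) /\ ~ rlt (frac k a b x) (real_zero M) /\
  rlt (frac k a b x) real_one /\
  member (guest k a b x) A /\ ~ unit_real (guest k a b x).

Lemma eval_room G (e : env M G) k a b :
  eval (room_tm k a b) e = room (eval k e) (eval a e) (eval b e).
Proof. by rewrite /room_tm !eval_npair. Qed.

Lemma eval_frac G (e : env M G) k a b x :
  eval (frac_tm k a b x) e = frac (eval k e) (eval a e) (eval b e) (eval x e).
Proof. by rewrite /frac_tm eval_affine !(eval_pow2, eval_room, evalE). Qed.

Lemma eval_guest G (e : env M G) k a b x :
  eval (guest_tm k a b x) e = guest (eval k e) (eval a e) (eval b e) (eval x e).
Proof. by rewrite /guest_tm eval_affine !(eval_pow2, eval_room, evalE). Qed.

Lemma eval_move G (e : env M G) k a b j x :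
  eval (move_tm k a b j x) e =
  move_ (eval k e) (eval a e) (eval b e) (eval j e) (eval x e).
Proof. by rewrite /move_tm eval_affine !(eval_pow2, eval_room, evalE). Qed.

Lemma eval_real_one G (e : env M G) :
  eval (rnat (Cst One)) e = real_one.
Proof. by apply: extensional => n; rewrite /real_one /rnat !eval_fn !(ratE, varE, evalE). Qed.

Lemma sat_occupied G (e : env M G) k a b x A : sat (occupied_fm k a b x A) e =
  occupied (eval k e) (eval a e) (eval b e) (eval x e) (eval A e).
Proof.
rewrite /occupied_fm !(sat_mem, sat_in01, sat_RealLe, sat_RealLt, sat_and, sat_or, sat_eq, sat_neg).
by rewrite eval_real_zero eval_real_one eval_frac eval_guest.
Qed.

Lemma frac_guest_rho k a b x : is_real x ->
  [/\ is_real (frac k a b x), is_real (guest k a b x),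
      rho (frac k a b x) = rho x / halfpow (add (room k a b) one) - 1 &
      rho (guest k a b x) = rho x / halfpow (add (room k a b) one) - 1 + jN a - jN b].
Proof.
move=> Hx; have j1 : 0 < jN one by rewrite jN1.
have [? ef] := affineP (pw (add (room k a b) one)) zero one j1 Hx.
have [? eg] := affineP (pw (add (room k a b) one)) a (add b one) j1 Hx.
split=> //; rewrite /frac /guest ?ef ?eg !jNE /halfpow invrK divr1; ring.
Qed.

Variable A : M (Arr ty1 ty1).
Hypothesis FA : fun_real A.

Definition outsider y := member y A /\ ~ unit_real y.

Lemma member_eq x y : is_real x -> is_real y -> rho x = rho y -> member x A -> member y A.
Proof.
move=> Hx Hy xy [_ Ax]; split=> //; have [z0 ez] := real_zeroP M.
have Hxy : req x y by apply/reqP.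
have := FA.2 x y Hx Hy Hxy => /(reqP (FA.1 x Hx) (FA.1 y Hy)) E.
by move: Ax => /(rltP z0 (FA.1 x Hx)); rewrite E => /(rltP z0 (FA.1 y Hy)).
Qed.

Lemma outsider_eq x y : is_real x -> is_real y -> rho x = rho y -> outsider x -> outsider y.
Proof.
move=> Hx Hy xy [mx ux]; split; first exact: member_eq mx.
by move=> [_ uy]; apply: ux; split; rewrite ?xy.
Qed.

Lemma occupiedP k a b x : is_real x ->
  (occupied k a b x A <-> exists2 y, outsider y & lodged k a b (rho x) (rho y)).
Proof.
move=> Hx; have [Hf Hg ef eg] := frac_guest_rho k a b Hx.
have [z0 ez] := real_zeroP M.
have [o0 eo] : is_real real_one /\ rho real_one = 1.
  by have := rnatP (enil M) (Cst One); rewrite evalE jN1.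
have p0 := halfpow_gt0 (add (room k a b) one).
split.
  move=> [ab [/(rltP Hf z0) h1 [/(rltP Hf o0) h2 [mg ug]]]].
  exists (guest k a b x); first by split.
  split=> //.
    move: h1 h2; rewrite ez eo eg ef => /negP; rewrite -leNgt => h1 h2; apply/andP; lra.
  rewrite eg; set t := rho x / _.
  have -> : 1 + (t - 1 + jN a - jN b - jN a + jN b) = t by ring.
  by rewrite /t mulfVK ?lt0r_neq0.
move=> [y oy [ab t01 ex]].
have yE : rho y = rho (guest k a b x).
  by rewrite eg ex mulfK ?lt0r_neq0 //; ring.
have [mg ug] := outsider_eq oy.1.1 Hg yE oy.
split=> //; split; last split=> //.
  move=> /(rltP Hf z0); rewrite ez ef ex mulfK ?lt0r_neq0 //.
  by case/andP: t01; lra.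
apply/(rltP Hf o0); rewrite eo ef ex mulfK ?lt0r_neq0 //.
by case/andP: t01; lra.
Qed.

Lemma moveP k a b j x y : is_real x -> lodged k a b (rho x) y ->
  is_real (move_ k a b j x) /\ lodged j a b (rho (move_ k a b j x)) y.
Proof.
move=> Hx [ab t ex].
have [Hm em] := affineP (pw (room k a b)) zero zero (jN_pw_gt0 (room j a b)) Hx.
split=> //; split=> //; rewrite /move_ em jN0 subr0 addr0 ex !halfpowS.
have -> : jN (pw (room k a b)) = (halfpow (room k a b))^-1 by rewrite /halfpow invrK.
rewrite -/(halfpow (room j a b)); move: (halfpow (room j a b)) (lt0r_neq0 (halfpow_gt0 (room k a b))).
move: (halfpow (room k a b)) (1 + _) => p u q p0.
transitivity (u * (q / 2) * (p^-1 * p)); first ring.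
by rewrite mulVf // mulr1.
Qed.

Variable Y : M ty2.
Hypotheses (FY : fun_nat Y) (IY : injective_set Y A) (OY : onto_set Y A).
Hypothesis unit_sub : forall x, unit_real x -> member x A.
Variable E : M ty2.
Hypothesis HE : kleene E.

Definition hotel_fm : fm [:: ty0; ty1; Arr ty1 ty1; ty2; ty2] :=
  let occ : fm [:: ty0; ty0; ty0; ty0; ty1; Arr ty1 ty1; ty2; ty2] :=
    occupied_fm (Var (vs (vs vz))) (Var (vs vz)) (Var vz) (Var (vs (vs (vs (vs vz)))))
      (Var (vs (vs (vs (vs (vs vz)))))) in
  Or
    (Ex ty0 (Ex ty0 (Ex ty0 (And occ
      (Or
        (And (FEq (Var (vs (vs vz))) (Cst Zero))
           (FEq (Var (vs (vs (vs vz))))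
             (App (Var (vs (vs (vs (vs (vs (vs vz)))))))
               (guest_tm (Var (vs (vs vz))) (Var (vs vz)) (Var vz)
                 (Var (vs (vs (vs (vs vz)))))))))
        (Ex ty0
          (And (FEq (Var (vs (vs (vs vz)))) (App (App (Cst Plus) (Var vz)) (Cst One)))
             (FEq (Var (vs (vs (vs (vs vz)))))
               (App (Var (vs (vs (vs (vs (vs (vs (vs vz))))))))
                 (move_tm (Var (vs (vs (vs vz)))) (Var (vs (vs vz))) (Var (vs vz)) (Var vz)
                   (Var (vs (vs (vs (vs (vs vz))))))))))))))))
    (And (Neg (Ex ty0 (Ex ty0 (Ex ty0 occ))))
       (FEq (Var vz) (App (Var (vs (vs (vs vz)))) (Var (vs vz))))).

Lemma arith_hotel : arith hotel_fm.
Proof. by rewrite /=; repeat split. Qed.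

Lemma sat_hotel n x : sat hotel_fm (econs n (econs x (econs A (econs Y (econs E (enil M)))))) =
  ((exists k a b, occupied k a b x A /\
      (k = zero /\ n = Y $ (guest k a b x) \/
       exists j, k = add j one /\ n = Y $ (move_ k a b j x))) \/
   ~ (exists k a b, occupied k a b x A) /\ n = Y $ x).
Proof.
rewrite /hotel_fm sat_or; congr (_ \/ _).
  rewrite sat_Ex; apply: eq_exists => k; rewrite sat_Ex; apply: eq_exists => a.
  rewrite sat_Ex; apply: eq_exists => b; rewrite sat_and sat_occupied !varE.
  congr (_ /\ _); rewrite sat_or; congr (_ \/ _).
    by rewrite sat_and !sat_eq !(eval_guest, evalE).
  by rewrite sat_Ex; apply: eq_exists => j; rewrite sat_and !sat_eq !(eval_move, evalE).
rewrite sat_and sat_eq; congr (_ /\ _); rewrite sat_neg; congr (~ _).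
rewrite sat_Ex; apply: eq_exists => k; rewrite sat_Ex; apply: eq_exists => a.
by rewrite sat_Ex; apply: eq_exists => b; rewrite sat_occupied.
Qed.

Lemma hotel : exists Z : M ty2, forall x, is_real x ->
  [\/ exists a b y, [/\ outsider y, lodged zero a b (rho x) (rho y) & Z $ x = Y $ y],
      exists j a b y w, [/\ outsider y, lodged (add j one) a b (rho x) (rho y),
         is_real w, lodged j a b (rho w) (rho y) & Z $ x = Y $ w] |
      (forall k a b y, outsider y -> ~ lodged k a b (rho x) (rho y)) /\ Z $ x = Y $ x].
Proof.
have [|x|Z HZ] := @arith_choice M [:: Arr ty1 ty1; ty2; ty2] hotel_fm (Var (vs (vs vz)))
  (econs A (econs Y (econs E (enil M)))) arith_hotel; first by rewrite !varE.
  case: (EM (exists k a b, occupied k a b x A)) => [[k [a [b O]]]|H]; last first.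
    by exists (Y $ x); rewrite sat_hotel; right.
  case: (N_cases k) => k0.
    by exists (Y $ (guest k a b x)); rewrite sat_hotel; left; exists k, a, b; split=> //; left.
  exists (Y $ (move_ k a b (pred k) x)); rewrite sat_hotel; left; exists k, a, b; split=> //.
  by right; exists (pred k).
exists Z => x Hx; have := HZ x; rewrite sat_hotel.
case=> [[k [a [b [O [[k0 ZE]|[j [kj ZE]]]]]]]|[H ZE]].
- constructor 1; subst k; have [Hf Hg ef eg] := frac_guest_rho zero a b Hx.
  have [y oy L] := (occupiedP _ _ _ Hx).1 O.
  exists a, b, y; split=> //; rewrite ZE; apply: FY => //; first exact: oy.1.1.
  apply/reqP; rewrite ?eg //; first exact: oy.1.1.
  case: L => _ _ ->; rewrite mulfK ?lt0r_neq0 ?halfpow_gt0 //; ring.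
- constructor 2; subst k; have [y oy L] := (occupiedP _ _ _ Hx).1 O.
  have [Hm Lm] := moveP j Hx L.
  by exists j, a, b, y, (move_ (add j one) a b j x); split.
- constructor 3; split=> // k a b y oy L; apply: H; exists k, a, b.
  by apply/(occupiedP _ _ _ Hx); exists y.
Qed.

Lemma succ_neq0 (j : N) : add j one <> zero.
Proof. by move=> /(congr1 (@jN M)); rewrite jND jN1 jN0; have := jN_ge0 j; lra. Qed.

Lemma succ_inj (j j' : N) : add j one = add j' one -> j = j'.
Proof. by move=> /(congr1 (@jN M)); rewrite !jND => H; apply: jN_inj; lra. Qed.

Lemma hotel_bijection : exists Z : M ty2,
  [/\ fun_unit Z, inj_unit Z & forall n, exists x, unit_real x /\ Z $ x = n].
Proof.
have [Z HZ] := hotel; exists Z.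
have Yeq x y : is_real x -> is_real y -> rho x = rho y -> Y $ x = Y $ y.
  by move=> Hx Hy xy; apply: FY => //; apply/reqP.
have YI x y : member x A -> member y A -> Y $ x = Y $ y -> rho x = rho y.
  by move=> mx my /(IY mx my) /(reqP mx.1 my.1).
have LM k a b w y : is_real w -> lodged k a b (rho w) (rho y) -> unit_real w.
  by move=> Hw /lodged_unit.
split.
- move=> x x' ux ux' /(reqP ux.1 ux'.1) xx.
  case: (HZ x ux.1) => [[a [b [y [oy L ->]]]]|[j [a [b [y [w [oy L Hw Lw ->]]]]]]|[H ->]];
  case: (HZ x' ux'.1) => [[a' [b' [y' [oy' L' ->]]]]|[j' [a' [b' [y' [w' [oy' L' Hw' Lw' ->]]]]]]|[H' ->]];
  try (rewrite -xx in L'); try (by case: (H _ _ _ _ oy' L'));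
  try (by rewrite -xx in H'; case: (H' _ _ _ _ oy L)).
  + have [_ _ _ yy] := lodged_inj L L'; by apply: Yeq yy; [exact: oy.1.1|exact: oy'.1.1].
  + by have [/esym/succ_neq0 []] := lodged_inj L L'.
  + by have [/succ_neq0 []] := lodged_inj L L'.
  + have [/succ_inj ej ea eb yy] := lodged_inj L L'; subst j' a' b'.
    by apply: Yeq => //; rewrite -yy in Lw'; apply: lodged_fun Lw Lw'.
  + by apply: Yeq => //; [exact: ux.1|exact: ux'.1].
- move=> x x' ux ux' ZZ; apply/(reqP ux.1 ux'.1); move: ZZ.
  case: (HZ x ux.1) => [[a [b [y [oy L ->]]]]|[j [a [b [y [w [oy L Hw Lw ->]]]]]]|[H ->]];
  case: (HZ x' ux'.1) => [[a' [b' [y' [oy' L' ->]]]]|[j' [a' [b' [y' [w' [oy' L' Hw' Lw' ->]]]]]]|[H' ->]].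
  + move=> /(YI _ _ oy.1 oy'.1) yy; rewrite -yy in L'; exact: lodged_fun L L'.
  + have uw := LM _ _ _ _ _ Hw' Lw'.
    move=> /(YI _ _ oy.1 (unit_sub uw)) yw; case: oy.2; split; first exact: oy.1.1.
    by rewrite yw; exact: uw.2.
  + move=> /(YI _ _ oy.1 (unit_sub ux')) yw; case: oy.2; split; first exact: oy.1.1.
    by rewrite yw; exact: ux'.2.
  + have uw := LM _ _ _ _ _ Hw Lw.
    move=> /(YI _ _ (unit_sub uw) oy'.1) yw; case: oy'.2; split; first exact: oy'.1.1.
    by rewrite -yw; exact: uw.2.
  + have uw := LM _ _ _ _ _ Hw Lw; have uw' := LM _ _ _ _ _ Hw' Lw'.
    move=> /(YI _ _ (unit_sub uw) (unit_sub uw')) ww; rewrite -ww in Lw'.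
    have [ej ea eb yy] := lodged_inj Lw Lw'; subst j' a' b'.
    by rewrite -yy in L'; apply: lodged_fun L L'.
  + have uw := LM _ _ _ _ _ Hw Lw.
    move=> /(YI _ _ (unit_sub uw) (unit_sub ux')) wx; rewrite wx in Lw.
    by case: (H' _ _ _ _ oy Lw).
  + move=> /(YI _ _ (unit_sub ux) oy'.1) yw; case: oy'.2; split; first exact: oy'.1.1.
    by rewrite -yw; exact: ux.2.
  + have uw := LM _ _ _ _ _ Hw' Lw'.
    move=> /(YI _ _ (unit_sub ux) (unit_sub uw)) wx; rewrite -wx in Lw'.
    by case: (H _ _ _ _ oy' Lw').
  + exact: (YI _ _ (unit_sub ux) (unit_sub ux')).
- move=> n; have [v [mv <-]] := OY n.
  case: (EM (unit_real v)) => uv; last first.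
    have [a [b [ab t]]] := int_part HE mv.1.
    have [x [ux L]] := lodge zero mv.1 ab t; exists x; split=> //.
    have ov : outsider v by [].
    case: (HZ x ux.1) => [[a' [b' [y' [oy' L' ->]]]]|[j' [a' [b' [y' [w' [oy' L' _ _ _]]]]]]|[H _]].
    + have [_ _ _ yy] := lodged_inj L L'; by apply: Yeq; [exact: oy'.1.1|exact: mv.1|].
    + by have [/esym/succ_neq0 []] := lodged_inj L L'.
    + by case: (H _ _ _ _ ov L).
  case: (EM (exists k a b y, outsider y /\ lodged k a b (rho v) (rho y))).
    move=> [k [a [b [y [oy L]]]]]; have [ab t _] := L.
    have [x [ux Lx]] := lodge (add k one) oy.1.1 ab t; exists x; split=> //.
    case: (HZ x ux.1) => [[a' [b' [y' [oy' L' ->]]]]|[j' [a' [b' [y' [w' [oy' L' Hw' Lw' ->]]]]]]|[H _]].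
    + by have [/succ_neq0 []] := lodged_inj Lx L'.
    + have [/succ_inj ej ea eb yy] := lodged_inj Lx L'; subst j' a' b'.
      by rewrite -yy in Lw'; apply: Yeq => //; [exact: mv.1|apply: lodged_fun Lw' L].
    + by case: (H _ _ _ _ oy Lx).
  move=> NL; exists v; split=> //.
  case: (HZ v mv.1) => [[a' [b' [y' [oy' L' _]]]]|[j' [a' [b' [y' [w' [oy' L' _ _ _]]]]]]|[]//].
    by case: NL; exists zero, a', b', y'.
  by case: NL; exists (add j' one), a', b', y'.
Qed.

End Hotel.

(** * The equivalences *)

Section Equivalences.
Variable M : model.
Local Notation e0 := (enil M).

Lemma sat_NIN : sat NIN e0 = forall Y : M ty2, fun_unit Y -> collides Y.
Proof.
rewrite /NIN sat_all; apply: eq_forall => Y.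
by rewrite satE sat_Fun01N sat_collision !varE.
Qed.

Lemma sat_NBI : sat NBI e0 = forall Y : M ty2, fun_unit Y ->
  collides Y \/ exists n, forall x, unit_real x -> ap Y x <> n.
Proof.
rewrite /NBI sat_all; apply: eq_forall => Y.
rewrite satE sat_Fun01N sat_or sat_collision !varE; congr (_ -> _ \/ _).
rewrite sat_ex; apply: eq_exists => n; rewrite sat_all; apply: eq_forall => x.
by rewrite satE sat_in01 sat_neg sat_eq !(varE, evalE).
Qed.

Definition is_countable (A : M (Arr ty1 ty1)) :=
  exists Y : M ty2, fun_nat Y /\ injective_set Y A.
Definition is_strongly_countable (A : M (Arr ty1 ty1)) :=
  exists Y : M ty2, fun_nat Y /\ injective_set Y A /\ onto_set Y A.

Lemma sat_A : sat principle_A e0 =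
  forall A : M (Arr ty1 ty1), fun_real A -> is_countable A -> misses A.
Proof.
rewrite /principle_A sat_all; apply: eq_forall => A.
by rewrite !(sat_FunRR, sat_countable, sat_misses, satE) !varE.
Qed.

Lemma sat_A' : sat principle_A' e0 =
  forall A : M (Arr ty1 ty1), fun_real A -> is_strongly_countable A -> misses A.
Proof.
rewrite /principle_A' sat_all; apply: eq_forall => A.
by rewrite !(sat_FunRR, sat_strongly_countable, sat_misses, satE) !varE.
Qed.

Lemma sat_B : sat principle_B e0 =
  forall A : M (Arr ty1 ty1), fun_real A -> (forall x, member x A -> unit_real x) ->
    is_countable A -> ~ perfect_set A.
Proof.
rewrite /principle_B sat_all; apply: eq_forall => A.
by rewrite !(sat_FunRR, sat_countable, sat_sub01, sat_perfect, satE) !varE.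
Qed.

Lemma sat_B_nonempty : sat principle_B_nonempty e0 =
  forall A : M (Arr ty1 ty1), fun_real A -> (forall x, member x A -> unit_real x) ->
    (exists x, member x A) -> is_countable A -> ~ perfect_set A.
Proof.
rewrite /principle_B_nonempty sat_all; apply: eq_forall => A.
by rewrite !(sat_FunRR, sat_countable, sat_sub01, sat_nonempty, sat_perfect, satE) !varE.
Qed.

Lemma sat_B' : sat principle_B' e0 =
  forall A : M (Arr ty1 ty1), fun_real A -> (forall x, member x A -> unit_real x) ->
    is_strongly_countable A -> ~ perfect_set A.
Proof.
rewrite /principle_B' sat_all; apply: eq_forall => A.
by rewrite !(sat_FunRR, sat_strongly_countable, sat_sub01, sat_perfect, satE) !varE.
Qed.

Lemma fun_nat_unit (Y : M ty2) : fun_nat Y -> fun_unit Y.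
Proof. by move=> FY x y ux uy; apply: FY; [exact: ux.1|exact: uy.1]. Qed.

Lemma not_misses (A : M (Arr ty1 ty1)) : fun_real A -> ~ misses A ->
  forall x, unit_real x -> member x A.
Proof.
move=> FA H x ux; apply: contrapT => N; apply: H; exists x; split=> // y my.
move=> /(reqP ux.1 my.1) xy; apply: N; exact: member_eq FA _ _ my.1 ux.1 (esym xy) my.
Qed.

Lemma inj_unit_set (A : M (Arr ty1 ty1)) Y : (forall x, unit_real x -> member x A) ->
  injective_set Y A -> inj_unit Y.
Proof. by move=> UA IY x y ux uy; apply: IY; apply: UA. Qed.

Lemma inj_not_collides (Y : M ty2) : inj_unit Y -> ~ collides Y.
Proof. by move=> IY [x [y [ux [uy [N E]]]]]; apply: N; apply: IY. Qed.

Lemma NIN_A : sat NIN e0 -> sat principle_A e0.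
Proof.
rewrite sat_NIN sat_A => H A FA [Y [FY IY]]; apply: contrapT => /(not_misses FA) UA.
exact: inj_not_collides (inj_unit_set UA IY) (H Y (fun_nat_unit FY)).
Qed.

Lemma NBI_A' : sat NBI e0 -> sat principle_A' e0.
Proof.
rewrite sat_NBI sat_A' => H A FA [Y [FY [IY OY]]]; apply: contrapT => /(not_misses FA) UA.
have [E HE] := injection_kleene (fun_nat_unit FY) (inj_unit_set UA IY).
have [Z [FZ IZ OZ]] := hotel_bijection FA FY IY OY UA HE.
case: (H Z FZ) => [|[n Hn]]; first exact: inj_not_collides.
by have [x [ux]] := OZ n; apply: Hn.
Qed.

Lemma unit_countable (Y : M ty2) : fun_unit Y -> ~ collides Y ->
  exists A : M (Arr ty1 ty1), [/\ fun_real A, forall x, member x A <-> unit_real x,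
    is_countable A & (forall n, exists2 x, unit_real x & ap Y x = n) ->
    is_strongly_countable A].
Proof.
move=> FY /collides_inj IY; have [A [Y' [FA HA FY' EY]]] := unit_set FY IY.
have IY' : injective_set Y' A.
  by move=> x y /HA ux /HA uy; rewrite !EY //; apply: IY.
exists A; split=> //; first by exists Y'.
move=> OY; exists Y'; split=> //; split=> // n; have [x ux xn] := OY n.
by exists x; rewrite HA EY.
Qed.

Lemma unit_not_misses (A : M (Arr ty1 ty1)) :
  (forall x, member x A <-> unit_real x) -> ~ misses A.
Proof.
move=> HA [y [uy]] /(_ y); rewrite HA => /(_ uy); apply.
exact: ((reqP uy.1 uy.1).2 erefl).
Qed.

Lemma not_NIN (Y : M ty2) : ~ (fun_unit Y -> collides Y) -> exists A : M (Arr ty1 ty1),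
  [/\ fun_real A, forall x, member x A <-> unit_real x & is_countable A].
Proof. by move=> /not_implyP [FY /(unit_countable FY) [A [FA HA CA _]]]; exists A. Qed.

Lemma not_NBI (Y : M ty2) :
  ~ (fun_unit Y -> collides Y \/ exists n, forall x, unit_real x -> ap Y x <> n) ->
  exists A : M (Arr ty1 ty1),
  [/\ fun_real A, forall x, member x A <-> unit_real x & is_strongly_countable A].
Proof.
move=> /not_implyP [FY /not_orP [NC NN]]; have [A [FA HA _ CA]] := unit_countable FY NC.
exists A; split=> //; apply: CA => n; apply: contrapT => H; apply: NN; exists n => x ux xn.
by apply: H; exists x.
Qed.

Lemma A_NIN : sat principle_A e0 -> sat NIN e0.
Proof.
rewrite sat_NIN sat_A => H Y; apply: contrapT => /not_NIN [A [FA HA CA]].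
exact: unit_not_misses HA (H A FA CA).
Qed.

Lemma A'_NBI : sat principle_A' e0 -> sat NBI e0.
Proof.
rewrite sat_NBI sat_A' => H Y; apply: contrapT => /not_NBI [A [FA HA CA]].
exact: unit_not_misses HA (H A FA CA).
Qed.

Lemma B_nonempty_NIN : sat principle_B_nonempty e0 -> sat NIN e0.
Proof.
rewrite sat_NIN sat_B_nonempty => H Y; apply: contrapT => /not_NIN [A [FA HA CA]].
apply: (H A FA _ _ CA (perfect_unit HA)) => [x /HA //|].
by exists (real_zero M); apply/HA/unit_zero.
Qed.

Lemma B_NIN : sat principle_B e0 -> sat NIN e0.
Proof.
rewrite sat_B => H; apply: B_nonempty_NIN; rewrite sat_B_nonempty => A FA SA _.
exact: H.
Qed.

Lemma B'_NBI : sat principle_B' e0 -> sat NBI e0.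
Proof.
rewrite sat_NBI sat_B' => H Y; apply: contrapT => /not_NBI [A [FA HA CA]].
by apply: (H A FA _ CA (perfect_unit HA)) => x /HA.
Qed.

End Equivalences.

Theorem main :
  RCA0w_proves (Iff NIN principle_A) /\
  RCA0w_proves (FImp principle_B NIN) /\
  RCA0w_proves (FImp principle_B_nonempty NIN) /\
  RCA0w_proves (Iff NBI principle_A') /\
  RCA0w_proves (FImp principle_B' NBI).
Proof.
split; [|split; [|split; [|split]]]; apply: completeness => M.
- by rewrite sat_iff; split; [exact: NIN_A|exact: A_NIN].
- by rewrite satE; apply: B_NIN.
- by rewrite satE; apply: B_nonempty_NIN.
- by rewrite sat_iff; split; [exact: NBI_A'|exact: A'_NBI].
- by rewrite satE; apply: B'_NBI.
Qed.

End Completeness.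

From Pilot Require Import Defs.

Theorem theorem3p10 :
  RCA0w_proves (NIN <==> principle_A) /\
  RCA0w_proves (principle_B ==> NIN) /\
  RCA0w_proves (principle_B_nonempty ==> NIN) /\
  RCA0w_proves (NBI <==> principle_A') /\
  RCA0w_proves (principle_B' ==> NBI).
Proof. exact Completeness.main. Qed.
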